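(* There exist $F_0\in Y$ (representing a Lorenz map) and a matrix $\Gamma$ (regarded as a finite-rank bounded linear operator on $Y$) such that the simplified Newton operator $\Phi=(\Gamma-I)^{-1}(\Gamma-T)$ is well defined and satisfies: (1) $\|D\Phi_F\|<0.2$ for all $F\in Y$ with $\|F-F_0\|\le10^{-7}$; (2) $\|\Phi F_0-F_0\|<5\cdot10^{-9}$; (3) $\|(\Gamma-e^{it}I)^{-1}(\Gamma-DT_F)\|<0.9$ for all $t\in\mathbb{R}$ and all $F\in Y$ with $\|F-F_0\|\le10^{-7}$.
   Context: Let $X$ be the real Banach space of analytic functions $f(z)=\sum_{k\ge0}a_kz^k$ on the open unit disk with $a_k\in\mathbb{R}$ and $\|f\|=\sum_k|a_k|<\infty$. Let $Y=X\times X$ with norm $\|(f,g)\|=\|f\|+\|g\|$. $I$ is the identity on $Y$; norms of linear operators are operator norms (in (3), on the complexification of $Y$, with the corresponding $\ell^1$-norm of complex coefficients). Fix $s=2.2$ and $\tau=0.5$. The operator $T$ is defined by $T(f,g)=(\hat f,\hat g)$, where $$\lambda=-f\big([f(0)^2-1]/s\big),\qquad u(w)=f\big(\lambda^2[w+\tfrac1s]-\tfrac1s\big)^2,\qquad \hat f(w)=\lambda^{-1}\big\{-1+u(w)\,g\big(u(w)/\tau\big)\big\},$$ $$v(w)=\lambda^2\tau w\, g(\lambda^2 w),\qquad \hat g(w)=\frac{1}{\tau w}\Big\{1+\lambda^{-1}f\Big(\tfrac1s f\big(v(w)[v(w)-2]/s\big)^2-\tfrac1s\Big)\Big\}$$ (the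 singularity of $\hat g$ at $w=0$ is removable). It is considered on pairs $(f,g)\in Y$ for which $\lambda\ne0$ and all compositions are well defined (for $w$ in the closed unit disk all arguments of $f$ and $g$ lie in the open unit disk); there $T$ is Fréchet differentiable with compact derivative $DT_{(f,g)}$. ''Well defined'' for $\Phi$ includes that $T$ is defined on the closed ball $\{F:\|F-F_0\|\le10^{-7}\}$ and that $\Gamma-I$ is invertible; (3) includes invertibility of $\Gamma-e^{it}I$. A pair $(f,g)\in Y$ represents the Lorenz map $F$ on an interval $[-1,r]$ given by $F(x)=\varphi(x^2)$ for $x\in(-1,0)$ and $F(x)=\psi(x^2)$ for $x\in(0,r)$, with $\varphi(z)=f((z-1)/s)$ for $|z-1|<s$ and $\psi(z)=-1+z\,g(z/\tau)$ for $|z|<\tau$. Here a Lorenz map on $[-1,r]$, $r>0$, is a monotone increasing continuous $F:[-1,r]\setminus\{0\}\to[-1,r]$ with $\lim_{x\uparrow0}F(x)=r$, $\lim_{x\downarrow0}F(x)=-1$. A $2d\times2d$ real matrix acts on $Y$ via the coefficients of $z^0,\dots,z^{d-1}$ of the two components (and is zero on pairs $(z^dh_1,z^dh_2)$ with $h_1,h_2\in X$); the paper takes $d=13$. *)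

(* Defs.v *)
From Stdlib Require Import Reals Lra Lia Arith.
From Stdlib Require Import FunctionalExtensionality ProofIrrelevance ClassicalEpsilon.
From Coquelicot Require Import Coquelicot.

Open Scope R_scope.

Section NormUniform.

Context {K : AbsRing} {V : ModuleSpace K} (N : V -> R).
Hypothesis N_triangle : forall x y : V, N (plus x y) <= N x + N y.
Hypothesis N_scal : forall (l : K) (x : V), N (scal l x) <= abs l * N x.

Definition norm_ball (x : V) (e : R) (y : V) : Prop := N (minus y x) < e.

Lemma norm_ball_center (x : V) (e : posreal) : norm_ball x e x.
Proof.
unfold norm_ball; rewrite minus_eq_zero.
assert (H := N_scal zero zero).
rewrite abs_zero, Rmult_0_l, scal_zero_r in H.
apply Rle_lt_trans with (1 := H); apply cond_pos.
Qed.

Lemma norm_ball_sym (x y : V) (e : R) : norm_ball x e y -> norm_ball y e x.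
Proof.
unfold norm_ball; intros H.
rewrite <- (opp_minus y x), <- scal_opp_one.
apply Rle_lt_trans with (1 := N_scal _ _).
now rewrite abs_opp_one, Rmult_1_l.
Qed.

Lemma norm_ball_triangle (x y z : V) (e1 e2 : R) :
  norm_ball x e1 y -> norm_ball y e2 z -> norm_ball x (e1 + e2) z.
Proof.
unfold norm_ball; intros H1 H2.
rewrite (minus_trans y z x).
apply Rle_lt_trans with (1 := N_triangle _ _); lra.
Qed.

Definition norm_UniformSpace_mixin : UniformSpace.mixin_of V :=
  UniformSpace.Mixin V zero norm_ball norm_ball_center norm_ball_sym
    norm_ball_triangle.

End NormUniform.

(** [l1 K] is the space of analytic functions [sum_k a_k z^k] on the open unit
    disk with [a_k] in [K] and [sum_k |a_k|] finite; a function is represented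
    by the sequence of its Taylor coefficients at 0. *)

Record l1 (K : AbsRing) : Type := L1 {
  coef :> nat -> K;
  l1_summable : ex_series (fun k => abs (coef k)) }.
Arguments L1 {K} coef l1_summable.
Arguments coef {K} _ _.
Arguments l1_summable {K} _.

Section L1Module.

Context {K : AbsRing}.

Lemma l1_eq (a b : l1 K) : (forall k, a k = b k) -> a = b.
Proof.
destruct a as [a Ha], b as [b Hb]; simpl; intros H.
apply functional_extensionality in H; subst b.
now rewrite (proof_irrelevance _ Ha Hb).
Qed.

Lemma summable_le (a : nat -> K) (b : nat -> R) :
  (forall k, abs (a k) <= b k) -> ex_series b -> ex_series (fun k => abs (a k)).
Proof.
intros H Hb; apply (@ex_series_le R_AbsRing R_CompleteNormedModule _ b); auto.
intros k; change (Rabs (abs (a k)) <= b k).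
rewrite Rabs_pos_eq; [apply H | apply abs_ge_0].
Qed.

Lemma l1_zero_summable : ex_series (fun _ : nat => abs (@zero K)).
Proof.
exists 0; apply is_series_ext with (fun _ : nat => @zero R_AbelianMonoid).
- intros _; now rewrite abs_zero.
- apply filterlim_ext with (fun _ : nat => 0).
  + intros n; symmetry; now rewrite sum_n_const, Rmult_0_r.
  + apply filterlim_const.
Qed.

Definition l1_zero : l1 K := L1 (fun _ => zero) l1_zero_summable.

Definition l1_plus (a b : l1 K) : l1 K :=
  L1 (fun k => plus (a k) (b k))
    (summable_le _ _ (fun k => abs_triangle (a k) (b k))
      (ex_series_plus _ _ (l1_summable a) (l1_summable b))).

Definition l1_scal (c : K) (a : l1 K) : l1 K :=
  L1 (fun k => mult c (a k))
    (summable_le _ _ (fun k => abs_mult c (a k))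
      (ex_series_scal_l (abs c) _ (l1_summable a))).

Definition l1_opp (a : l1 K) : l1 K :=
  L1 (fun k => opp (a k))
    (summable_le _ _ (fun k => Req_le _ _ (abs_opp (a k))) (l1_summable a)).

Definition l1_AbelianMonoid_mixin : AbelianMonoid.mixin_of (l1 K).
Proof.
apply (AbelianMonoid.Mixin (l1 K) l1_plus l1_zero).
- intros a b; apply l1_eq; intros k; apply plus_comm.
- intros a b c; apply l1_eq; intros k; apply plus_assoc.
- intros a; apply l1_eq; intros k; apply plus_zero_r.
Defined.

Canonical l1_AbelianMonoid := AbelianMonoid.Pack _ l1_AbelianMonoid_mixin (l1 K).

Definition l1_AbelianGroup_mixin : AbelianGroup.mixin_of l1_AbelianMonoid.
Proof.
apply (AbelianGroup.Mixin l1_AbelianMonoid l1_opp).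
intros a; apply l1_eq; intros k; exact (plus_opp_r (a k)).
Defined.

Canonical l1_AbelianGroup :=
  AbelianGroup.Pack _ (AbelianGroup.Class _ _ l1_AbelianGroup_mixin) (l1 K).

Definition l1_ModuleSpace_mixin : ModuleSpace.mixin_of K l1_AbelianGroup.
Proof.
apply (ModuleSpace.Mixin K l1_AbelianGroup l1_scal).
- intros x y a; apply l1_eq; intros k; apply mult_assoc.
- intros a; apply l1_eq; intros k; apply mult_one_l.
- intros x a b; apply l1_eq; intros k; exact (mult_distr_l x (a k) (b k)).
- intros x y a; apply l1_eq; intros k; exact (mult_distr_r x y (a k)).
Defined.

Canonical l1_ModuleSpace :=
  ModuleSpace.Pack K _ (ModuleSpace.Class K _ _ l1_ModuleSpace_mixin) (l1 K).

Definition l1_norm (a : l1 K) : R := Series (fun k => abs (a k)).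

Lemma l1_norm_triangle (a b : l1 K) :
  l1_norm (plus a b) <= l1_norm a + l1_norm b.
Proof.
unfold l1_norm; rewrite <- Series_plus by apply l1_summable.
apply Series_le.
- intros k; split; [apply abs_ge_0 | exact (abs_triangle (a k) (b k))].
- exact (ex_series_plus _ _ (l1_summable a) (l1_summable b)).
Qed.

Lemma l1_norm_scal (c : K) (a : l1 K) : l1_norm (scal c a) <= abs c * l1_norm a.
Proof.
unfold l1_norm; rewrite <- Series_scal_l.
apply Series_le.
- intros k; split; [apply abs_ge_0 | exact (abs_mult c (a k))].
- exact (ex_series_scal_l (abs c) _ (l1_summable a)).
Qed.

Lemma l1_abs_coef_le (a : l1 K) (k : nat) : abs (a k) <= l1_norm a.
Proof.
apply Rle_trans with (sum_n (fun j => abs (a j)) k).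
- destruct k as [|k]; [rewrite sum_O; apply Rle_refl|].
  rewrite sum_Sn; change (plus ?x ?y) with (x + y).
  assert (0 <= sum_n (fun j => abs (a j)) k); [|lra].
  induction k as [|k IH]; [rewrite sum_O; apply abs_ge_0|].
  rewrite sum_Sn; change (plus ?x ?y) with (x + y).
  assert (H := abs_ge_0 (a (S k))); lra.
- apply is_lim_seq_incr_compare.
  + apply (Series_correct _ (l1_summable a)).
  + intros n; rewrite sum_Sn; change (plus ?x ?y) with (x + y).
    assert (H := abs_ge_0 (a (S n))); lra.
Qed.

Lemma l1_norm_eq_zero (a : l1 K) : l1_norm a = 0 -> a = zero.
Proof.
intros H; apply l1_eq; intros k; apply abs_eq_zero.
apply Rle_antisym; [rewrite <- H; apply l1_abs_coef_le | apply abs_ge_0].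
Qed.

Lemma l1_norm_ge_0 (a : l1 K) : 0 <= l1_norm a.
Proof. apply Rle_trans with (2 := l1_abs_coef_le a 0); apply abs_ge_0. Qed.

Canonical l1_UniformSpace :=
  UniformSpace.Pack (l1 K)
    (norm_UniformSpace_mixin l1_norm l1_norm_triangle l1_norm_scal) (l1 K).

Canonical l1_NormedModuleAux :=
  NormedModuleAux.Pack K (l1 K)
    (NormedModuleAux.Class K _ (ModuleSpace.class K l1_ModuleSpace)
       (UniformSpace.class l1_UniformSpace)) (l1 K).

Definition l1_NormedModule_mixin : NormedModule.mixin_of K l1_NormedModuleAux.
Proof.
apply (NormedModule.Mixin K l1_NormedModuleAux l1_norm 1).
- exact l1_norm_triangle.
- exact l1_norm_scal.
- intros x y e H; exact H.
- intros x y e H; rewrite Rmult_1_l; exact H.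
- exact l1_norm_eq_zero.
Defined.

Canonical l1_NormedModule :=
  NormedModule.Pack K (l1 K)
    (NormedModule.Class K _ _ l1_NormedModule_mixin) (l1 K).

End L1Module.

(** Pairs [(f, g)] with norm [||f|| + ||g||]. This is a separate record and not
    a product type because Coquelicot's canonical norm on [U * V] is the
    Euclidean combination of the two norms. *)

Record l1_pair (K : AbsRing) : Type := Pair { pf : l1 K; pg : l1 K }.
Arguments Pair {K} pf pg.
Arguments pf {K} _.
Arguments pg {K} _.

Section PairModule.

Context {K : AbsRing}.

Lemma pair_eq (F G : l1_pair K) : pf F = pf G -> pg F = pg G -> F = G.
Proof. destruct F, G; simpl; intros; subst; reflexivity. Qed.

Definition pair_AbelianMonoid_mixin : AbelianMonoid.mixin_of (l1_pair K).
Proof.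
apply (AbelianMonoid.Mixin (l1_pair K)
  (fun F G => Pair (plus (pf F) (pf G)) (plus (pg F) (pg G))) (Pair zero zero)).
- intros F G; apply pair_eq; apply plus_comm.
- intros F G H; apply pair_eq; apply plus_assoc.
- intros F; apply pair_eq; apply plus_zero_r.
Defined.

Canonical pair_AbelianMonoid :=
  AbelianMonoid.Pack _ pair_AbelianMonoid_mixin (l1_pair K).

Definition pair_AbelianGroup_mixin : AbelianGroup.mixin_of pair_AbelianMonoid.
Proof.
apply (AbelianGroup.Mixin pair_AbelianMonoid
  (fun F => Pair (opp (pf F)) (opp (pg F)))).
intros F; apply pair_eq; [exact (plus_opp_r (pf F)) | exact (plus_opp_r (pg F))].
Defined.

Canonical pair_AbelianGroup :=
  AbelianGroup.Pack _ (AbelianGroup.Class _ _ pair_AbelianGroup_mixin) (l1_pair K).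

Definition pair_ModuleSpace_mixin : ModuleSpace.mixin_of K pair_AbelianGroup.
Proof.
apply (ModuleSpace.Mixin K pair_AbelianGroup
  (fun c F => Pair (scal c (pf F)) (scal c (pg F)))).
- intros x y F; apply pair_eq; apply scal_assoc.
- intros F; apply pair_eq; apply @scal_one.
- intros x F G; apply pair_eq; [exact (scal_distr_l x (pf F) (pf G)) | exact (scal_distr_l x (pg F) (pg G))].
- intros x y F; apply pair_eq; [exact (scal_distr_r x y (pf F)) | exact (scal_distr_r x y (pg F))].
Defined.

Canonical pair_ModuleSpace :=
  ModuleSpace.Pack K _ (ModuleSpace.Class K _ _ pair_ModuleSpace_mixin) (l1_pair K).

Definition pair_norm (F : l1_pair K) : R := norm (pf F) + norm (pg F).

Lemma pair_norm_triangle (F G : l1_pair K) :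
  pair_norm (plus F G) <= pair_norm F + pair_norm G.
Proof.
apply Rle_trans with
  ((norm (pf F) + norm (pf G)) + (norm (pg F) + norm (pg G))).
- exact (Rplus_le_compat _ _ _ _ (norm_triangle (pf F) (pf G))
    (norm_triangle (pg F) (pg G))).
- unfold pair_norm; lra.
Qed.

Lemma pair_norm_scal (c : K) (F : l1_pair K) :
  pair_norm (scal c F) <= abs c * pair_norm F.
Proof.
unfold pair_norm; rewrite Rmult_plus_distr_l.
exact (Rplus_le_compat _ _ _ _ (norm_scal c (pf F)) (norm_scal c (pg F))).
Qed.

Lemma pair_norm_eq_zero (F : l1_pair K) : pair_norm F = 0 -> F = zero.
Proof.
unfold pair_norm; intros H.
assert (Hf := norm_ge_0 (pf F)); assert (Hg := norm_ge_0 (pg F)).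
apply pair_eq; [apply (norm_eq_zero (pf F)) | apply (norm_eq_zero (pg F))]; lra.
Qed.

Canonical pair_UniformSpace :=
  UniformSpace.Pack (l1_pair K)
    (norm_UniformSpace_mixin pair_norm pair_norm_triangle pair_norm_scal)
    (l1_pair K).

Canonical pair_NormedModuleAux :=
  NormedModuleAux.Pack K (l1_pair K)
    (NormedModuleAux.Class K _ (ModuleSpace.class K pair_ModuleSpace)
       (UniformSpace.class pair_UniformSpace)) (l1_pair K).

Definition pair_NormedModule_mixin : NormedModule.mixin_of K pair_NormedModuleAux.
Proof.
apply (NormedModule.Mixin K pair_NormedModuleAux pair_norm 1).
- exact pair_norm_triangle.
- exact pair_norm_scal.
- intros x y e H; exact H.
- intros x y e H; rewrite Rmult_1_l; exact H.
- exact pair_norm_eq_zero.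
Defined.

Canonical pair_NormedModule :=
  NormedModule.Pack K (l1_pair K)
    (NormedModule.Class K _ _ pair_NormedModule_mixin) (l1_pair K).

End PairModule.

Notation X := (l1 R_AbsRing).
Notation Y := (l1_pair R_AbsRing).
Notation YC := (l1_pair C_AbsRing).

Section Operators.

Context {K : AbsRing} {V W : NormedModule K}.

(** Value [p_infty] for an unbounded operator. *)
Definition opnorm (A : V -> W) : Rbar :=
  Lub_Rbar (fun m => exists x : V, norm x <= 1 /\ m = norm (A x)).

(** [is_linear] includes boundedness. *)
Definition is_inverse (A : V -> W) (B : W -> V) : Prop :=
  is_linear B /\ (forall x, B (A x) = x) /\ (forall y, A (B y) = y).

Definition invertible (A : V -> W) : Prop := exists B, is_inverse A B.

Definition inv_op (A : V -> W) : W -> V :=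
  epsilon (inhabits (fun _ => zero)) (is_inverse A).

End Operators.

Lemma RI_l1_summable (a b : X) :
  ex_series (fun k => @abs C_AbsRing ((a k, b k) : C)).
Proof.
refine (summable_le (K := C_AbsRing) _ (fun k => Rabs (a k) + Rabs (b k)) _
  (ex_series_plus _ _ (l1_summable a) (l1_summable b))).
intros k; change (Cmod (a k, b k) <= Rabs (a k) + Rabs (b k)).
replace ((a k, b k) : C) with (Cplus (RtoC (a k)) (Cmult Ci (RtoC (b k)))).
2: { unfold Cplus, Cmult, Ci, RtoC; simpl; f_equal; ring. }
apply Rle_trans with (1 := Cmod_triangle _ _).
rewrite Cmod_mult, !Cmod_R, Cmod_Ci; lra.
Qed.

Definition l1_RI (a b : X) : l1 C_AbsRing :=
  L1 (K := C_AbsRing) (fun k => (a k, b k) : C) (RI_l1_summable a b).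

Definition l1_Re (c : l1 C_AbsRing) : X :=
  L1 (fun k => Re (c k))
    (summable_le (K := R_AbsRing) _ _ (fun k => Rle_trans _ _ _
      (Rmax_l _ _) (Rmax_Cmod (c k))) (l1_summable c)).

Definition l1_Im (c : l1 C_AbsRing) : X :=
  L1 (fun k => Im (c k))
    (summable_le (K := R_AbsRing) _ _ (fun k => Rle_trans _ _ _
      (Rmax_r _ _) (Rmax_Cmod (c k))) (l1_summable c)).

(** Complexification of a real linear operator: [(F + i G) |-> A F + i A G]. *)
Definition cplx (A : Y -> Y) (H : YC) : YC :=
  let P := A (Pair (l1_Re (pf H)) (l1_Re (pg H))) in
  let Q := A (Pair (l1_Im (pf H)) (l1_Im (pg H))) in
  Pair (l1_RI (pf P) (pf Q)) (l1_RI (pg P) (pg Q)).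

Definition expi (t : R) : C := (cos t, sin t).

Definition d : nat := 13.

(** Column of the coefficients of [z^0, ..., z^(d-1)] of the two components,
    those of the first component coming first. *)
Definition low_coefs (F : Y) : @matrix R (2 * d) 1 :=
  mk_matrix (2 * d) 1 (fun i _ =>
    if lt_dec i d then pf F i else pg F (i - d)%nat).

Lemma finite_summable (a : nat -> R) :
  ex_series (fun k => abs (if lt_dec k d then a k else 0 : R_AbsRing)).
Proof.
apply (ex_series_incr_n (V := R_NormedModule) _ d).
destruct (@l1_zero_summable R_AbsRing) as [l Hl]; exists l.
apply is_series_ext with (2 := Hl); intros k.
destruct (lt_dec (d + k) d); [lia | reflexivity].
Qed.

Definition l1_finite (a : nat -> R) : X :=
  L1 (K := R_AbsRing) (fun k => if lt_dec k d then a k else 0)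
    (finite_summable a).

Definition mat_op (M : @matrix R (2 * d) (2 * d)) (F : Y) : Y :=
  let c := Mmult M (low_coefs F) in
  Pair (l1_finite (fun i => coeff_mat 0 c i 0))
       (l1_finite (fun i => coeff_mat 0 c (d + i) 0)).

Definition s : R := 22 / 10.
Definition tau : R := 5 / 10.

(** [f(z)] for complex [z] in the unit disk: the sum of [a_k z^k], taken on real
    and imaginary parts separately. *)
Definition evalC (f : X) (z : C) : C :=
  (Series (fun k => f k * Re (Cpow z k)), Series (fun k => f k * Im (Cpow z k))).

Definition lambda_arg (f : X) : R := ((PSeries f 0) ^ 2 - 1) / s.

Definition lambda (f : X) : R := - PSeries f (lambda_arg f).

Section TOperator.

Local Open Scope C_scope.

Variable F : Y.
Let f : X := pf F.
Let g : X := pg F.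
Let lam : C := RtoC (lambda f).
Let sC : C := RtoC s.
Let tauC : C := RtoC tau.

Definition u_arg (w : C) : C := lam ^ 2 * (w + / sC) - / sC.
Definition u (w : C) : C := evalC f (u_arg w) ^ 2.
Definition v (w : C) : C := lam ^ 2 * tauC * w * evalC g (lam ^ 2 * w).
Definition v_arg (w : C) : C := v w * (v w - 2) / sC.
Definition vf_arg (w : C) : C := / sC * evalC f (v_arg w) ^ 2 - / sC.

Definition fhat (w : C) : C := / lam * (- (1) + u w * evalC g (u w / tauC)).
Definition ghat (w : C) : C :=
  / (tauC * w) * (1 + / lam * evalC f (vf_arg w)).

Definition T_dom : Prop :=
  lambda f <> 0%R /\ (Rabs (lambda_arg f) < 1)%R /\
  forall w : C, (Cmod w <= 1)%R ->
    (Cmod (u_arg w) < 1)%R /\ (Cmod (u w / tauC) < 1)%R /\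
    (Cmod (lam ^ 2 * w) < 1)%R /\ (Cmod (v_arg w) < 1)%R /\
    (Cmod (vf_arg w) < 1)%R.

(** [G = T F]. The formula for the second component is not required at [w = 0],
    where it has a removable singularity. *)
Definition is_T (G : Y) : Prop :=
  forall w : C, (Cmod w < 1)%R ->
    evalC (pf G) w = fhat w /\ (w <> 0 -> evalC (pg G) w = ghat w).

End TOperator.

Definition T_defined (F : Y) : Prop := T_dom F /\ exists G : Y, is_T F G.

Definition T (F : Y) : Y := epsilon (inhabits zero) (is_T F).

Definition Newton (Gam : Y -> Y) (F : Y) : Y :=
  inv_op (fun H : Y => minus (Gam H) H) (minus (Gam F) (T F)).

Definition lorenz_dom (r x : R) : Prop := -1 <= x <= r /\ x <> 0.

(** Monotonicity is meant on each of the two branches: the map jumps down from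
    [r] to [-1] at 0. *)
Definition is_Lorenz_map (r : R) (L : R -> R) : Prop :=
  0 < r /\
  (forall x, lorenz_dom r x -> -1 <= L x <= r) /\
  continuous_on (lorenz_dom r) L /\
  (forall x y, -1 <= x -> x < y -> y < 0 -> L x < L y) /\
  (forall x y, 0 < x -> x < y -> y <= r -> L x < L y) /\
  filterlim L (at_left 0) (locally r) /\
  filterlim L (at_right 0) (locally (-1)).

Definition phi (f : X) (z : R) : R := PSeries f ((z - 1) / s).
Definition psi (g : X) (z : R) : R := -1 + z * PSeries g (z / tau).

Definition represents (F : Y) (r : R) (L : R -> R) : Prop :=
  (forall x, -1 < x < 0 -> Rabs (x ^ 2 - 1) < s /\ L x = phi (pf F) (x ^ 2)) /\
  (forall x, 0 < x < r -> Rabs (x ^ 2) < tau /\ L x = psi (pg F) (x ^ 2)).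

Definition represents_Lorenz_map (F : Y) : Prop :=
  exists (r : R) (L : R -> R), is_Lorenz_map r L /\ represents F r L.

(* Main.v *)
(** Proof idea. In the convolution algebra [l^1] the operator [T] is a finite expression in
    products, compositions and one backward shift; all of these are differentiable with a
    quadratic remainder, so the derivative of [T] is again such an expression. Balls
    "integer polynomial plus [l^1] radius", in units of [2^-52], enclose these expressions.
    Evaluated at [F0] they give [||T F0 - F0|| <= 10^-11]. Evaluated on the ball of radius
    [1.1 10^-7] they bound every column of [Gamma - DT_F] by [0.0039]; on [l^1] the norm of
    an operator, and of its complexification, is the supremum of the norms of its columns,
    and the columns [z^k], [k >= 13], are dominated by the one of [z^13] because they have
    the form [b a^k] with [||a|| < 1].

    [Gamma] is the rounded derivative of [T]. It has eigenvalues near 23.4, 12.1 and 0.54 and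
    is otherwise small. For [|z| = 1] its resolvent is approximated by the three spectral
    projections and a truncated Laurent expansion of the complementary part; the defect is
    at most 0.172, so a Neumann series yields [||(Gamma - z)^-1|| <= 36]. The theorem follows
    from [36 * 0.0039 < 0.2] and [36 * 10^-11 < 5 * 10^-9]. *)

Require Import Defs.
From Stdlib Require Import Reals Lra Lia Psatz ZArith List Bool.
From Stdlib Require Import FunctionalExtensionality ClassicalEpsilon.
From Coquelicot Require Import Coquelicot.
Import ListNotations.
Open Scope R_scope.

(** One parametrix serves the whole circle: $z=e^{it}$ enters it only through the scalars
    $1/(\mu_i-z)$, $1/z$ and $1/z^2$, so finitely many integer checks on operators free of $z$ cover
    every $t$. The eigenvectors need only be approximate, since their errors are counted in the
    defect. The value $z=1$ supplies $(\Gamma-I)^{-1}$ for (1) and (2).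

    Composition is the delicate operation: differentiating $f\circ a$ in $a$ produces $f'\circ a$,
    and $f'$ need not lie in $\ell^1$. The sum $\sum kf_ka^{k-1}$ does converge when $\|a\|<1$, at
    the price $1/(1-\|a\|)$. Hence all arguments are controlled in the norm of $\ell^1$ and not only
    pointwise on the disk; the same norms give well-definedness.

    The backward shift replaces the division by $w$ in $\hat g$, so that no removable singularity is
    left inside the algebra. Numbers such as $\lambda$ become constant functions, so that one
    differential calculus and one ball arithmetic treat scalars and functions alike. *)

(** * Partial sums and series of real numbers *)

Fixpoint psum {G : AbelianGroup} (x : nat -> G) (m : nat) : G :=
  match m with O => zero | S k => plus (psum x k) (x k) end.

Notation rsum := (psum (G := R_AbelianGroup)).

Lemma ex_series_mult_l (c : R) (a : nat -> R) :
  ex_series a -> ex_series (fun k => c * a k).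
Proof. exact (ex_series_scal_l (V := R_NormedModule) c a). Qed.

Lemma ex_series_add (a b : nat -> R) :
  ex_series a -> ex_series b -> ex_series (fun k => a k + b k).
Proof. exact (ex_series_plus (V := R_NormedModule) a b). Qed.

Lemma ex_series_dom (a b : nat -> R) :
  (forall k, Rabs (a k) <= b k) -> ex_series b -> ex_series a.
Proof. exact (@ex_series_le R_AbsRing R_CompleteNormedModule a b). Qed.

Lemma psum_sum_n (c : nat -> R) (m : nat) :
  sum_n c m = rsum c (S m).
Proof.
induction m as [|m IH]; [rewrite sum_O; simpl; symmetry; apply @plus_zero_l|].
rewrite sum_Sn, IH; reflexivity.
Qed.

Lemma psum_first (u : nat -> R) (n : nat) :
  rsum u (S n) =
  u 0%nat + rsum (fun k => u (S k)) n.
Proof.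
induction n as [|n IH].
- change (0 + u 0%nat = u 0%nat + 0); ring.
- change (rsum u (S n) + u (S n) =
    u 0%nat + (rsum (fun k => u (S k)) n + u (S n))).
  rewrite IH; ring.
Qed.

Lemma psum_le (c b : nat -> R) (m : nat) :
  (forall k, c k <= b k) ->
  rsum c m <= rsum b m.
Proof.
intros H; induction m as [|m IH]; [apply Rle_refl | exact (Rplus_le_compat _ _ _ _ IH (H m))].
Qed.

(** Partial sums of nonnegative terms increase, so a common bound gives convergence and passes to
    the limit. *)
Lemma bounded_series (c : nat -> R) (B : R) :
  (forall k, 0 <= c k) ->
  (forall m, rsum c m <= B) -> ex_series c /\ Series c <= B.
Proof.
intros Hc HB.
assert (E : ex_finite_lim_seq (sum_n c)).
{ apply ex_finite_lim_seq_incr with B; intros n.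
  - rewrite sum_Sn; specialize (Hc (S n)); change (sum_n c n <= sum_n c n + c (S n)); lra.
  - rewrite psum_sum_n; apply HB. }
destruct E as [l Hl]; split; [exists l; exact Hl|].
rewrite (is_series_unique c l Hl).
change (Rbar_le (Finite l) (Finite B)).
apply (is_lim_seq_le (sum_n c) (fun _ => B)); [|exact Hl | apply is_lim_seq_const].
intros n; rewrite psum_sum_n; apply HB.
Qed.

Lemma psum_le_Series (c : nat -> R) (m : nat) :
  (forall k, 0 <= c k) -> ex_series c ->
  rsum c m <= Series c.
Proof.
intros Hc H.
assert (I : forall n, rsum c n <= rsum c (S n)).
{ intros n; simpl; change (plus ?a ?b) with (a + b); specialize (Hc n); lra. }
apply Rle_trans with (1 := I m); rewrite <- psum_sum_n.
apply is_lim_seq_incr_compare; [apply (Series_correct _ H)|].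
intros n; rewrite !psum_sum_n; apply I.
Qed.

Lemma Series_nonneg (c : nat -> R) : (forall k, 0 <= c k) -> ex_series c -> 0 <= Series c.
Proof. intros H H'; exact (psum_le_Series c 0 H H'). Qed.

Lemma Series_tail (c : nat -> R) (m : nat) :
  ex_series c -> Series c = rsum c m + Series (fun k => c (m + k)%nat).
Proof.
intros H; destruct m as [|m]; [symmetry; apply Rplus_0_l|].
rewrite (Series_incr_n c (S m)) by (lia || exact H).
simpl pred; rewrite <- sum_n_Reals, psum_sum_n; reflexivity.
Qed.

Lemma ex_series_shift (c : nat -> R) (m : nat) : ex_series c -> ex_series (fun k => c (m + k)%nat).
Proof. intros H; apply (ex_series_incr_n (V := R_NormedModule) c m), H. Qed.

Lemma Series_tail_lim (c : nat -> R) :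
  ex_series c -> is_lim_seq (fun m => Series (fun k => c (m + k)%nat)) 0.
Proof.
intros H.
apply is_lim_seq_incr_1.
apply is_lim_seq_ext with (fun m => Series c - sum_n c m).
{ intros m; rewrite (Series_tail c (S m) H), psum_sum_n; simpl; ring. }
replace (Finite 0) with (Finite (Series c - Series c)) by (f_equal; ring).
apply is_lim_seq_minus'; [apply is_lim_seq_const | apply (Series_correct _ H)].
Qed.

Lemma is_series_0 : is_series (fun _ : nat => 0) 0.
Proof.
change (is_lim_seq (sum_n (fun _ => 0)) 0).
apply is_lim_seq_ext with (fun _ => 0); [|apply is_lim_seq_const].
intros n; symmetry; rewrite sum_n_const; apply Rmult_0_r.
Qed.

Lemma Series_psum (c : nat -> nat -> R) (m : nat) :
  (forall n, ex_series (fun k => c k n)) ->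
  ex_series (fun k => rsum (c k) m) /\
  Series (fun k => rsum (c k) m) =
  rsum (fun n => Series (fun k => c k n)) m.
Proof.
intros H; induction m as [|m [IH1 IH2]].
- split; [exists 0; exact is_series_0 | exact (is_series_unique _ _ is_series_0)].
- split; [exact (ex_series_plus _ _ IH1 (H m))|].
  simpl; change (plus (psum (c ?k : nat -> R_AbelianGroup) m)) with (Rplus (rsum (c k) m)).
  rewrite <- IH2; exact (Series_plus _ _ IH1 (H m)).
Qed.

Lemma is_lim_seq_squeeze0 (u w : nat -> R) :
  (forall n, 0 <= u n <= w n) -> is_lim_seq w 0 -> is_lim_seq u 0.
Proof. intros H Hw; apply (is_lim_seq_le_le (fun _ => 0) u w); auto using is_lim_seq_const. Qed.

(** * Absolutely convergent families in $\ell^1$ over a general scalar ring *)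

Section Families.

Context {K : AbsRing}.

Lemma psum_coef (x : nat -> l1 K) (m n : nat) :
  psum x m n = psum (fun k => x k n : K) m.
Proof. induction m as [|m IH]; [reflexivity | simpl; rewrite <- IH; reflexivity]. Qed.

(** Completeness of the scalars in the only form used below: a summation that stays within the tail
    of every partial sum. It lets the real and the complex $\ell^1$ share one existence proof. *)
Definition complete_sum (sum : (nat -> K) -> K) : Prop :=
  forall a : nat -> K, ex_series (fun k => abs (a k)) ->
  forall m, abs (minus (sum a) (psum a m)) <= Series (fun k => abs (a (m + k)%nat)).

Lemma ex_series_coef (x : nat -> l1 K) (n : nat) :
  ex_series (fun k => l1_norm (x k)) -> ex_series (fun k => abs (x k n)).
Proof. apply summable_le; intros k; apply l1_abs_coef_le. Qed.

(** The sum is taken coefficient by coefficient. The first [N] coefficients of its distance to a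
    partial sum are bounded by exchanging a finite sum with a series, uniformly in [N]. *)
Lemma family_sum_ex (sum : (nat -> K) -> K) (x : nat -> l1 K) :
  complete_sum sum -> ex_series (fun k => l1_norm (x k)) ->
  exists l : l1 K, forall m,
    l1_norm (minus l (psum x m)) <= Series (fun k => l1_norm (x (m + k)%nat)).
Proof.
intros Hs Hx.
set (l := fun n => sum (fun k => x k n)).
assert (B : forall m N,
  rsum (fun n => abs (minus (l n) (psum x m n))) N
  <= Series (fun k => l1_norm (x (m + k)%nat))).
{ intros m N.
  apply Rle_trans with (rsum (fun n => Series (fun k => abs (x (m + k)%nat n))) N).
  - apply psum_le; intros n; rewrite psum_coef.
    apply (Hs (fun k => x k n)), ex_series_coef, Hx.
  - destruct (Series_psum (fun k n => abs (x (m + k)%nat n)) N) as [E1 E2].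
    { intros n; apply (ex_series_shift (fun k => abs (x k n))), ex_series_coef, Hx. }
    rewrite <- E2; apply Series_le.
    + intros k; split.
      * induction N as [|N IH]; [apply Rle_refl|].
        apply Rplus_le_le_0_compat; [|apply abs_ge_0].
        apply IH; apply (Series_psum (fun k n => abs (x (m + k)%nat n)) N);
        intros n; apply (ex_series_shift (fun k => abs (x k n))), ex_series_coef, Hx.
      * apply psum_le_Series; [intros n; apply abs_ge_0 | apply l1_summable].
    + apply (ex_series_shift (fun k => l1_norm (x k))), Hx. }
(* The estimate with the empty partial sum says that the candidate itself is summable. *)
assert (S0 : ex_series (fun n => abs (l n))).
{ apply (bounded_series _ (Series (fun k => l1_norm (x (0 + k)%nat)))); [intros; apply abs_ge_0|].
  intros N; apply Rle_trans with (2 := B O N), psum_le; intros n.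
  apply Req_le; f_equal; symmetry; exact (minus_zero_r (l n)). }
exists (L1 l S0); intros m.
apply (bounded_series (fun n => abs (minus (l n) (psum x m n)))); [intros; apply abs_ge_0 | apply B].
Qed.

Lemma l1_norm_minus_sym (x y : l1 K) : l1_norm (minus x y) = l1_norm (minus y x).
Proof. rewrite <- (opp_minus x y); symmetry; exact (norm_opp (minus x y)). Qed.

Lemma family_sum_unique (x : nat -> l1 K) (l l' : l1 K) :
  is_lim_seq (fun m => l1_norm (minus l (psum x m))) 0 ->
  is_lim_seq (fun m => l1_norm (minus l' (psum x m))) 0 -> l = l'.
Proof.
intros H H'.
assert (Z : l1_norm (minus l l') = 0).
{ apply Rle_antisym; [|apply l1_norm_ge_0].
  change (Rbar_le (l1_norm (minus l l')) 0).
  apply (is_lim_seq_le (fun _ => l1_norm (minus l l'))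
    (fun m => l1_norm (minus l (psum x m)) + l1_norm (minus l' (psum x m)))).
  - intros m; rewrite (l1_norm_minus_sym l'), (minus_trans (psum x m) l l').
    apply l1_norm_triangle.
  - apply is_lim_seq_const.
  - replace (Finite 0) with (Finite (0 + 0)) by (f_equal; ring).
    apply is_lim_seq_plus'; assumption. }
apply l1_norm_eq_zero in Z.
apply (plus_reg_r (opp l')); rewrite plus_opp_r; exact Z.
Qed.

End Families.

(** * Completeness of the real and the complex scalars *)

Lemma complete_sum_R : complete_sum (K := R_AbsRing) Series.
Proof.
intros a Ha m.
assert (E : ex_series a) by exact (ex_series_Rabs _ Ha).
change (Rabs (Series a - rsum a m) <= Series (fun k => Rabs (a (m + k)%nat))).
rewrite (Series_tail a m E).
replace (_ - _) with (Series (fun k => a (m + k)%nat)) by ring.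
apply Series_Rabs, (ex_series_shift (fun k => Rabs (a k))), Ha.
Qed.

Definition sumC (b : nat -> C) : C :=
  (Series (fun k => Re (b k)), Series (fun k => Im (b k))).

Lemma ex_series_ReIm (b : nat -> C) : ex_series (fun k => Cmod (b k)) ->
  ex_series (fun k => Re (b k)) /\ ex_series (fun k => Im (b k)).
Proof.
intros H; split; apply (ex_series_dom _ (fun k => Cmod (b k))); auto;
intros k; apply Rle_trans with (2 := Rmax_Cmod (b k)); [apply Rmax_l | apply Rmax_r].
Qed.

(* With t the sum, |t|^2 is the sum of Re t Re b_k + Im t Im b_k <= |t| |b_k|. *)
Lemma sumC_bound (b : nat -> C) :
  ex_series (fun k => Cmod (b k)) -> Cmod (sumC b) <= Series (fun k => Cmod (b k)).
Proof.
intros H; destruct (ex_series_ReIm b H) as [HR HI].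
set (t := sumC b).
destruct (Req_dec (Cmod t) 0) as [Z|NZ].
{ rewrite Z; apply Series_nonneg; auto; intros; apply Cmod_ge_0. }
assert (P : 0 < Cmod t) by (assert (Q := Cmod_ge_0 t); lra).
apply Rmult_le_reg_l with (1 := P).
rewrite <- (Series_scal_l (Cmod t)).
assert (S2 : Cmod t * Cmod t = Series (fun k => Re t * Re (b k) + Im t * Im (b k))).
{ rewrite Series_plus by (apply ex_series_mult_l; assumption).
  rewrite !Series_scal_l; change (Series (fun k => Re (b k))) with (Re t).
  change (Series (fun k => Im (b k))) with (Im t).
  unfold Cmod; rewrite sqrt_sqrt by nra; unfold Re, Im; ring. }
rewrite S2; apply Rle_trans with (1 := Rle_abs _).
apply Rle_trans with (Series (fun k => Rabs (Re t * Re (b k) + Im t * Im (b k)))).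
- apply Series_Rabs.
  apply (ex_series_dom _ (fun k => Rabs (Re t) * Rabs (Re (b k)) + Rabs (Im t) * Rabs (Im (b k)))).
  + intros k; change (Rabs (Rabs (Re t * Re (b k) + Im t * Im (b k))) <= Rabs (Re t) * Rabs (Re (b k)) + Rabs (Im t) * Rabs (Im (b k))).
    rewrite Rabs_Rabsolu, <- !Rabs_mult; apply Rabs_triang.
  + assert (A : forall c, ex_series (fun k => c (b k)) -> (forall z, Rabs (c z) <= Cmod z) ->
      ex_series (fun k => Rabs (c (b k)))).
    { intros c _ Hc; apply (ex_series_dom _ (fun k => Cmod (b k))); auto.
      intros k; change (Rabs (Rabs (c (b k))) <= Cmod (b k)); rewrite Rabs_Rabsolu; apply Hc. }
    apply ex_series_add; apply ex_series_mult_l; apply A; auto;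
    intros z; apply Rle_trans with (2 := Rmax_Cmod z); [apply Rmax_l | apply Rmax_r].
- apply Series_le; [|apply ex_series_mult_l; exact H].
  intros k; split; [apply Rabs_pos|].
  unfold Cmod; rewrite <- sqrt_mult by nra.
  rewrite <- sqrt_Rsqr_abs; apply sqrt_le_1_alt; unfold Rsqr, Re, Im.
  assert (Q := Rle_0_sqr (fst t * snd (b k) - snd t * fst (b k))); unfold Rsqr in Q; nra.
Qed.

Lemma complete_sum_C : complete_sum (K := C_AbsRing) sumC.
Proof.
intros a Ha m; destruct (ex_series_ReIm a Ha) as [HR HI].
apply Rle_trans with (Cmod (sumC (fun k => a (m + k)%nat))).
2: { apply (sumC_bound (fun k => a (m + k)%nat)), (ex_series_shift (fun k => Cmod (a k))), Ha. }
change (Cmod (minus (sumC a : C_AbelianGroup) (psum (a : nat -> C_AbelianGroup) m)) <= Cmod (sumC (fun k => a (m + k)%nat))).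
apply Req_le; f_equal.
- assert (E : psum (a : nat -> C_AbelianGroup) m =
    (rsum (fun k => Re (a k)) m, rsum (fun k => Im (a k)) m)).
  { clear; induction m as [|m IH]; [reflexivity | simpl; rewrite IH; reflexivity]. }
  rewrite E; unfold sumC; rewrite (Series_tail _ m HR), (Series_tail _ m HI).
  unfold minus, plus, opp; simpl; unfold Cplus, Copp; simpl; f_equal; ring.
Qed.

Lemma sumC_ext (a b : nat -> C) : (forall k, a k = b k) -> sumC a = sumC b.
Proof. intros H; unfold sumC; f_equal; apply Series_ext; intros k; now rewrite H. Qed.

Lemma sumC_scal (c : C) (b : nat -> C) :
  ex_series (fun k => Cmod (b k)) -> sumC (fun k => (c * b k)%C) = (c * sumC b)%C.
Proof.
intros H; destruct (ex_series_ReIm b H) as [HR HI].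
destruct c as [x y]; unfold sumC, Cmult; simpl; f_equal.
- rewrite <- !Series_scal_l, <- Series_minus by (apply ex_series_mult_l; assumption).
  reflexivity.
- rewrite <- !Series_scal_l, <- Series_plus by (apply ex_series_mult_l; assumption).
  reflexivity.
Qed.

(** * Evaluation on the closed unit disk *)

Lemma evalC_sumC (f : X) (w : C) : evalC f w = sumC (fun k => (RtoC (f k) * w ^ k)%C).
Proof.
unfold evalC, sumC; f_equal; apply Series_ext; intros k; destruct (w ^ k)%C as [x y]; unfold Re, Im, Cmult, RtoC; simpl; ring.
Qed.

Lemma Cmod_pow (w : C) (k : nat) : Cmod (w ^ k)%C = Cmod w ^ k.
Proof. induction k as [|k IH]; simpl; [apply Cmod_1 | now rewrite Cmod_mult, IH]. Qed.

Lemma evalC_term_le (f : X) (w : C) (k : nat) : Cmod w <= 1 ->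
  Cmod (RtoC (f k) * w ^ k)%C <= Rabs (f k).
Proof.
intros H; rewrite Cmod_mult, Cmod_R, Cmod_pow.
rewrite <- (Rmult_1_r (Rabs (f k))) at 2.
apply Rmult_le_compat_l; [apply Rabs_pos|].
rewrite <- (pow1 k); apply pow_incr; split; [apply Cmod_ge_0 | exact H].
Qed.

Lemma evalC_summable (f : X) (w : C) : Cmod w <= 1 ->
  ex_series (fun k => Cmod (RtoC (f k) * w ^ k)%C).
Proof.
intros H; apply (ex_series_dom _ (fun k => Rabs (f k))).
- intros k; change (Rabs (Cmod (RtoC (f k) * w ^ k)%C) <= Rabs (f k)).
  rewrite Rabs_pos_eq by apply Cmod_ge_0; apply evalC_term_le, H.
- apply (l1_summable f).
Qed.

Lemma evalC_bound (f : X) (w : C) : Cmod w <= 1 -> Cmod (evalC f w) <= l1_norm f.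
Proof.
intros H; rewrite evalC_sumC; apply Rle_trans with (1 := sumC_bound _ (evalC_summable f w H)).
apply Series_le; [|apply (l1_summable f)].
intros k; split; [apply Cmod_ge_0 | apply evalC_term_le, H].
Qed.

Lemma evalC_plus (f g : X) (w : C) : Cmod w <= 1 ->
  evalC (plus f g) w = (evalC f w + evalC g w)%C.
Proof.
intros H.
destruct (ex_series_ReIm _ (evalC_summable f w H)) as [F1 F2].
destruct (ex_series_ReIm _ (evalC_summable g w H)) as [G1 G2].
rewrite !evalC_sumC; unfold sumC, Cplus; cbn [fst snd]; f_equal.
- rewrite <- Series_plus by assumption; apply Series_ext; intros k.
  destruct (w ^ k)%C as [x y]; unfold Re, Cmult, RtoC; simpl.
  change (plus (f k) (g k)) with (f k + g k); ring.
- rewrite <- Series_plus by assumption; apply Series_ext; intros k.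
  destruct (w ^ k)%C as [x y]; unfold Im, Cmult, RtoC; simpl.
  change (plus (f k) (g k)) with (f k + g k); ring.
Qed.

Lemma evalC_scal (c : R) (f : X) (w : C) :
  evalC (scal c f) w = (RtoC c * evalC f w)%C.
Proof.
unfold evalC, RtoC, Cmult; simpl; f_equal.
- rewrite Rmult_0_l, Rminus_0_r, <- Series_scal_l; apply Series_ext; intros k.
  change (coef (scal c f) k) with (c * f k); cbv beta; change (mult c (f k)) with (c * f k); ring.
- rewrite Rmult_0_l, Rplus_0_r, <- Series_scal_l; apply Series_ext; intros k.
  change (coef (scal c f) k) with (c * f k); cbv beta; change (mult c (f k)) with (c * f k); ring.
Qed.

Lemma evalC_PSeries (f : X) (t : R) : evalC f (RtoC t) = RtoC (PSeries f t).
Proof.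
unfold evalC; transitivity ((PSeries f t, 0) : C); [f_equal | reflexivity].
- apply Series_ext; intros k; rewrite <- RtoC_pow; reflexivity.
- rewrite <- (is_series_unique _ _ is_series_0); apply Series_ext; intros k.
  rewrite <- RtoC_pow; apply Rmult_0_r.
Qed.

Lemma CV_radius_l1 (f : X) : Rbar_lt 0 (CV_radius f).
Proof.
apply Rbar_lt_le_trans with 1; [simpl; lra|].
apply (proj1 (CV_radius_bounded f)); exists (l1_norm f); intros n.
rewrite pow1, Rmult_1_r; apply (l1_abs_coef_le f).
Qed.

(** The values at real points of the disk already determine the Taylor coefficients. Identities in
    $\ell^1$ thus reduce to identities between complex numbers, where [ring] applies. *)
Lemma evalC_inj (f g : X) :
  (forall w : C, Cmod w < 1 -> evalC f w = evalC g w) -> f = g.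
Proof.
intros H; apply l1_eq; intros k.
apply (PSeries_ext_recip f g k); try apply CV_radius_l1.
exists (mkposreal 1 Rlt_0_1); intros t Ht.
assert (E : RtoC (PSeries f t) = RtoC (PSeries g t)); [|now injection E].
rewrite <- !evalC_PSeries; apply H; rewrite Cmod_R.
change (Rabs (t - 0) < 1) in Ht; rewrite Rminus_0_r in Ht; exact Ht.
Qed.

(** * The Banach algebra structure *)

(** $\sum_kf_ky_k$ for a bounded sequence [y]. Products, compositions $f\circ a$ and $f'\circ a$ are
    the cases $y_k=w^kb$, $a^k$ and $ka^{k-1}$, so that norm bounds, coefficients and values are
    established once. Choosing a limit by [epsilon] makes the operation total. *)
Definition lc (f : X) (y : nat -> X) : X :=
  epsilon (inhabits (zero : X)) (fun l =>
    is_lim_seq (fun m => l1_norm (minus l (psum (fun k => scal (f k) (y k)) m))) 0).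

Definition bounded_by (M : R) (y : nat -> X) : Prop := forall k, l1_norm (y k) <= M.

Section LinearCombination.

Variables (f : X) (y : nat -> X) (M : R).
Hypothesis Hy : bounded_by M y.

Lemma lc_term_le (k : nat) : l1_norm (scal (f k) (y k)) <= M * Rabs (f k).
Proof.
apply Rle_trans with (1 := l1_norm_scal (f k) (y k)).
rewrite Rmult_comm; apply Rmult_le_compat_r; [apply Rabs_pos | apply Hy].
Qed.

Lemma lc_summable : ex_series (fun k => l1_norm (scal (f k) (y k))).
Proof.
apply (ex_series_dom _ (fun k => M * Rabs (f k))).
- intros k; change (Rabs (l1_norm (scal (f k) (y k))) <= M * Rabs (f k)).
  rewrite Rabs_pos_eq by apply l1_norm_ge_0; apply lc_term_le.
- apply ex_series_mult_l, (l1_summable f).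
Qed.

Lemma lc_spec (m : nat) :
  l1_norm (minus (lc f y) (psum (fun k => scal (f k) (y k)) m))
  <= Series (fun k => l1_norm (scal (f (m + k)%nat) (y (m + k)%nat))).
Proof.
destruct (family_sum_ex Series (fun k => scal (f k) (y k)) complete_sum_R lc_summable) as [l Hl].
assert (L : is_lim_seq (fun m => l1_norm (minus l (psum (fun k => scal (f k) (y k)) m))) 0).
{ apply is_lim_seq_squeeze0 with (2 := Series_tail_lim _ lc_summable).
  intros n; split; [apply l1_norm_ge_0 | apply Hl]. }
replace (lc f y) with l; [apply Hl|].
apply (family_sum_unique (fun k => scal (f k) (y k))); [exact L|].
apply (epsilon_spec (inhabits (zero : X)) (fun l =>
    is_lim_seq (fun m => l1_norm (minus l (psum (fun k => scal (f k) (y k)) m))) 0)).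
exists l; exact L.
Qed.

Lemma lc_lim : is_lim_seq (fun m => l1_norm (minus (lc f y) (psum (fun k => scal (f k) (y k)) m))) 0.
Proof.
apply is_lim_seq_squeeze0 with (2 := Series_tail_lim _ lc_summable).
intros n; split; [apply l1_norm_ge_0 | apply lc_spec].
Qed.

Lemma lc_norm : l1_norm (lc f y) <= M * l1_norm f.
Proof.
assert (H := lc_spec 0).
rewrite (minus_zero_r (lc f y) : minus (lc f y) (psum _ 0) = lc f y) in H.
apply Rle_trans with (1 := H); unfold l1_norm at 2; rewrite <- Series_scal_l.
apply Series_le; [|apply ex_series_mult_l, (l1_summable f)].
intros k; split; [apply l1_norm_ge_0 | apply lc_term_le].
Qed.

(** A bounded linear functional passes through the limit of the partial sums. It is applied to
    single coefficients and to the real and imaginary parts of an evaluation. *)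
Lemma lc_functional (phi : X -> R) (N : R) :
  (forall a b, phi (plus a b) = phi a + phi b) ->
  (forall c a, phi (scal c a) = c * phi a) ->
  (forall a, Rabs (phi a) <= N * l1_norm a) ->
  phi (lc f y) = Series (fun k => f k * phi (y k)).
Proof.
intros Hp Hs Hb; symmetry; apply is_series_unique.
assert (P : forall m, phi (psum (fun k => scal (f k) (y k)) m)
  = rsum (fun k => f k * phi (y k)) m).
{ induction m as [|m IH].
  - assert (Z : phi (zero : X) = 0 * phi (zero : X)).
    { rewrite <- Hs; f_equal; symmetry; exact (scal_zero_l (V := @l1_ModuleSpace R_AbsRing) zero). }
    rewrite Rmult_0_l in Z; exact Z.
  - simpl; rewrite Hp, Hs, IH; reflexivity. }
assert (O : forall x : X, phi (opp x) = - phi x).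
{ intros x; transitivity (phi (scal (-1) x)).
  - f_equal; symmetry; exact (scal_opp_one (V := @l1_ModuleSpace R_AbsRing) x).
  - rewrite Hs; ring. }
change (is_lim_seq (sum_n (fun k => f k * phi (y k))) (phi (lc f y))).
apply is_lim_seq_ext with (fun m => rsum (fun k => f k * phi (y k)) (S m)).
{ intros m; symmetry; apply psum_sum_n. }
apply (is_lim_seq_incr_1 (fun m => rsum (fun k => f k * phi (y k)) m)).
apply is_lim_seq_ext with (fun m => phi (lc f y) - phi (minus (lc f y) (psum (fun k => scal (f k) (y k)) m))).
{ intros m; rewrite <- P; unfold minus; rewrite Hp.
  rewrite O; ring. }
replace (Finite (phi (lc f y))) with (Finite (phi (lc f y) - 0)) by (f_equal; ring).
apply is_lim_seq_minus'; [apply is_lim_seq_const|].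
apply is_lim_seq_abs_0, is_lim_seq_squeeze0 with
  (fun m => N * l1_norm (minus (lc f y) (psum (fun k => scal (f k) (y k)) m))).
- intros n; split; [apply Rabs_pos | apply Hb].
- replace (Finite 0) with (Rbar_mult N 0) by (simpl; f_equal; ring).
  apply is_lim_seq_scal_l, lc_lim.
Qed.

Lemma lc_coef (n : nat) : lc f y n = Series (fun k => f k * y k n).
Proof.
apply (lc_functional (fun a => a n) 1); [reflexivity | reflexivity|].
intros a; rewrite Rmult_1_l; apply (l1_abs_coef_le a n).
Qed.

Lemma evalC_lc (w : C) : Cmod w <= 1 ->
  evalC (lc f y) w = sumC (fun k => (RtoC (f k) * evalC (y k) w)%C).
Proof.
intros H.
assert (B : forall a : X, Rabs (Re (evalC a w)) <= 1 * l1_norm a /\ Rabs (Im (evalC a w)) <= 1 * l1_norm a).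
{ intros a; rewrite Rmult_1_l; assert (E := evalC_bound a w H); assert (E' := Rmax_Cmod (evalC a w)).
  split; eapply Rle_trans; [apply Rmax_l | eapply Rle_trans; [exact E' | exact E] |
    apply Rmax_r | eapply Rle_trans; [exact E' | exact E]]. }
rewrite (surjective_pairing (evalC (lc f y) w)); unfold sumC; f_equal.
- change (fst (evalC (lc f y) w)) with (Re (evalC (lc f y) w)).
  rewrite (lc_functional (fun a => Re (evalC a w)) 1).
  + apply Series_ext; intros k; unfold Re; simpl; ring.
  + intros a b; rewrite evalC_plus by exact H; reflexivity.
  + intros c a; rewrite evalC_scal; unfold Re; simpl; ring.
  + intros a; apply B.
- change (snd (evalC (lc f y) w)) with (Im (evalC (lc f y) w)).
  rewrite (lc_functional (fun a => Im (evalC a w)) 1).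
  + apply Series_ext; intros k; unfold Im; simpl; ring.
  + intros a b; rewrite evalC_plus by exact H; reflexivity.
  + intros c a; rewrite evalC_scal; unfold Im; simpl; ring.
  + intros a; apply B.
Qed.

End LinearCombination.

Notation nrm := (@l1_norm R_AbsRing).

Definition x0 : X := zero.
Definition xadd (a b : X) : X := plus a b.
Definition xopp (a : X) : X := opp a.
Definition xsub (a b : X) : X := minus a b.

Lemma xshift_summable (a : X) :
  ex_series (fun k => abs (match k with O => 0 | S j => a j end : R_AbsRing)).
Proof.
apply (ex_series_incr_1 (V := R_NormedModule)); exact (l1_summable a).
Qed.

Definition xshift (a : X) : X := L1 (K := R_AbsRing) _ (xshift_summable a).

Lemma xtail_summable (a : X) : ex_series (fun k => abs (a (S k))).
Proof. apply (ex_series_incr_1 (V := R_NormedModule) (fun k => abs (a k))), (l1_summable a). Qed.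

Definition xtail (a : X) : X := L1 (K := R_AbsRing) _ (xtail_summable a).

Lemma cst_summable (r : R) :
  ex_series (fun k => abs (match k with O => r | S _ => 0 end : R_AbsRing)).
Proof.
apply (ex_series_incr_1 (V := R_NormedModule)); exists 0.
apply is_series_ext with (2 := is_series_0); intros n; symmetry; exact Rabs_R0.
Qed.

Definition cst (r : R) : X := L1 (K := R_AbsRing) _ (cst_summable r).
Definition x1 : X := cst 1.
Definition xw : X := xshift x1.
Definition xmul (a b : X) : X := lc a (fun k => Nat.iter k xshift b).

Declare Scope X_scope.
Delimit Scope X_scope with X.
Notation "x + y" := (xadd x y) : X_scope.
Notation "x - y" := (xsub x y) : X_scope.
Notation "- x" := (xopp x) : X_scope.
Notation "x * y" := (xmul x y) : X_scope.

Fixpoint xpow (a : X) (k : nat) : X :=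
  match k with O => x1 | S j => (a * xpow a j)%X end.

Notation "x ^ n" := (xpow x n) : X_scope.

Definition xcomp (f a : X) : X := lc f (xpow a).

(** [dpow a k] is [k a^(k-1)]. *)
Fixpoint dpow (a : X) (k : nat) : X :=
  match k with O => x0 | S j => (a * dpow a j + a ^ j)%X end.

(** This is $f'\circ a$, obtained without forming $f'$. *)
Definition xdcomp (f a : X) : X := lc f (dpow a).

Arguments xcomp (f a)%_X.
Arguments xdcomp (f a)%_X.

Lemma nrm_ge0 (a : X) : 0 <= nrm a.
Proof. apply l1_norm_ge_0. Qed.

Lemma nrm_add (a b : X) : nrm (a + b)%X <= nrm a + nrm b.
Proof. exact (l1_norm_triangle a b). Qed.

Lemma nrm_opp (a : X) : nrm (- a)%X = nrm a.
Proof. exact (norm_opp a). Qed.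

Lemma nrm_sub (a b : X) : nrm (a - b)%X <= nrm a + nrm b.
Proof. rewrite <- (nrm_opp b); exact (nrm_add a (- b)%X). Qed.

Lemma nrm_x0 : nrm x0 = 0.
Proof. exact (norm_zero (V := @l1_NormedModule R_AbsRing)). Qed.

Lemma nrm_xshift (a : X) : nrm (xshift a) = nrm a.
Proof.
unfold l1_norm; rewrite Series_incr_1 by apply (l1_summable (xshift a)).
change (Rabs 0 + Series (fun k => abs (a k)) = Series (fun k => abs (a k))).
rewrite Rabs_R0; ring.
Qed.

Lemma nrm_xtail (a : X) : nrm (xtail a) <= nrm a.
Proof.
unfold l1_norm; rewrite (Series_incr_1 (fun k => abs (a k))) by apply (l1_summable a).
change (Series (fun k => abs (xtail a k))) with (Series (fun k => abs (a (S k)))).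
assert (H := abs_ge_0 (a O)); lra.
Qed.

Lemma nrm_cst (r : R) : nrm (cst r) = Rabs r.
Proof.
unfold l1_norm; rewrite Series_incr_1 by apply (l1_summable (cst r)).
transitivity (Rabs r + Series (fun _ => 0)).
- f_equal; apply Series_ext; intros k; exact Rabs_R0.
- rewrite (is_series_unique _ _ is_series_0); ring.
Qed.

Lemma nrm_x1 : nrm x1 = 1.
Proof. unfold x1; rewrite nrm_cst; apply Rabs_R1. Qed.

Lemma nrm_xw : nrm xw = 1.
Proof. unfold xw; rewrite nrm_xshift; apply nrm_x1. Qed.

Lemma iter_xshift_bounded (b : X) : bounded_by (nrm b) (fun k => Nat.iter k xshift b).
Proof.
intros k; induction k as [|k IH]; simpl; [apply Rle_refl|].
rewrite nrm_xshift; exact IH.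
Qed.

Lemma nrm_mul (a b : X) : nrm (a * b)%X <= nrm a * nrm b.
Proof. rewrite Rmult_comm; apply lc_norm, iter_xshift_bounded. Qed.

Lemma nrm_pow (a : X) (k : nat) : nrm (a ^ k)%X <= nrm a ^ k.
Proof.
induction k as [|k IH]; simpl; [rewrite nrm_x1; apply Rle_refl|].
apply Rle_trans with (1 := nrm_mul _ _).
apply Rmult_le_compat_l; [apply nrm_ge0 | exact IH].
Qed.

Lemma nrm_pow_le1 (a : X) (k : nat) : nrm a <= 1 -> nrm (a ^ k)%X <= 1.
Proof.
intros H; apply Rle_trans with (1 := nrm_pow a k).
rewrite <- (pow1 k); apply pow_incr; split; [apply nrm_ge0 | exact H].
Qed.

Section Eval.

Variable w : C.
Hypothesis Hw : Cmod w <= 1.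

Lemma evalC_xadd (a b : X) : evalC (a + b)%X w = (evalC a w + evalC b w)%C.
Proof. apply evalC_plus, Hw. Qed.

Lemma evalC_xopp (a : X) : evalC (- a)%X w = (- evalC a w)%C.
Proof.
transitivity (evalC (scal (-1) a) w).
- f_equal; symmetry; exact (scal_opp_one (V := @l1_ModuleSpace R_AbsRing) a).
- rewrite evalC_scal; apply injective_projections; simpl; ring.
Qed.

Lemma evalC_xsub (a b : X) : evalC (a - b)%X w = (evalC a w - evalC b w)%C.
Proof.
change (a - b)%X with (a + (- b))%X; rewrite evalC_xadd, evalC_xopp; reflexivity.
Qed.

Lemma evalC_xshift (a : X) : evalC (xshift a) w = (w * evalC a w)%C.
Proof.
rewrite !evalC_sumC, <- sumC_scal by apply evalC_summable, Hw.
destruct (ex_series_ReIm _ (evalC_summable (xshift a) w Hw)) as [HR HI].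
unfold sumC; rewrite (Series_incr_1 _ HR), (Series_incr_1 _ HI); f_equal.
- replace (Re (RtoC (xshift a 0%nat) * w ^ 0)%C) with 0 by (simpl; ring).
  rewrite Rplus_0_l; apply Series_ext; intros k; f_equal; simpl; ring.
- replace (Im (RtoC (xshift a 0%nat) * w ^ 0)%C) with 0 by (simpl; ring).
  rewrite Rplus_0_l; apply Series_ext; intros k; f_equal; simpl; ring.
Qed.

Lemma evalC_cst (r : R) : evalC (cst r) w = RtoC r.
Proof.
unfold evalC; transitivity ((r, 0) : C); [f_equal | reflexivity].
- rewrite Series_incr_1.
  + rewrite (Series_ext _ (fun _ => 0)); [|intros k; simpl; ring].
    rewrite (is_series_unique _ _ is_series_0); simpl; ring.
  + destruct (ex_series_ReIm _ (evalC_summable (cst r) w Hw)) as [HR _].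
    apply ex_series_ext with (2 := HR); intros k; destruct (w ^ k)%C; unfold Re, Cmult, RtoC; simpl; ring.
- rewrite (Series_ext _ (fun _ => 0)); [apply (is_series_unique _ _ is_series_0)|].
  intros [|k]; simpl; ring.
Qed.

Lemma evalC_x1 : evalC x1 w = RtoC 1.
Proof. apply evalC_cst. Qed.

Lemma evalC_x0 : evalC x0 w = RtoC 0.
Proof. rewrite <- evalC_cst; f_equal; apply l1_eq; intros [|k]; reflexivity. Qed.

Lemma evalC_xw : evalC xw w = w.
Proof. unfold xw; rewrite evalC_xshift, evalC_x1; ring. Qed.

Lemma evalC_xmul (a b : X) : evalC (a * b)%X w = (evalC a w * evalC b w)%C.
Proof.
unfold xmul; rewrite (evalC_lc _ _ _ (iter_xshift_bounded b) w Hw).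
rewrite (evalC_sumC a), Cmult_comm, <- sumC_scal by apply evalC_summable, Hw.
apply sumC_ext; intros k.
assert (E : evalC (Nat.iter k xshift b) w = (w ^ k * evalC b w)%C).
{ induction k as [|k IH]; simpl; [ring|]; rewrite evalC_xshift, IH; ring. }
rewrite E; ring.
Qed.

Lemma evalC_xpow (a : X) (k : nat) : evalC (a ^ k)%X w = (evalC a w ^ k)%C.
Proof.
induction k as [|k IH]; simpl; [apply evalC_x1 | now rewrite evalC_xmul, IH].
Qed.

Lemma evalC_xcomp (f a : X) : nrm a <= 1 -> evalC (xcomp f a) w = evalC f (evalC a w).
Proof.
intros H; unfold xcomp; rewrite (evalC_lc _ _ 1) by (try exact Hw; intros k; apply nrm_pow_le1, H).
rewrite evalC_sumC; apply sumC_ext; intros k; now rewrite evalC_xpow.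
Qed.

End Eval.

(** Every axiom holds for the values on the disk, and [evalC_inj] carries it back. The convolution
    itself is never expanded. *)
Lemma X_ring_theory : ring_theory x0 x1 xadd xmul xsub xopp eq.
Proof.
split; intros; apply evalC_inj; intros w Hw; apply Rlt_le in Hw;
repeat rewrite ?evalC_xadd, ?evalC_xmul, ?evalC_xsub, ?evalC_xopp, ?evalC_x0, ?evalC_x1 by exact Hw;
ring.
Qed.

Add Ring X_ring : X_ring_theory.

Lemma xshift_mul (a : X) : xshift a = (xw * a)%X.
Proof.
apply evalC_inj; intros w Hw; apply Rlt_le in Hw.
now rewrite evalC_xshift, evalC_xmul, evalC_xw by exact Hw.
Qed.

Lemma scal_cst (r : R) (a : X) : scal r a = (cst r * a)%X.
Proof.
apply evalC_inj; intros w Hw; apply Rlt_le in Hw.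
now rewrite evalC_scal, evalC_xmul, evalC_cst by exact Hw.
Qed.

Lemma cst_add (r t : R) : cst (r + t) = (cst r + cst t)%X.
Proof. apply l1_eq; intros [|k]; [reflexivity|]; symmetry; apply Rplus_0_l. Qed.

Lemma cst_opp (r : R) : cst (- r) = (- cst r)%X.
Proof. apply l1_eq; intros [|k]; [reflexivity|]; symmetry; exact Ropp_0. Qed.

Lemma cst_mul (r t : R) : cst (r * t) = (cst r * cst t)%X.
Proof.
rewrite <- scal_cst; apply l1_eq; intros [|k]; [reflexivity|]; symmetry; exact (Rmult_0_r r).
Qed.

Lemma cst_0 : cst 0 = x0.
Proof. apply l1_eq; intros [|k]; reflexivity. Qed.

Lemma xtail_xshift (a : X) : xtail (xshift a) = a.
Proof. apply l1_eq; reflexivity. Qed.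

Lemma xdecomp (a : X) : a = (cst (a 0%nat) + xw * xtail a)%X.
Proof.
rewrite <- xshift_mul; apply l1_eq; intros [|k].
- symmetry; exact (Rplus_0_r (a 0%nat)).
- symmetry; exact (Rplus_0_l (a (S k))).
Qed.

Lemma xadd_coef (a b : X) (k : nat) : (a + b)%X k = a k + b k.
Proof. reflexivity. Qed.

Lemma xtail_add (a b : X) : xtail (a + b)%X = (xtail a + xtail b)%X.
Proof. apply l1_eq; reflexivity. Qed.

Lemma xtail_mul_cst (r : R) (a : X) : xtail (cst r * a)%X = (cst r * xtail a)%X.
Proof. rewrite <- !scal_cst; apply l1_eq; reflexivity. Qed.

Lemma nrm_w_mul (a : X) : nrm (xw * a)%X = nrm a.
Proof. rewrite <- xshift_mul; apply nrm_xshift. Qed.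

Lemma nrm_cst_mul (r : R) (a : X) : nrm (cst r * a)%X = Rabs r * nrm a.
Proof.
rewrite <- scal_cst; unfold l1_norm; rewrite <- Series_scal_l; apply Series_ext; intros k.
apply Rabs_mult.
Qed.

(** * Linear combinations and compositions *)

Lemma ex_series_lc_coef (f : X) (y : nat -> X) (M : R) (n : nat) :
  bounded_by M y -> ex_series (fun k => f k * y k n).
Proof.
intros H; apply ex_series_dom with (fun k => M * Rabs (f k)).
- intros k; rewrite Rabs_mult, Rmult_comm; apply Rmult_le_compat_r; [apply Rabs_pos|].
  apply Rle_trans with (2 := H k); exact (l1_abs_coef_le (y k) n).
- apply ex_series_mult_l, (l1_summable f).
Qed.

Lemma lc_add_l (f g : X) (y : nat -> X) (M : R) :
  bounded_by M y -> lc (f + g)%X y = (lc f y + lc g y)%X.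
Proof.
intros H; apply l1_eq; intros n; rewrite xadd_coef, !(lc_coef _ y M H).
rewrite <- Series_plus by (apply (ex_series_lc_coef _ y M n H)).
apply Series_ext; intros k; rewrite xadd_coef; ring.
Qed.

Lemma lc_cst_l (r : R) (f : X) (y : nat -> X) (M : R) :
  bounded_by M y -> lc (cst r * f)%X y = (cst r * lc f y)%X.
Proof.
intros H; rewrite <- !scal_cst; apply l1_eq; intros n.
change (scal r (lc f y) n) with (r * lc f y n); rewrite !(lc_coef _ y M H), <- Series_scal_l.
apply Series_ext; intros k; change (scal r f k) with (r * f k); ring.
Qed.

Lemma lc_add_r (f : X) (y z : nat -> X) (M N : R) :
  bounded_by M y -> bounded_by N z ->
  lc f (fun k => (y k + z k)%X) = (lc f y + lc f z)%X.
Proof.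
intros H H'.
assert (H2 : bounded_by (M + N) (fun k => (y k + z k)%X)).
{ intros k; apply Rle_trans with (1 := nrm_add _ _), Rplus_le_compat; [apply H | apply H']. }
apply l1_eq; intros n; rewrite xadd_coef, (lc_coef _ _ _ H2), (lc_coef _ _ _ H), (lc_coef _ _ _ H').
rewrite <- Series_plus by (eapply ex_series_lc_coef; eassumption).
apply Series_ext; intros k; rewrite xadd_coef; ring.
Qed.

Lemma lc_mul_r (f b : X) (y : nat -> X) (M : R) :
  bounded_by M y -> lc f (fun k => (y k * b)%X) = (lc f y * b)%X.
Proof.
intros H.
assert (H2 : bounded_by (M * nrm b) (fun k => (y k * b)%X)).
{ intros k; apply Rle_trans with (1 := nrm_mul _ _), Rmult_le_compat_r; [apply nrm_ge0 | apply H]. }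
assert (M0 : 0 <= M) by (apply Rle_trans with (2 := H O); apply nrm_ge0).
apply evalC_inj; intros w Hw; apply Rlt_le in Hw.
rewrite evalC_xmul, (evalC_lc _ _ _ H2 w Hw), (evalC_lc _ _ _ H w Hw), Cmult_comm by exact Hw.
rewrite <- sumC_scal.
- apply sumC_ext; intros k; rewrite evalC_xmul by exact Hw; ring.
- apply ex_series_dom with (fun k => M * Rabs (f k)); [|apply ex_series_mult_l, (l1_summable f)].
  intros k; rewrite Rabs_pos_eq by apply Cmod_ge_0.
  rewrite Cmod_mult, Cmod_R, Rmult_comm; apply Rmult_le_compat_r; [apply Rabs_pos|].
  apply Rle_trans with (2 := H k), evalC_bound, Hw.
Qed.

Lemma xpow_bounded (a : X) : nrm a <= 1 -> bounded_by 1 (xpow a).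
Proof. intros H k; apply nrm_pow_le1, H. Qed.

(** The number $c/(1-\rho)$ is the fixed point of the recurrence, and no term starting below it can
    pass it. This yields bounds uniform in the exponent, as [lc] requires, for $ka^{k-1}$, for
    increments of powers and for their Taylor remainders. *)
Lemma geometric_bound (rho c : R) (t : nat -> R) :
  0 <= rho < 1 -> 0 <= c -> t O <= 0 -> (forall k, t (S k) <= rho * t k + c) ->
  forall k, t k <= c / (1 - rho).
Proof.
intros Hr Hc H0 Hs; induction k as [|k IH].
- apply Rle_trans with (1 := H0), Rdiv_le_0_compat; lra.
- apply Rle_trans with (1 := Hs k).
  replace (c / (1 - rho)) with (rho * (c / (1 - rho)) + c) by (field; lra).
  apply Rplus_le_compat_r, Rmult_le_compat_l; [lra | exact IH].
Qed.

Lemma dpow_bounded (a : X) (rho : R) : nrm a <= rho -> rho < 1 -> bounded_by (1 / (1 - rho)) (dpow a).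
Proof.
intros H Hr; assert (P := nrm_ge0 a).
unfold bounded_by; apply (geometric_bound rho 1 (fun k => nrm (dpow a k))); try lra.
- simpl; rewrite nrm_x0; lra.
- intros k; simpl; apply Rle_trans with (1 := nrm_add _ _), Rplus_le_compat; [|apply nrm_pow_le1; lra].
  apply Rle_trans with (1 := nrm_mul _ _), Rmult_le_compat_r; [apply nrm_ge0 | exact H].
Qed.

Section CompTaylor.

Variables (a b : X) (rho : R).
Hypotheses (Ha : nrm a <= rho) (Hab : nrm (a + b)%X <= rho) (Hr : rho < 1).

Let rho_pos : 0 <= rho.
Proof. apply Rle_trans with (2 := Ha), nrm_ge0. Qed.

Lemma pow_increment (k : nat) : nrm ((a + b) ^ k - a ^ k)%X <= nrm b / (1 - rho).
Proof.
revert k; apply (geometric_bound rho (nrm b) (fun k => nrm ((a + b) ^ k - a ^ k)%X)).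
- lra.
- apply nrm_ge0.
- simpl; replace (x1 - x1)%X with x0 by ring; rewrite nrm_x0; lra.
- intros k; simpl.
  replace ((a + b) * (a + b) ^ k - a * a ^ k)%X with ((a + b) * ((a + b) ^ k - a ^ k) + b * a ^ k)%X by ring.
  apply Rle_trans with (1 := nrm_add _ _), Rplus_le_compat.
  + apply Rle_trans with (1 := nrm_mul _ _), Rmult_le_compat_r; [apply nrm_ge0 | exact Hab].
  + apply Rle_trans with (1 := nrm_mul _ _); rewrite <- (Rmult_1_r (nrm b)) at 2.
    apply Rmult_le_compat_l; [apply nrm_ge0 | apply nrm_pow_le1; lra].
Qed.

(** The remainder for the exponent $k+1$ is [a] times the one for [k] plus [b] times the increment
    of the [k]-th power, and that increment is already of first order in [b]. *)
Lemma pow_remainder (k : nat) :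
  nrm ((a + b) ^ k - a ^ k - dpow a k * b)%X <= nrm b * (nrm b / (1 - rho)) / (1 - rho).
Proof.
assert (P : 0 <= nrm b / (1 - rho)) by (apply Rdiv_le_0_compat; [apply nrm_ge0 | lra]).
revert k; apply (geometric_bound rho _ (fun k => nrm ((a + b) ^ k - a ^ k - dpow a k * b)%X)).
- lra.
- apply Rmult_le_pos; [apply nrm_ge0 | exact P].
- simpl; replace (x1 - x1 - x0 * b)%X with x0 by ring; rewrite nrm_x0; lra.
- intros k; simpl.
  replace ((a + b) * (a + b) ^ k - a * a ^ k - (a * dpow a k + a ^ k) * b)%X with
    (a * ((a + b) ^ k - a ^ k - dpow a k * b) + b * ((a + b) ^ k - a ^ k))%X by ring.
  apply Rle_trans with (1 := nrm_add _ _), Rplus_le_compat.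
  + apply Rle_trans with (1 := nrm_mul _ _), Rmult_le_compat_r; [apply nrm_ge0 | exact Ha].
  + apply Rle_trans with (1 := nrm_mul _ _), Rmult_le_compat_l; [apply nrm_ge0 | apply pow_increment].
Qed.

Lemma comp_increment (f : X) :
  nrm (xcomp f (a + b) - xcomp f a)%X <= nrm b / (1 - rho) * nrm f.
Proof.
assert (E : xcomp f (a + b) = (xcomp f a + lc f (fun k => ((a + b) ^ k - a ^ k)%X))%X).
{ unfold xcomp; rewrite <- (lc_add_r f _ _ 1 (nrm b / (1 - rho))).
  - f_equal; apply functional_extensionality; intros k; ring.
  - apply xpow_bounded; lra.
  - exact pow_increment. }
rewrite E; replace (_ - _)%X with (lc f (fun k => (a + b) ^ k - a ^ k)%X) by ring.
apply lc_norm; exact pow_increment.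
Qed.

Lemma comp_remainder (f : X) :
  nrm (xcomp f (a + b) - xcomp f a - xdcomp f a * b)%X
  <= nrm b * (nrm b / (1 - rho)) / (1 - rho) * nrm f.
Proof.
assert (D := dpow_bounded a rho Ha Hr).
assert (D2 : bounded_by (1 / (1 - rho) * nrm b) (fun k => (dpow a k * b)%X)).
{ intros k; apply Rle_trans with (1 := nrm_mul _ _), Rmult_le_compat_r; [apply nrm_ge0 | apply D]. }
assert (E : xcomp f (a + b) =
  (xcomp f a + (xdcomp f a * b + lc f (fun k => ((a + b) ^ k - a ^ k - dpow a k * b)%X)))%X).
{ unfold xcomp, xdcomp; rewrite <- (lc_mul_r f b _ _ D).
  rewrite <- (lc_add_r f _ _ _ _ D2 pow_remainder).
  rewrite <- (lc_add_r f _ _ 1 (1 / (1 - rho) * nrm b + nrm b * (nrm b / (1 - rho)) / (1 - rho))).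
  - f_equal; apply functional_extensionality; intros k; ring.
  - apply xpow_bounded; lra.
  - intros k; apply Rle_trans with (1 := nrm_add _ _), Rplus_le_compat; [apply D2 | apply pow_remainder]. }
rewrite E; replace (_ - _ - _)%X with (lc f (fun k => (a + b) ^ k - a ^ k - dpow a k * b)%X) by ring.
apply lc_norm; exact pow_remainder.
Qed.

End CompTaylor.

Lemma comp_add_l (f g a : X) : nrm a <= 1 -> xcomp (f + g)%X a = (xcomp f a + xcomp g a)%X.
Proof. intros H; exact (lc_add_l f g _ 1 (xpow_bounded a H)). Qed.

Lemma comp_cst_l (r : R) (f a : X) : nrm a <= 1 -> xcomp (cst r * f)%X a = (cst r * xcomp f a)%X.
Proof. intros H; exact (lc_cst_l r f _ 1 (xpow_bounded a H)). Qed.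

Lemma nrm_comp (f a : X) : nrm a <= 1 -> nrm (xcomp f a) <= nrm f.
Proof. intros H; rewrite <- (Rmult_1_l (nrm f)); exact (lc_norm f _ 1 (xpow_bounded a H)). Qed.

(** * Differentiability with quadratic remainder *)

Notation nrmY := (@pair_norm R_AbsRing).

Record lin (L : Y -> X) : Prop := Lin {
  lin_add : forall h k : Y, L (plus h k) = (L h + L k)%X;
  lin_scal : forall (c : R) (h : Y), L (scal c h) = (cst c * L h)%X;
  lin_bdd : exists M, 0 <= M /\ forall h, nrm (L h) <= M * nrmY h }.

(** An explicit quadratic remainder instead of a little-o: sums, products, inverses and compositions
    keep it by plain inequalities, and filters enter only in [qd_filterdiff]. *)
Definition qd (A : Y -> X) (F : Y) (L : Y -> X) : Prop :=
  lin L /\ exists B delta, 0 < delta /\ 0 <= B /\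
  forall h : Y, nrmY h <= delta ->
    nrm (A (plus F h) - A F - L h)%X <= B * (nrmY h * nrmY h).

Lemma nrmY_ge0 (h : Y) : 0 <= nrmY h.
Proof. apply Rplus_le_le_0_compat; apply nrm_ge0. Qed.

Lemma qd_ext (A A' : Y -> X) (F : Y) (L L' : Y -> X) :
  (forall G, A G = A' G) -> (forall h, L h = L' h) -> qd A F L -> qd A' F L'.
Proof.
intros HA HL; apply functional_extensionality in HA; apply functional_extensionality in HL.
now subst.
Qed.

Lemma lin_sum (L L' : Y -> X) : lin L -> lin L' -> lin (fun h => L h + L' h)%X.
Proof.
intros [a1 s1 [M [M0 b1]]] [a2 s2 [N [N0 b2]]]; split.
- intros; rewrite a1, a2; ring.
- intros; rewrite s1, s2; ring.
- exists (M + N); split; [lra|]; intros h; apply Rle_trans with (1 := nrm_add _ _).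
  rewrite Rmult_plus_distr_r; apply Rplus_le_compat; auto.
Qed.

Lemma lin_mul (a : X) (L : Y -> X) : lin L -> lin (fun h => a * L h)%X.
Proof.
intros [a1 s1 [M [M0 b1]]]; split.
- intros; rewrite a1; ring.
- intros; rewrite s1; ring.
- exists (nrm a * M); split; [apply Rmult_le_pos; [apply nrm_ge0 | exact M0]|].
  intros h; apply Rle_trans with (1 := nrm_mul _ _); rewrite Rmult_assoc.
  apply Rmult_le_compat_l; [apply nrm_ge0 | apply b1].
Qed.

Lemma lin_zero : lin (fun _ => x0).
Proof.
split; [intros; ring | intros; ring|].
exists 0; split; [lra|]; intros h; rewrite nrm_x0; lra.
Qed.

Lemma lin_tail (L : Y -> X) : lin L -> lin (fun h => xtail (L h)).
Proof.
intros [a1 s1 [M [M0 b1]]]; split.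
- intros; rewrite a1; apply xtail_add.
- intros; rewrite s1; apply xtail_mul_cst.
- exists M; split; [exact M0|]; intros h; apply Rle_trans with (1 := nrm_xtail _), b1.
Qed.

Lemma pf_scal (c : R) (h : Y) : pf (scal c h) = (cst c * pf h)%X.
Proof. rewrite <- scal_cst; reflexivity. Qed.

Lemma pg_scal (c : R) (h : Y) : pg (scal c h) = (cst c * pg h)%X.
Proof. rewrite <- scal_cst; reflexivity. Qed.

Lemma nrm_pf (h : Y) : nrm (pf h) <= nrmY h.
Proof. assert (P := nrm_ge0 (pg h)); change (nrmY h) with (nrm (pf h) + nrm (pg h)); lra. Qed.

Lemma nrm_pg (h : Y) : nrm (pg h) <= nrmY h.
Proof. assert (P := nrm_ge0 (pf h)); change (nrmY h) with (nrm (pf h) + nrm (pg h)); lra. Qed.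

Lemma lin_pf : lin pf.
Proof.
split; [reflexivity | apply pf_scal |].
exists 1; split; [lra|]; intros h; rewrite Rmult_1_l; apply nrm_pf.
Qed.

Lemma lin_pg : lin pg.
Proof.
split; [reflexivity | apply pg_scal |].
exists 1; split; [lra|]; intros h; rewrite Rmult_1_l; apply nrm_pg.
Qed.

Lemma lin_comp (L : Y -> X) (a : X) : nrm a <= 1 -> lin L -> lin (fun h => xcomp (L h) a).
Proof.
intros Ha [a1 s1 [M [M0 b1]]]; split.
- intros; rewrite a1; apply comp_add_l, Ha.
- intros; rewrite s1; apply comp_cst_l, Ha.
- exists M; split; [exact M0|]; intros h; apply Rle_trans with (2 := b1 h), nrm_comp, Ha.
Qed.

Lemma qd_lin (L : Y -> X) (F : Y) : lin L -> qd L F L.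
Proof.
intros H; split; [exact H|]; exists 0, 1; split; [lra|]; split; [lra|].
intros h _; rewrite (lin_add _ H); replace (_ - _ - _)%X with x0 by ring.
rewrite nrm_x0; lra.
Qed.

Lemma qd_const (a : X) (F : Y) : qd (fun _ => a) F (fun _ => x0).
Proof.
split; [apply lin_zero|]; exists 0, 1; split; [lra|]; split; [lra|].
intros h _; replace (_ - _ - _)%X with x0 by ring; rewrite nrm_x0; lra.
Qed.

(** On a ball of radius [delta] the quadratic remainder is at most $B\delta\|h\|$. The resulting
    Lipschitz bound controls the mixed terms of products, inverses and compositions. *)
Lemma qd_lipschitz (A : Y -> X) (F : Y) (L : Y -> X) : qd A F L ->
  exists M delta, 0 < delta /\ 0 <= M /\ forall h : Y, nrmY h <= delta ->
    nrm (A (plus F h) - A F)%X <= M * nrmY h.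
Proof.
intros [[_ _ [M [M0 HM]]] [B [delta [Hd [HB H]]]]].
exists (B * delta + M), delta; split; [exact Hd|]; split; [nra|].
intros h Hh; replace (A (plus F h) - A F)%X with ((A (plus F h) - A F - L h) + L h)%X by ring.
apply Rle_trans with (1 := nrm_add _ _).
assert (Q := H h Hh); assert (Q' := HM h); assert (P := nrmY_ge0 h).
assert (B * (nrmY h * nrmY h) <= B * delta * nrmY h); [|lra].
rewrite Rmult_assoc; apply Rmult_le_compat_l; [exact HB|]; nra.
Qed.

Lemma qd_add (A B : Y -> X) (F : Y) (L K : Y -> X) :
  qd A F L -> qd B F K -> qd (fun G => A G + B G)%X F (fun h => L h + K h)%X.
Proof.
intros [L1 [b [d1 [Hd [Hb H]]]]] [L2 [c [d2 [Hd' [Hc H']]]]].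
split; [apply lin_sum; assumption|].
exists (b + c), (Rmin d1 d2); split; [apply Rmin_pos; assumption|]; split; [lra|].
intros h Hh.
assert (h1 := H h (Rle_trans _ _ _ Hh (Rmin_l _ _))).
assert (h2 := H' h (Rle_trans _ _ _ Hh (Rmin_r _ _))).
replace (_ - _ - _)%X with ((A (plus F h) - A F - L h) + (B (plus F h) - B F - K h))%X by ring.
apply Rle_trans with (1 := nrm_add _ _); lra.
Qed.

Lemma qd_mul (A B : Y -> X) (F : Y) (L K : Y -> X) :
  qd A F L -> qd B F K -> qd (fun G => A G * B G)%X F (fun h => B F * L h + A F * K h)%X.
Proof.
intros HA HB.
destruct (qd_lipschitz _ _ _ HA) as [M [e1 [He1 [HM LA]]]].
destruct (qd_lipschitz _ _ _ HB) as [N [e2 [He2 [HN LB]]]].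
destruct HA as [L1 [b [d1 [Hd [Hb H]]]]]; destruct HB as [L2 [c [d2 [Hd' [Hc H']]]]].
split; [apply lin_sum; apply lin_mul; assumption|].
exists (nrm (B F) * b + nrm (A F) * c + M * N), (Rmin (Rmin d1 d2) (Rmin e1 e2)).
split; [repeat apply Rmin_pos; assumption|].
assert (P1 := nrm_ge0 (B F)); assert (P2 := nrm_ge0 (A F)).
split; [assert (0 <= M * N) by (apply Rmult_le_pos; assumption);
  assert (0 <= nrm (B F) * b) by (apply Rmult_le_pos; assumption);
  assert (0 <= nrm (A F) * c) by (apply Rmult_le_pos; assumption); lra|].
intros h Hh.
assert (U1 := Rmin_l (Rmin d1 d2) (Rmin e1 e2)); assert (U2 := Rmin_r (Rmin d1 d2) (Rmin e1 e2)).
assert (U3 := Rmin_l d1 d2); assert (U4 := Rmin_r d1 d2).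
assert (U5 := Rmin_l e1 e2); assert (U6 := Rmin_r e1 e2).
assert (h1 := H h ltac:(lra)); assert (h2 := H' h ltac:(lra)).
assert (h3 := LA h ltac:(lra)); assert (h4 := LB h ltac:(lra)).
replace (_ - _ - _)%X with
  (B F * (A (plus F h) - A F - L h) + A F * (B (plus F h) - B F - K h)
   + (A (plus F h) - A F) * (B (plus F h) - B F))%X by ring.
apply Rle_trans with (1 := nrm_add _ _).
rewrite Rmult_plus_distr_r; apply Rplus_le_compat.
- apply Rle_trans with (1 := nrm_add _ _).
  rewrite Rmult_plus_distr_r, !Rmult_assoc.
  apply Rplus_le_compat; apply Rle_trans with (1 := nrm_mul _ _);
  apply Rmult_le_compat_l; assumption.
- apply Rle_trans with (1 := nrm_mul _ _).
  replace (M * N * (nrmY h * nrmY h)) with ((M * nrmY h) * (N * nrmY h)) by ring.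
  apply Rmult_le_compat; try assumption; apply nrm_ge0.
Qed.

Lemma qd_tail (A : Y -> X) (F : Y) (L : Y -> X) :
  qd A F L -> qd (fun G => xtail (A G)) F (fun h => xtail (L h)).
Proof.
intros [L1 [b [d1 [Hd [Hb H]]]]]; split; [apply lin_tail, L1|].
exists b, d1; split; [exact Hd|]; split; [exact Hb|]; intros h Hh.
replace (xtail (A (plus F h)) - xtail (A F) - xtail (L h))%X with (xtail (A (plus F h) - A F - L h)%X).
- apply Rle_trans with (1 := nrm_xtail _), H, Hh.
- apply l1_eq; reflexivity.
Qed.

(** No inverse is constructed: the identity $AB=1$ near [F] and a uniform bound on [B] suffice. With
    $A_0,B_0$ taken at [F] and $A_1,B_1$ nearby, the remainder is
    $-B_0^2(A_1-A_0-Lh)+B_0^2B_1(A_1-A_0)^2$, which is quadratic by the Lipschitz bound of [A]. *)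
Lemma qd_inv (A B : Y -> X) (F : Y) (L : Y -> X) (N delta : R) :
  qd A F L -> 0 < delta ->
  (forall h, nrmY h <= delta -> (A (plus F h) * B (plus F h))%X = x1 /\ nrm (B (plus F h)) <= N) ->
  qd B F (fun h => - (B F * B F) * L h)%X.
Proof.
intros HA Hdl HAB.
destruct (qd_lipschitz _ _ _ HA) as [M [e1 [He1 [HM LA]]]].
destruct HA as [L1 [b [d1 [Hd [Hb H]]]]].
split; [apply lin_mul, L1|].
assert (Z0 : nrmY zero = 0) by (exact (norm_zero (V := @pair_NormedModule R_AbsRing))).
destruct (HAB zero ltac:(lra)) as [E0 N0]; rewrite (plus_zero_r F : plus F zero = F) in E0, N0.
assert (NP : 0 <= N) by (apply Rle_trans with (2 := N0), nrm_ge0).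
exists (N * N * b + N * N * (N * (M * M))), (Rmin (Rmin d1 delta) e1).
split; [repeat apply Rmin_pos; assumption|].
assert (Q1 : 0 <= N * N) by (apply Rmult_le_pos; assumption).
assert (Q2 : 0 <= M * M) by (apply Rmult_le_pos; assumption).
assert (Q3 : 0 <= N * (M * M)) by (apply Rmult_le_pos; assumption).
split; [apply Rplus_le_le_0_compat; apply Rmult_le_pos; assumption|].
intros h Hh.
assert (U1 := Rmin_l (Rmin d1 delta) e1); assert (U2 := Rmin_r (Rmin d1 delta) e1).
assert (U3 := Rmin_l d1 delta); assert (U4 := Rmin_r d1 delta).
assert (h1 := H h ltac:(lra)); assert (h3 := LA h ltac:(lra)).
destruct (HAB h ltac:(lra)) as [E1 N1].
set (A0 := A F) in *; set (B0 := B F) in *; set (A1 := A (plus F h)) in *; set (B1 := B (plus F h)) in *.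
assert (E : (B1 - B0 - - (B0 * B0) * L h)%X =
  (- (B0 * B0) * (A1 - A0 - L h) + (B0 * B0) * (B1 * ((A1 - A0) * (A1 - A0))))%X).
(* Both sides are spelled out so that the products $A_0B_0$ and $A_1B_1$ are visible; once these are
   rewritten to 1, a ring identity remains. *)
{ transitivity (B1 * (A0 * B0) * (A0 * B0) - B0 * (A1 * B1) * (A0 * B0) + (B0 * B0) * (L h)
   + B0 * (A1 * B1) * (A0 * B0) - B1 * (A0 * B0) * (A0 * B0) + B1 - B0)%X; [ring|].
  transitivity (- (B0 * B0 * A1) + B0 * (A0 * B0) + B0 * B0 * L h +
   (B0 * A1) * (B0 * (A1 * B1)) - (B0 * (A0 * B0)) * (A1 * B1) - (A0 * B0) * (B0 * (A1 * B1)) + (A0 * B0) * (A0 * B0) * B1)%X; [|ring].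
  rewrite E0, E1; ring. }
rewrite E; apply Rle_trans with (1 := nrm_add _ _).
rewrite Rmult_plus_distr_r; apply Rplus_le_compat.
- apply Rle_trans with (1 := nrm_mul _ _); rewrite nrm_opp, Rmult_assoc.
  replace (N * (N * (b * (nrmY h * nrmY h)))) with ((N * N) * (b * (nrmY h * nrmY h))) by ring.
  apply Rmult_le_compat; try assumption; try apply nrm_ge0.
  apply Rle_trans with (1 := nrm_mul _ _); apply Rmult_le_compat; try assumption; apply nrm_ge0.
- apply Rle_trans with (1 := nrm_mul _ _).
  rewrite Rmult_assoc; apply Rmult_le_compat; try apply nrm_ge0.
  + apply Rle_trans with (1 := nrm_mul _ _); apply Rmult_le_compat; try assumption; apply nrm_ge0.
  + apply Rle_trans with (1 := nrm_mul _ _); rewrite Rmult_assoc.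
    apply Rmult_le_compat; try assumption; try apply nrm_ge0.
    apply Rle_trans with (1 := nrm_mul _ _).
    replace (M * M * (nrmY h * nrmY h)) with ((M * nrmY h) * (M * nrmY h)) by ring.
    apply Rmult_le_compat; try assumption; apply nrm_ge0.
Qed.

Lemma qd_comp (A B : Y -> X) (F : Y) (L K : Y -> X) :
  qd A F L -> qd B F K -> nrm (B F) < 1 ->
  qd (fun G => xcomp (A G) (B G)) F (fun h => xcomp (L h) (B F) + xdcomp (A F) (B F) * K h)%X.
Proof.
intros HA HB H1.
destruct (qd_lipschitz _ _ _ HA) as [M [e1 [He1 [HM LA]]]].
destruct (qd_lipschitz _ _ _ HB) as [N [e2 [He2 [HN LB]]]].
destruct HA as [L1 [b [d1 [Hd [Hb H]]]]]; destruct HB as [L2 [c [d2 [Hd' [Hc H']]]]].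
split; [apply lin_sum; [apply lin_comp; [lra|exact L1] | apply lin_mul, L2]|].
(* A radius halfway between $\|B(F)\|$ and 1. The bound [e3] on the step keeps $B(F+h)$ inside it,
   so that the estimates with $1/(1-\rho)$ apply at both arguments. *)
set (rho := (1 + nrm (B F)) / 2).
assert (R1 : nrm (B F) < rho < 1) by (unfold rho; lra).
assert (R0 := nrm_ge0 (B F)).
set (q := / (1 - rho)).
assert (Q0 : 0 < q) by (apply Rinv_0_lt_compat; lra).
set (e3 := (rho - nrm (B F)) / (N + 1)).
assert (He3 : 0 < e3) by (apply Rdiv_lt_0_compat; lra).
assert (DP := nrm_ge0 (xdcomp (A F) (B F))); assert (AP := nrm_ge0 (A F)).
exists (b + M * N * q + nrm (A F) * (N * N) * (q * q) + nrm (xdcomp (A F) (B F)) * c),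
  (Rmin (Rmin (Rmin d1 d2) (Rmin e1 e2)) e3).
split; [repeat apply Rmin_pos; assumption|].
split.
{ repeat apply Rplus_le_le_0_compat; repeat apply Rmult_le_pos; try assumption; lra. }
intros h Hh.
assert (U0 := Rmin_l (Rmin (Rmin d1 d2) (Rmin e1 e2)) e3); assert (U0' := Rmin_r (Rmin (Rmin d1 d2) (Rmin e1 e2)) e3).
assert (U1 := Rmin_l (Rmin d1 d2) (Rmin e1 e2)); assert (U2 := Rmin_r (Rmin d1 d2) (Rmin e1 e2)).
assert (U3 := Rmin_l d1 d2); assert (U4 := Rmin_r d1 d2).
assert (U5 := Rmin_l e1 e2); assert (U6 := Rmin_r e1 e2).
assert (h1 := H h ltac:(lra)); assert (h2 := H' h ltac:(lra)).
assert (h3 := LA h ltac:(lra)); assert (h4 := LB h ltac:(lra)).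
assert (tp := nrmY_ge0 h); set (t := nrmY h) in *.
set (A0 := A F) in *; set (B0 := B F) in *; set (A1 := A (plus F h)) in *.
set (bb := (B (plus F h) - B0)%X) in *.
replace (B (plus F h)) with (B0 + bb)%X by (unfold bb; ring).
assert (Hbb : nrm (B0 + bb)%X <= rho).
{ apply Rle_trans with (1 := nrm_add _ _).
  assert (N * t <= (N + 1) * e3) by nra.
  replace ((N + 1) * e3) with (rho - nrm B0) in H0 by (unfold e3; field; lra); lra. }
assert (HB0 : nrm B0 <= rho) by lra.
assert (C1 : nrm (B0 + bb)%X <= 1) by lra.
set (aa := (A1 - A0)%X) in *.
replace A1 with (A0 + aa)%X by (unfold aa; ring).
rewrite comp_add_l by exact C1.
(* Four errors: the remainder of [A] composed with the old argument, the product of both increments,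
   the Taylor remainder of the composition, and the remainder of [B] carried by the derivative. *)
replace (xcomp A0 (B0 + bb) + xcomp aa (B0 + bb) - xcomp A0 B0 - (xcomp (L h) B0 + xdcomp A0 B0 * K h))%X
 with (((xcomp aa B0 - xcomp (L h) B0) + (xcomp aa (B0 + bb) - xcomp aa B0))
  + (xcomp A0 (B0 + bb) - xcomp A0 B0 - xdcomp A0 B0 * bb) + xdcomp A0 B0 * (bb - K h))%X by ring.
rewrite !Rmult_plus_distr_r.
apply Rle_trans with (1 := nrm_add _ _), Rplus_le_compat.
apply Rle_trans with (1 := nrm_add _ _), Rplus_le_compat.
apply Rle_trans with (1 := nrm_add _ _), Rplus_le_compat.
- replace (xcomp aa B0 - xcomp (L h) B0)%X with (xcomp (aa - L h) B0).
  + apply Rle_trans with (2 := h1), nrm_comp; lra.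
  + replace aa with ((aa - L h) + L h)%X at 2 by ring.
    rewrite (comp_add_l (aa - L h)%X) by lra; ring.
- apply Rle_trans with (1 := comp_increment B0 bb rho HB0 Hbb (proj2 R1) aa).
  change (nrm bb * q * nrm aa <= M * N * q * (t * t)).
  replace (M * N * q * (t * t)) with ((N * t) * q * (M * t)) by ring.
  apply Rmult_le_compat; try apply nrm_ge0; try assumption.
  + apply Rmult_le_pos; [apply nrm_ge0 | lra].
  + apply Rmult_le_compat_r; [lra | exact h4].
- apply Rle_trans with (1 := comp_remainder B0 bb rho HB0 Hbb (proj2 R1) A0).
  change (nrm bb * (nrm bb * q) * q * nrm A0 <= nrm A0 * (N * N) * (q * q) * (t * t)).
  replace (nrm A0 * (N * N) * (q * q) * (t * t)) with ((nrm A0 * (q * q)) * ((N * t) * (N * t))) by ring.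
  replace (nrm bb * (nrm bb * q) * q * nrm A0) with ((nrm A0 * (q * q)) * (nrm bb * nrm bb)) by ring.
  apply Rmult_le_compat_l; [repeat apply Rmult_le_pos; try assumption; lra|].
  apply Rmult_le_compat; try apply nrm_ge0; exact h4.
- apply Rle_trans with (1 := nrm_mul _ _).
  rewrite Rmult_assoc; apply Rmult_le_compat_l; assumption.
Qed.

Lemma qd_filterdiff (A B : Y -> X) (T' : Y -> Y) (F : Y) (L K : Y -> X) (delta : R) :
  qd A F L -> qd B F K -> 0 < delta ->
  (forall h, nrmY h <= delta -> T' (plus F h) = Pair (A (plus F h)) (B (plus F h))) ->
  filterdiff T' (locally F) (fun h => Pair (L h) (K h)).
Proof.
intros [[a1 s1 [M [M0 b1]]] [b [d1 [Hd [Hb H]]]]] [[a2 s2 [N [N0 b2]]] [c [d2 [Hd' [Hc H']]]]] Hdl HT.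
split.
- split.
  + intros h k; apply pair_eq; [apply a1 | apply a2].
  + intros r h; apply pair_eq; simpl; rewrite scal_cst; [apply s1 | apply s2].
  + exists (M + N + 1); split; [lra|]; intros h.
    assert (P := nrmY_ge0 h); assert (Q1 := b1 h); assert (Q2 := b2 h).
    change (nrm (L h) + nrm (K h) <= (M + N + 1) * nrmY h); lra.
- intros x Hx.
  assert (E : F = x) by exact (is_filter_lim_locally_unique _ _ Hx); subst x.
  intros eps.
  (* The last entry makes the quadratic remainder at most [eps] times the norm of [h]; the 1 in its
     denominator excludes a division by zero. *)
  set (e := Rmin (Rmin d1 d2) (Rmin delta (eps / (b + c + 1)))).
  assert (He : 0 < e).
  { unfold e; repeat apply Rmin_pos; try assumption.
    apply Rdiv_lt_0_compat; [apply cond_pos | lra]. }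
  exists (mkposreal e He); intros G HG.
  change (nrmY (minus G F) < e) in HG.
  set (h := minus G F) in *.
  assert (EG : G = plus F h).
  { apply pair_eq.
    - transitivity (pf F + (pf G - pf F))%X; [ring | reflexivity].
    - transitivity (pg F + (pg G - pg F))%X; [ring | reflexivity]. }
  assert (U1 : e <= d1) by (unfold e; eapply Rle_trans; [apply Rmin_l | apply Rmin_l]).
  assert (U2 : e <= d2) by (unfold e; eapply Rle_trans; [apply Rmin_l | apply Rmin_r]).
  assert (U3 : e <= delta) by (unfold e; eapply Rle_trans; [apply Rmin_r | apply Rmin_l]).
  assert (U4 : e <= eps / (b + c + 1)) by (unfold e; eapply Rle_trans; [apply Rmin_r | apply Rmin_r]).
  assert (ET := HT h ltac:(lra)); rewrite <- EG in ET; rewrite ET.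
  assert (EF : T' F = Pair (A F) (B F)).
  { assert (Z0 : nrmY zero = 0) by (exact (norm_zero (V := @pair_NormedModule R_AbsRing))).
    assert (Q := HT zero ltac:(lra)); rewrite (plus_zero_r F : plus F zero = F) in Q; exact Q. }
  rewrite EF.
  assert (h1 := H h ltac:(lra)); assert (h2 := H' h ltac:(lra)); rewrite <- EG in h1, h2.
  change (nrm (A G - A F - L h)%X + nrm (B G - B F - K h)%X <= eps * nrmY h).
  assert (P := nrmY_ge0 h).
  assert (V : (b + c + 1) * nrmY h <= eps).
  { replace (pos eps) with ((b + c + 1) * (eps / (b + c + 1))) by (field; lra).
    apply Rmult_le_compat_l; lra. }
  assert (W : (b + c) * (nrmY h * nrmY h) <= eps * nrmY h); [|lra].
  rewrite <- Rmult_assoc; apply Rmult_le_compat_r; [exact P | lra].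
Qed.

(** * The operator [T] in the Banach algebra *)

(** The constants $1/s=10/22$, $1/\tau$ and $\tau$; [x2] doubles as the plain number 2. *)
Definition cis : X := cst (5 / 11).
Definition x2 : X := cst 2.
Definition xhalf : X := cst (/ 2).

Section Operator.

Local Open Scope X_scope.

Variable F : Y.

Definition tc : X := cst (pf F 0%nat).
Definition tal : X := (tc * tc - x1) * cis.
Definition tlam : X := - xcomp (pf F) tal.
(** The inverse is taken of the number $\lambda$, since the algebra has no division; [til_tlam]
    links it to [tlam]. *)
Definition til : X := cst (/ lambda (pf F)).
Definition tws : X := xw + cis.
Definition tp : X := tlam * tlam * tws - cis.
Definition tfp : X := xcomp (pf F) tp.
Definition tu : X := tfp * tfp.
Definition tut : X := x2 * tu.
Definition tgu : X := xcomp (pg F) tut.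
Definition tT1 : X := til * (tu * tgu - x1).
Definition tm : X := tlam * tlam * xw.
Definition tgm : X := xcomp (pg F) tm.
Definition tv : X := xhalf * tm * tgm.
Definition tq : X := cis * (tv * (tv - x2)).
Definition tfq : X := xcomp (pf F) tq.
Definition th : X := cis * (tfq * tfq - x1).
Definition tfh : X := xcomp (pf F) th.
(** Since $\lambda^{-1}f(\dots)$ equals $-1$ at $w=0$, dropping its constant coefficient is the same
    as adding 1, and the backward shift then divides by $w$. *)
Definition tT2 : X := xtail (x2 * til * tfh).

(** Evaluation is bounded by the norm, so these conditions imply [T_dom]. Being strict and in norm,
    they also make the compositions differentiable. *)
Definition good : Prop :=
  lambda (pf F) <> 0%R /\ (nrm tal < 1)%R /\ (nrm tp < 1)%R /\ (nrm tut < 1)%R /\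
  (nrm tm < 1)%R /\ (nrm tq < 1)%R /\ (nrm th < 1)%R.

Variable h : Y.

(** The chain rule, one line per intermediate quantity; [d_il] and [d_l2] belong to $1/\lambda$ and
    $\lambda^2$. *)
Definition d_al : X := cis * (x2 * tc * cst (pf h 0%nat)).
Definition d_lam : X := - (xcomp (pf h) tal + xdcomp (pf F) tal * d_al).
Definition d_il : X := - (til * til) * d_lam.
Definition d_l2 : X := x2 * tlam * d_lam.
Definition d_p : X := d_l2 * tws.
Definition d_fp : X := xcomp (pf h) tp + xdcomp (pf F) tp * d_p.
Definition d_u : X := x2 * tfp * d_fp.
Definition d_ut : X := x2 * d_u.
Definition d_gu : X := xcomp (pg h) tut + xdcomp (pg F) tut * d_ut.
Definition d_T1 : X := (tu * tgu - x1) * d_il + til * (tgu * d_u + tu * d_gu).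
Definition d_m : X := d_l2 * xw.
Definition d_gm : X := xcomp (pg h) tm + xdcomp (pg F) tm * d_m.
Definition d_v : X := xhalf * (tgm * d_m + tm * d_gm).
Definition d_q : X := cis * ((tv - x2) * d_v + tv * d_v).
Definition d_fq : X := xcomp (pf h) tq + xdcomp (pf F) tq * d_q.
Definition d_h : X := cis * (x2 * tfq * d_fq).
Definition d_fh : X := xcomp (pf h) th + xdcomp (pf F) th * d_h.
Definition d_T2 : X := xtail (x2 * (tfh * d_il + til * d_fh)).

End Operator.

Lemma cst_sub (r t : R) : cst (r - t) = (cst r - cst t)%X.
Proof. unfold Rminus; rewrite cst_add, cst_opp; ring. Qed.

Lemma xcomp_cst (f : X) (r : R) : Rabs r <= 1 -> xcomp f (cst r) = cst (PSeries f r).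
Proof.
intros Hr; apply evalC_inj; intros w Hw; apply Rlt_le in Hw.
rewrite evalC_xcomp by (try exact Hw; rewrite nrm_cst; exact Hr).
rewrite !evalC_cst by exact Hw; apply evalC_PSeries.
Qed.

Lemma tal_cst (F : Y) : tal F = cst (lambda_arg (pf F)).
Proof.
unfold tal, tc, x1, cis, lambda_arg, s; rewrite PSeries_0, <- cst_mul, <- cst_sub, <- cst_mul.
f_equal; simpl; field.
Qed.

Lemma tlam_cst (F : Y) : nrm (tal F) <= 1 -> tlam F = cst (lambda (pf F)).
Proof.
unfold tlam, lambda; rewrite tal_cst, nrm_cst; intros H.
now rewrite xcomp_cst, cst_opp by exact H.
Qed.

Lemma til_tlam (F : Y) : good F -> (tlam F * til F)%X = x1.
Proof.
intros [H0 [H1 _]]; rewrite tlam_cst by lra; unfold til, x1; rewrite <- cst_mul.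
f_equal; field; exact H0.
Qed.

Lemma coef0_evalC (a : X) : RtoC (a 0%nat) = evalC a (RtoC 0).
Proof. rewrite evalC_PSeries, PSeries_0; reflexivity. Qed.

Lemma evalC_xtail (a : X) (w : C) : Cmod w <= 1 ->
  (w * evalC (xtail a) w = evalC a w - RtoC (a 0%nat))%C.
Proof.
intros Hw; rewrite (xdecomp a) at 2.
rewrite evalC_xadd, evalC_xmul, evalC_cst, evalC_xw by exact Hw; ring.
Qed.

Lemma xshift_inj (a b : X) : (xw * a)%X = (xw * b)%X -> a = b.
Proof. rewrite <- !xshift_mul; intros H; rewrite <- (xtail_xshift a), H; apply xtail_xshift. Qed.

Section Evaluation.

Variable F : Y.
Hypothesis G : good F.
Variable w : C.
Hypothesis Hw : Cmod w <= 1.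

Let lamE : evalC (tlam F) w = RtoC (lambda (pf F)).
Proof. destruct G as [_ [H _]]; rewrite tlam_cst, evalC_cst by (lra || exact Hw); reflexivity. Qed.

Lemma evalC_tp : evalC (tp F) w = u_arg F w.
Proof.
unfold tp, tws, cis, u_arg.
rewrite ?evalC_xsub, ?evalC_xmul, ?evalC_xadd, ?evalC_xw, ?evalC_cst, ?lamE by exact Hw.
unfold s; replace (RtoC (5 / 11)) with (/ RtoC (22 / 10))%C; [ring|].
rewrite <- RtoC_inv by lra; apply (f_equal RtoC); field.
Qed.

Lemma evalC_tu : evalC (tu F) w = u F w.
Proof.
destruct G as [_ [_ [H _]]].
unfold tu, tfp, u; rewrite evalC_xmul, evalC_xcomp, evalC_tp by (lra || exact Hw); ring.
Qed.

Lemma evalC_tut : evalC (tut F) w = (u F w / RtoC tau)%C.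
Proof.
unfold tut, x2; rewrite evalC_xmul, evalC_tu, evalC_cst by exact Hw.
unfold Cdiv, tau; rewrite <- RtoC_inv by lra; replace (/ (5 / 10)) with 2 by field; ring.
Qed.

Lemma evalC_tT1 : evalC (tT1 F) w = fhat F w.
Proof.
destruct G as [_ [_ [_ [H _]]]].
unfold tT1, tgu, til, fhat.
rewrite evalC_xmul, evalC_xsub, evalC_xmul, evalC_cst, evalC_x1, evalC_xcomp, evalC_tut, evalC_tu
  by (lra || exact Hw).
rewrite RtoC_inv by apply (proj1 G); ring.
Qed.

Lemma evalC_tm : evalC (tm F) w = (RtoC (lambda (pf F)) ^ 2 * w)%C.
Proof. unfold tm; rewrite !evalC_xmul, lamE, evalC_xw by exact Hw; ring. Qed.

Lemma evalC_tv : evalC (tv F) w = v F w.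
Proof.
destruct G as [_ [_ [_ [_ [H _]]]]].
unfold tv, tgm, xhalf, v.
rewrite !evalC_xmul, evalC_xcomp, evalC_cst, evalC_tm by (lra || exact Hw).
unfold tau; replace (5 / 10) with (/ 2) by field; ring.
Qed.

Lemma evalC_tq : evalC (tq F) w = v_arg F w.
Proof.
unfold tq, cis, x2, v_arg; rewrite !evalC_xmul, evalC_xsub, evalC_tv, !evalC_cst by exact Hw.
unfold Cdiv, s; rewrite <- RtoC_inv by lra; replace (/ (22 / 10)) with (5 / 11) by field; ring.
Qed.

Lemma evalC_th : evalC (th F) w = vf_arg F w.
Proof.
destruct G as [_ [_ [_ [_ [_ [H _]]]]]].
unfold th, tfq, cis, vf_arg.
rewrite evalC_xmul, evalC_xsub, evalC_xmul, evalC_xcomp, evalC_tq, evalC_cst, evalC_x1 by (lra || exact Hw).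
unfold s; rewrite <- RtoC_inv by lra; replace (/ (22 / 10)) with (5 / 11) by field; ring.
Qed.

Lemma evalC_tfh : evalC (tfh F) w = evalC (pf F) (vf_arg F w).
Proof.
destruct G as [_ [_ [_ [_ [_ [_ H]]]]]].
unfold tfh; rewrite evalC_xcomp, evalC_th by (lra || exact Hw); reflexivity.
Qed.

End Evaluation.

Lemma Cmod0_le1 : Cmod (RtoC 0) <= 1.
Proof. rewrite Cmod_R, Rabs_R0; lra. Qed.

(** At $w=0$ the function $v$ vanishes, hence so does $v(v-2)/s$, and the outer argument becomes
    $(f(0)^2-1)/s$, where $f$ takes the value $-\lambda$. This is the removability of the
    singularity. *)
Lemma tfh_coef0 (F : Y) : good F -> tfh F 0%nat = - lambda (pf F).
Proof.
intros G; apply RtoC_inj.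
rewrite coef0_evalC, (evalC_tfh F G _ Cmod0_le1).
unfold vf_arg, v_arg, v.
replace (_ * (_ - 2) / RtoC s)%C with (RtoC 0) by (unfold Cdiv; ring).
rewrite <- coef0_evalC, <- RtoC_inv by (unfold s; lra).
replace (_ - _)%C with (RtoC (lambda_arg (pf F))).
- rewrite evalC_PSeries; unfold lambda; f_equal; ring.
- unfold lambda_arg; rewrite PSeries_0; unfold Rdiv.
  rewrite RtoC_mult, RtoC_minus, RtoC_pow; ring.
Qed.

Lemma is_T_good (F : Y) : good F -> is_T F (Pair (tT1 F) (tT2 F)).
Proof.
intros G w Hw; apply Rlt_le in Hw; split; [apply evalC_tT1; assumption|].
intros W0; assert (L0 : RtoC (lambda (pf F)) <> RtoC 0).
{ intros E; apply (proj1 G), RtoC_inj, E. }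
assert (E := evalC_xtail (x2 * til F * tfh F)%X w Hw).
(* The value is $-1/\tau$, which accounts for the summand 1 in [ghat]. *)
assert (C0 : (x2 * til F * tfh F)%X 0%nat = - (2)).
{ unfold x2, til; rewrite <- cst_mul, <- scal_cst.
  change (2 * / lambda (pf F) * tfh F 0%nat = - (2)); rewrite tfh_coef0 by exact G.
  field; apply (proj1 G). }
rewrite C0, !evalC_xmul, (evalC_tfh F G w Hw) in E by exact Hw.
unfold x2, til in E; rewrite !evalC_cst, RtoC_opp in E by exact Hw; rewrite RtoC_inv in E by apply (proj1 G).
change (evalC (pg (Pair (tT1 F) (tT2 F))) w) with (evalC (tT2 F) w).
unfold ghat; rewrite <- (Cmult_1_l (evalC (tT2 F) w)).
replace (RtoC 1) with (/ w * w)%C at 1 by (field; exact W0).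
unfold tT2, x2, til; rewrite <- Cmult_assoc, E; unfold tau.
replace (RtoC (5 / 10)) with (/ RtoC 2)%C by (rewrite <- RtoC_inv by lra; apply (f_equal RtoC); field).
field; repeat split; try assumption.
Qed.

(** The second components are compared after multiplication by [w]: the origin, where [ghat]
    prescribes nothing, then causes no exception. *)
Lemma is_T_unique (F G G' : Y) : is_T F G -> is_T F G' -> G = G'.
Proof.
intros H H'; apply pair_eq.
- apply evalC_inj; intros w Hw; rewrite (proj1 (H w Hw)), (proj1 (H' w Hw)); reflexivity.
- apply xshift_inj, evalC_inj; intros w Hw.
  rewrite !evalC_xmul, !evalC_xw by lra.
  destruct (Ceq_dec w (RtoC 0)) as [E|NE]; [rewrite E; ring|].
  rewrite (proj2 (H w Hw) NE), (proj2 (H' w Hw) NE); reflexivity.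
Qed.

Lemma T_good (F : Y) : good F -> T F = Pair (tT1 F) (tT2 F).
Proof.
intros G; apply (is_T_unique F); [|apply is_T_good, G].
apply (epsilon_spec (inhabits (zero : Y)) (is_T F)); eexists; apply is_T_good, G.
Qed.

Lemma T_defined_good (F : Y) : good F -> T_defined F.
Proof.
intros G; split; [|eexists; apply is_T_good, G].
assert (G' := G); destruct G' as [H0 [H1 [H2 [H3 [H4 [H5 H6]]]]]].
split; [exact H0|]; split; [rewrite tal_cst, nrm_cst in H1; exact H1|].
intros w Hw; repeat split.
- rewrite <- (evalC_tp F G w Hw); apply Rle_lt_trans with (2 := H2), evalC_bound, Hw.
- rewrite <- (evalC_tut F G w Hw); apply Rle_lt_trans with (2 := H3), evalC_bound, Hw.
- rewrite <- (evalC_tm F G w Hw); apply Rle_lt_trans with (2 := H4), evalC_bound, Hw.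
- rewrite <- (evalC_tq F G w Hw); apply Rle_lt_trans with (2 := H5), evalC_bound, Hw.
- rewrite <- (evalC_th F G w Hw); apply Rle_lt_trans with (2 := H6), evalC_bound, Hw.
Qed.

(** * The derivative of [T] *)

Section Derivative.

Variable F : Y.
Variables N delta : R.
Hypothesis Hdelta : 0 < delta.
Hypothesis Hgood : forall h, nrmY h <= delta -> good (plus F h) /\ nrm (til (plus F h)) <= N.

Lemma good_center : good F.
Proof.
assert (Z0 : nrmY zero = 0) by (exact (norm_zero (V := @pair_NormedModule R_AbsRing))).
rewrite <- (plus_zero_r F : plus F zero = F); apply Hgood; lra.
Qed.

Let G := good_center.

Lemma lin_coef0 : lin (fun h => cst (pf h 0%nat)).
Proof.
split.
- intros h k; change (pf (plus h k) 0%nat) with (pf h 0%nat + pf k 0%nat); apply cst_add.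
- intros c h; change (pf (scal c h) 0%nat) with (c * pf h 0%nat); apply cst_mul.
- exists 1; split; [lra|]; intros h; rewrite nrm_cst, Rmult_1_l.
  apply Rle_trans with (2 := nrm_pf h); exact (l1_abs_coef_le (pf h) 0).
Qed.

Lemma qd_opp (A : Y -> X) (L : Y -> X) : qd A F L -> qd (fun H => - A H)%X F (fun h => - L h)%X.
Proof.
intros H; eapply qd_ext; [| |exact (qd_mul (fun _ => (- x1)%X) A F _ _ (qd_const _ F) H)];
intros; simpl; ring.
Qed.

Lemma qd_sub (A B : Y -> X) (L K : Y -> X) :
  qd A F L -> qd B F K -> qd (fun H => A H - B H)%X F (fun h => L h - K h)%X.
Proof.
intros H H'; eapply qd_ext; [| |exact (qd_add A _ F _ _ H (qd_opp _ _ H'))];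
intros; simpl; ring.
Qed.

Lemma x2_double : x2 = (x1 + x1)%X.
Proof. unfold x2, x1; rewrite <- cst_add; f_equal; ring. Qed.

Lemma qd_tc : qd tc F (fun h => cst (pf h 0%nat)).
Proof. apply (qd_lin tc), lin_coef0. Qed.

Lemma qd_tal : qd tal F (d_al F).
Proof.
eapply qd_ext; [| |exact (qd_mul _ _ F _ _ (qd_sub _ _ _ _ (qd_mul _ _ F _ _ qd_tc qd_tc) (qd_const x1 F)) (qd_const cis F))].
- reflexivity.
- intros h; unfold d_al; rewrite x2_double; simpl; ring.
Qed.

Lemma qd_tlam : qd tlam F (d_lam F).
Proof.
apply (qd_opp (fun H => xcomp (pf H) (tal H)) (fun h => xcomp (pf h) (tal F) + xdcomp (pf F) (tal F) * d_al F h)%X).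
apply (qd_comp pf tal F pf (d_al F)); [apply qd_lin, lin_pf | exact qd_tal | destruct G as [_ [H _]]; exact H].
Qed.

Lemma qd_til : qd til F (d_il F).
Proof.
apply (qd_inv tlam til F _ N delta); [apply qd_tlam | exact Hdelta|].
intros h Hh; destruct (Hgood h Hh) as [g b]; split; [apply til_tlam, g | exact b].
Qed.

Lemma qd_tl2 : qd (fun H => tlam H * tlam H)%X F (d_l2 F).
Proof.
eapply qd_ext; [| |exact (qd_mul _ _ F _ _ qd_tlam qd_tlam)]; [reflexivity|].
intros h; unfold d_l2; rewrite x2_double; ring.
Qed.

Lemma qd_tp : qd tp F (d_p F).
Proof.
eapply qd_ext; [| |exact (qd_sub _ _ _ _ (qd_mul _ _ F _ _ qd_tl2 (qd_const tws F)) (qd_const cis F))];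
[reflexivity|].
intros h; unfold d_p; simpl; ring.
Qed.

Lemma qd_tfp : qd tfp F (d_fp F).
Proof. apply (qd_comp pf tp F pf (d_p F)); [apply qd_lin, lin_pf | exact qd_tp | destruct G as [_ [_ [H _]]]; exact H]. Qed.

Lemma qd_tu : qd tu F (d_u F).
Proof.
eapply qd_ext; [| |exact (qd_mul _ _ F _ _ qd_tfp qd_tfp)]; [reflexivity|].
intros h; unfold d_u; rewrite x2_double; ring.
Qed.

Lemma qd_tut : qd tut F (d_ut F).
Proof.
eapply qd_ext; [| |exact (qd_mul _ _ F _ _ (qd_const x2 F) qd_tu)]; [reflexivity|].
intros h; unfold d_ut; simpl; ring.
Qed.

Lemma qd_tgu : qd tgu F (d_gu F).
Proof. apply (qd_comp pg tut F pg (d_ut F)); [apply qd_lin, lin_pg | exact qd_tut | destruct G as [_ [_ [_ [H _]]]]; exact H]. Qed.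

Lemma qd_tT1 : qd tT1 F (d_T1 F).
Proof.
eapply qd_ext; [| |exact (qd_mul _ _ F _ _ qd_til
  (qd_sub _ _ _ _ (qd_mul _ _ F _ _ qd_tu qd_tgu) (qd_const x1 F)))]; [reflexivity|].
intros h; unfold d_T1; simpl; ring.
Qed.

Lemma qd_tm : qd tm F (d_m F).
Proof.
eapply qd_ext; [| |exact (qd_mul _ _ F _ _ qd_tl2 (qd_const xw F))]; [reflexivity|].
intros h; unfold d_m; simpl; ring.
Qed.

Lemma qd_tgm : qd tgm F (d_gm F).
Proof. apply (qd_comp pg tm F pg (d_m F)); [apply qd_lin, lin_pg | exact qd_tm | destruct G as [_ [_ [_ [_ [H _]]]]]; exact H]. Qed.

Lemma qd_tv : qd tv F (d_v F).
Proof.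
eapply qd_ext; [| |exact (qd_mul _ _ F _ _ (qd_mul _ _ F _ _ (qd_const xhalf F) qd_tm) qd_tgm)];
[reflexivity|].
intros h; unfold d_v; simpl; ring.
Qed.

Lemma qd_tq : qd tq F (d_q F).
Proof.
eapply qd_ext; [| |exact (qd_mul _ _ F _ _ (qd_const cis F)
  (qd_mul _ _ F _ _ qd_tv (qd_sub _ _ _ _ qd_tv (qd_const x2 F))))]; [reflexivity|].
intros h; unfold d_q; simpl; ring.
Qed.

Lemma qd_tfq : qd tfq F (d_fq F).
Proof. apply (qd_comp pf tq F pf (d_q F)); [apply qd_lin, lin_pf | exact qd_tq | destruct G as [_ [_ [_ [_ [_ [H _]]]]]]; exact H]. Qed.

Lemma qd_th : qd th F (d_h F).
Proof.
eapply qd_ext; [| |exact (qd_mul _ _ F _ _ (qd_const cis F)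
  (qd_sub _ _ _ _ (qd_mul _ _ F _ _ qd_tfq qd_tfq) (qd_const x1 F)))]; [reflexivity|].
intros h; unfold d_h; rewrite x2_double; simpl; ring.
Qed.

Lemma qd_tfh : qd tfh F (d_fh F).
Proof. apply (qd_comp pf th F pf (d_h F)); [apply qd_lin, lin_pf | exact qd_th | destruct G as [_ [_ [_ [_ [_ [_ H]]]]]]; exact H]. Qed.

Lemma qd_tT2 : qd tT2 F (d_T2 F).
Proof.
apply (qd_tail (fun H => x2 * til H * tfh H)%X).
eapply qd_ext; [| |exact (qd_mul _ _ F _ _ (qd_const x2 F) (qd_mul _ _ F _ _ qd_til qd_tfh))].
- intros H; simpl; ring.
- intros h; simpl; ring.
Qed.

Definition DT (h : Y) : Y := Pair (d_T1 F h) (d_T2 F h).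

Lemma filterdiff_T : filterdiff T (locally F) DT.
Proof.
apply (qd_filterdiff tT1 tT2 T F _ _ delta qd_tT1 qd_tT2 Hdelta).
intros h Hh; apply T_good, Hgood, Hh.
Qed.

End Derivative.

(** * Factorized form of the derivative *)

Section Factors.

Local Open Scope X_scope.

Variable F : Y.

(** The chain rule read backwards. The derivative is a combination of compositions of the direction
    [h] with the six arguments, one of them inside [d_lam], and the coefficients depend on [F]
    alone; they are enclosed once and reused for all columns. *)
Definition dA1 : X := x2 * til F * (tgu F + tut F * xdcomp (pg F) (tut F)) * tfp F.
Definition dA2 : X := til F * tu F.
(** Collects all that varies with $\lambda$: the scaling inside [tp], and the prefactor $1/\lambda$,
    whose derivative contributes the subtracted term. [dV2] does the same for the second
    component. *)
Definition dV1 : X := x2 * (dA1 * xdcomp (pf F) (tp F)) * (tlam F * tws) - til F * tT1 F.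
Definition dB1 : X := x2 * til F.
Definition dB2 : X := x2 * (dB1 * xdcomp (pf F) (th F)) * (tfq F * cis).
Definition dBq : X := x2 * (dB2 * xdcomp (pf F) (tq F)) * ((tv F - x1) * cis).
Definition dB3 : X := dBq * (xhalf * tm F).
Definition dV2 : X := dBq * (tgm F + tm F * xdcomp (pg F) (tm F)) * (tlam F * xw)
  - til F * dB1 * tfh F.

Lemma x2_half : x2 * xhalf = x1.
Proof. unfold x2, xhalf, x1; rewrite <- cst_mul; f_equal; field. Qed.

Lemma d_T1_factor (h : Y) : d_T1 F h =
  dA1 * xcomp (pf h) (tp F) + dA2 * xcomp (pg h) (tut F) + dV1 * d_lam F h.
Proof.
unfold d_T1, dA1, dA2, dV1, dA1, d_gu, d_ut, d_u, d_fp, d_p, d_l2, d_il, tT1.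
set (d1 := xdcomp (pf F) (tp F)); set (d2 := xdcomp (pg F) (tut F)).
set (c1 := xcomp (pf h) (tp F)); set (c2 := xcomp (pg h) (tut F)).
unfold tut; ring.
Qed.

(** The derivative $2(v-1)\,dv$ of $v(v-2)$ loses its factor 2 against the $\tau=1/2$ in $v$. *)
Lemma d_q_factor (h : Y) : d_q F h =
  cis * (tv F - x1) * (tgm F * d_m F h + tm F * d_gm F h).
Proof.
unfold d_q, d_v; set (K := tgm F * d_m F h + tm F * d_gm F h).
transitivity (cis * (tv F - x1) * (x2 * xhalf * K)); [|rewrite x2_half; ring].
rewrite x2_double; ring.
Qed.

Lemma d_T2_factor (h : Y) : d_T2 F h =
  xtail (dB1 * xcomp (pf h) (th F) + dB2 * xcomp (pf h) (tq F)
    + dB3 * xcomp (pg h) (tm F) + dV2 * d_lam F h).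
Proof.
unfold d_T2; f_equal.
(* [ring] regards [x2] and [xhalf] as unrelated, so the product of these two constants is removed by
   hand. *)
assert (E : dB3 = dB2 * xdcomp (pf F) (tq F) * (tv F - x1) * cis * tm F).
{ transitivity (dB2 * xdcomp (pf F) (tq F) * (tv F - x1) * cis * tm F * (x2 * xhalf)).
  - unfold dB3, dBq; ring.
  - rewrite x2_half; ring. }
rewrite E; unfold dV2, dBq, d_fh, d_h, d_fq; rewrite d_q_factor.
unfold dB2, dB1, d_gm, d_m, d_l2, d_il.
set (d1 := xdcomp (pf F) (th F)); set (d2 := xdcomp (pf F) (tq F)); set (d3 := xdcomp (pg F) (tm F)).
set (c1 := xcomp (pf h) (th F)); set (c2 := xcomp (pf h) (tq F)); set (c3 := xcomp (pg h) (tm F)).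
ring.
Qed.

End Factors.

(** * Integer ball arithmetic *)

Definition prec : Z := 52%Z.
Definition unit_z : Z := 4503599627370496%Z.

Definition zball : Type := (list Z * Z)%type.

Fixpoint pz (l : list Z) : X :=
  match l with [] => x0 | c :: t => (cst (IZR c) + xw * pz t)%X end.

(** The ball [(l, e)] has centre [pz l / 2^52] and radius [e / 2^52]. *)
Definition inb (b : zball) (x : X) : Prop :=
  nrm (cst (IZR unit_z) * x - pz (fst b))%X <= IZR (snd b).

Fixpoint nz (l : list Z) : Z :=
  match l with [] => 0%Z | c :: t => (Z.abs c + nz t)%Z end.

Definition nb (b : zball) : Z := (nz (fst b) + snd b)%Z.

Fixpoint padd (a b : list Z) : list Z :=
  match a, b with
  | x :: a', y :: b' => (x + y)%Z :: padd a' b'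
  | [], _ => b
  | _, [] => a
  end.

Definition psc (c : Z) (l : list Z) : list Z := map (Z.mul c) l.

Fixpoint pmul (a b : list Z) : list Z :=
  match a with [] => [] | x :: a' => padd (psc x b) (0%Z :: pmul a' b) end.

Definition rnd (c : Z) : Z := Z.shiftr c prec.

(** Drops the top coefficients of size at most [thr] and returns their total for the radius. Without
    it the degrees would grow with every product. *)
Fixpoint trim (thr : Z) (l : list Z) : list Z * Z :=
  match l with
  | [] => ([], 0%Z)
  | c :: t =>
      let (t', e) := trim thr t in
      match t' with
      | [] => if (Z.abs c <=? thr)%Z then ([], (Z.abs c + e)%Z) else ([c], e)
      | _ => (c :: t', e)
      end
  end.

(** A product of two integer polynomials is in units of $2^{-104}$ and is brought back to $2^{-52}$.
    The radius pays one unit per coefficient, one for its own rounding, and the trimmed mass. *)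
Definition bround (thr : Z) (l : list Z) (e : Z) : zball :=
  let (t, d) := trim thr (map rnd l) in
  (t, (rnd e + 1 + Z.of_nat (length l) + d)%Z).

Definition badd (a b : zball) : zball := (padd (fst a) (fst b), (snd a + snd b)%Z).
Definition bneg (a : zball) : zball := (map Z.opp (fst a), snd a).
Definition bsub (a b : zball) : zball := badd a (bneg b).
Definition bmul (thr : Z) (a b : zball) : zball :=
  bround thr (pmul (fst a) (fst b))
    (nz (fst a) * snd b + nz (fst b) * snd a + snd a * snd b)%Z.
Definition btail (a : zball) : zball := (tl (fst a), snd a).
Definition bunit : zball := ([unit_z], 0%Z).
Definition bw : zball := ([0%Z; unit_z], 0%Z).

Fixpoint bpows (thr : Z) (a : zball) (p : zball) (n : nat) : list zball :=
  match n with O => [p] | S k => p :: bpows thr a (bmul thr a p) k end.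

(** Coefficients without a listed power only enlarge the radius: the powers have norm at most 1. *)
Fixpoint lcz (c : list Z) (r : list zball) : zball :=
  match c, r with
  | [], _ => ([], 0%Z)
  | x :: c', y :: r' => badd (psc x (fst y), (Z.abs x * snd y)%Z) (lcz c' r')
  | _, [] => ([], (unit_z * nz c)%Z)
  end.

Definition bcomp (thr : Z) (f : zball) (r : list zball) : zball :=
  let s := lcz (fst f) r in bround thr (fst s) (snd s + unit_z * snd f)%Z.

Fixpoint pder (k : Z) (c : list Z) : list Z :=
  match c with [] => [] | x :: t => (k * x)%Z :: pder (k + 1) t end.

(** The radius of [f] is amplified by $1/(1-\|a\|)$, the bound of [dpow_bounded]; adding 1 rounds
    the quotient up. *)
Definition bdcomp (thr : Z) (f a : zball) (r : list zball) : zball :=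
  bcomp thr (pder 1 (tl (fst f)), (unit_z * snd f / (unit_z - nb a) + 1)%Z) r.

(** Meant for the constant function $\lambda$, so that a number suffices as approximate inverse. If
    its defect has norm $\delta<1$, the true inverse lies within $|y|\delta/(1-\delta)$. *)
Definition binv (thr : Z) (a : zball) : zball :=
  let y := (unit_z * unit_z / hd 0%Z (fst a))%Z in
  let d := nb (bsub (bmul thr a ([y], 0%Z)) bunit) in
  ([y], (Z.abs y * d / (unit_z - d) + 1)%Z).

Lemma rnd_bound (c : Z) : (unit_z * rnd c <= c < unit_z * rnd c + unit_z)%Z.
Proof.
unfold rnd; rewrite Z.shiftr_div_pow2 by (unfold prec; lia).
change (2 ^ prec)%Z with unit_z.
assert (H := Z.div_mod c unit_z ltac:(discriminate)).
assert (H' := Z.mod_pos_bound c unit_z ltac:(reflexivity)); lia.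
Qed.

Lemma unit_val : unit_z = 4503599627370496%Z.
Proof. reflexivity. Qed.

Lemma unit_pos : 0 < IZR unit_z.
Proof. apply IZR_lt; reflexivity. Qed.

Opaque unit_z prec l1_norm.

Lemma cst_IZR_add (m n : Z) : cst (IZR (m + n)) = (cst (IZR m) + cst (IZR n))%X.
Proof. rewrite plus_IZR; apply cst_add. Qed.

Lemma cst_IZR_mul (m n : Z) : cst (IZR (m * n)) = (cst (IZR m) * cst (IZR n))%X.
Proof. rewrite mult_IZR; apply cst_mul. Qed.

Lemma pz_add (a b : list Z) : pz (padd a b) = (pz a + pz b)%X.
Proof.
revert b; induction a as [|x a IH]; intros [|y b]; simpl; try ring.
rewrite IH, cst_IZR_add; ring.
Qed.

Lemma pz_sc (c : Z) (l : list Z) : pz (psc c l) = (cst (IZR c) * pz l)%X.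
Proof.
induction l as [|x l IH]; simpl; [ring|].
rewrite IH, cst_IZR_mul; ring.
Qed.

Lemma pz_opp (l : list Z) : pz (map Z.opp l) = (- pz l)%X.
Proof.
induction l as [|x l IH]; simpl; [ring|].
rewrite IH, opp_IZR, cst_opp; ring.
Qed.

Lemma pz_mul (a b : list Z) : pz (pmul a b) = (pz a * pz b)%X.
Proof.
induction a as [|x a IH]; simpl; [ring|].
rewrite pz_add, pz_sc; simpl; rewrite IH, cst_0; ring.
Qed.

Lemma nrm_pz (l : list Z) : nrm (pz l) <= IZR (nz l).
Proof.
induction l as [|x l IH]; simpl; [rewrite nrm_x0; apply Rle_refl|].
rewrite plus_IZR, abs_IZR, <- nrm_cst; apply Rle_trans with (1 := nrm_add _ _).
apply Rplus_le_compat_l; rewrite nrm_w_mul; exact IH.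
Qed.

Lemma rnd_up (c : Z) : IZR c <= IZR unit_z * IZR (rnd c + 1).
Proof. rewrite <- mult_IZR; apply IZR_le; assert (H := rnd_bound c); lia. Qed.

Lemma pz_round (l : list Z) :
  nrm (pz l - cst (IZR unit_z) * pz (map rnd l))%X <= IZR unit_z * IZR (Z.of_nat (length l)).
Proof.
induction l as [|x l IH].
- simpl; replace (x0 - cst (IZR unit_z) * x0)%X with x0 by ring.
  rewrite nrm_x0, Rmult_0_r; apply Rle_refl.
- change (length (x :: l)) with (S (length l)); rewrite Nat2Z.inj_succ, <- Z.add_1_l, plus_IZR.
  simpl pz; replace (_ - _)%X with
    ((cst (IZR x) - cst (IZR unit_z) * cst (IZR (rnd x)))
     + xw * (pz l - cst (IZR unit_z) * pz (map rnd l)))%X by ring.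
  apply Rle_trans with (1 := nrm_add _ _); rewrite Rmult_plus_distr_l.
  apply Rplus_le_compat; [|rewrite nrm_w_mul; exact IH].
  rewrite <- cst_mul, <- cst_sub, nrm_cst, <- mult_IZR, <- minus_IZR, <- abs_IZR, Rmult_1_r.
  apply IZR_le; assert (H := rnd_bound x); lia.
Qed.

Lemma trim_bound (thr : Z) (l : list Z) :
  nrm (pz l - pz (fst (trim thr l)))%X <= IZR (snd (trim thr l)).
Proof.
induction l as [|x l IH]; simpl.
- replace (x0 - x0)%X with x0 by ring; rewrite nrm_x0; apply Rle_refl.
- destruct (trim thr l) as [t e]; simpl in IH.
  assert (C : forall y, nrm (cst y + xw * pz l - (cst y + xw * pz t))%X <= IZR e).
  { intros y; replace (_ - _)%X with (xw * (pz l - pz t))%X by ring.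
    rewrite nrm_w_mul; exact IH. }
  destruct t as [|y t]; [destruct (Z.abs x <=? thr)%Z; [simpl | exact (C (IZR x))] | exact (C (IZR x))].
  rewrite plus_IZR, abs_IZR, <- nrm_cst.
  replace (cst (IZR x) + xw * pz l - x0)%X with (cst (IZR x) + xw * (pz l - pz []))%X by (simpl; ring).
  apply Rle_trans with (1 := nrm_add _ _), Rplus_le_compat_l; rewrite nrm_w_mul; exact IH.
Qed.

Lemma inb_round (thr : Z) (l : list Z) (e : Z) (x : X) :
  nrm (cst (IZR unit_z) * (cst (IZR unit_z) * x) - pz l)%X <= IZR e -> inb (bround thr l e) x.
Proof.
intros H; unfold bround, inb.
assert (T := trim_bound thr (map rnd l)); destruct (trim thr (map rnd l)) as [t d]; simpl in *.
assert (U := unit_pos).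
rewrite plus_IZR; replace (cst (IZR unit_z) * x - pz t)%X with
  ((cst (IZR unit_z) * x - pz (map rnd l)) + (pz (map rnd l) - pz t))%X by ring.
apply Rle_trans with (1 := nrm_add _ _), Rplus_le_compat; [|exact T].
apply Rmult_le_reg_l with (1 := U); rewrite <- (Rabs_pos_eq (IZR unit_z)) at 1 by lra.
rewrite <- nrm_cst_mul.
replace (cst (IZR unit_z) * (cst (IZR unit_z) * x - pz (map rnd l)))%X with
  ((cst (IZR unit_z) * (cst (IZR unit_z) * x) - pz l)
   + (pz l - cst (IZR unit_z) * pz (map rnd l)))%X by ring.
apply Rle_trans with (1 := nrm_add _ _).
rewrite plus_IZR, Rmult_plus_distr_l; apply Rplus_le_compat; [|apply pz_round].
apply Rle_trans with (1 := H), rnd_up.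
Qed.

Lemma inb_add (a b : zball) (x y : X) : inb a x -> inb b y -> inb (badd a b) (x + y)%X.
Proof.
unfold inb, badd; simpl; intros H H'; rewrite pz_add, plus_IZR.
replace (_ - _)%X with ((cst (IZR unit_z) * x - pz (fst a)) + (cst (IZR unit_z) * y - pz (fst b)))%X by ring.
apply Rle_trans with (1 := nrm_add _ _), Rplus_le_compat; assumption.
Qed.

Lemma inb_neg (a : zball) (x : X) : inb a x -> inb (bneg a) (- x)%X.
Proof.
unfold inb, bneg; simpl; intros H; rewrite pz_opp, <- nrm_opp.
replace (- _)%X with (cst (IZR unit_z) * x - pz (fst a))%X by ring; exact H.
Qed.

Lemma inb_sub (a b : zball) (x y : X) : inb a x -> inb b y -> inb (bsub a b) (x - y)%X.
Proof.
intros H H'; replace (x - y)%X with (x + - y)%X by ring.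
apply inb_add; [exact H | apply inb_neg, H'].
Qed.

Lemma inb_radius (a : zball) (x : X) : inb a x -> 0 <= IZR (snd a).
Proof. intros H; apply Rle_trans with (2 := H), nrm_ge0. Qed.

Lemma inb_norm (a : zball) (x : X) : inb a x -> IZR unit_z * nrm x <= IZR (nb a).
Proof.
intros H; assert (U := unit_pos); rewrite <- (Rabs_pos_eq (IZR unit_z)) at 1 by lra.
rewrite <- nrm_cst_mul; unfold nb; rewrite plus_IZR.
replace (cst (IZR unit_z) * x)%X with (pz (fst a) + (cst (IZR unit_z) * x - pz (fst a)))%X by ring.
apply Rle_trans with (1 := nrm_add _ _), Rplus_le_compat; [apply nrm_pz | exact H].
Qed.

Lemma inb_mul (thr : Z) (a b : zball) (x y : X) :
  inb a x -> inb b y -> inb (bmul thr a b) (x * y)%X.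
Proof.
intros H H'; assert (R1 := inb_radius _ _ H); assert (R2 := inb_radius _ _ H').
apply inb_round; rewrite pz_mul, !plus_IZR, !mult_IZR.
set (p := pz (fst a)); set (q := pz (fst b)).
set (dx := (cst (IZR unit_z) * x - p)%X); set (dy := (cst (IZR unit_z) * y - q)%X).
replace (_ - _)%X with (p * dy + q * dx + dx * dy)%X by (unfold dx, dy; ring).
apply Rle_trans with (1 := nrm_add _ _), Rplus_le_compat.
apply Rle_trans with (1 := nrm_add _ _), Rplus_le_compat.
all: apply Rle_trans with (1 := nrm_mul _ _), Rmult_le_compat;
  try apply nrm_ge0; first [apply nrm_pz | assumption].
Qed.

Lemma pz_tail (l : list Z) : pz (tl l) = xtail (pz l).
Proof.
destruct l as [|x l]; [apply l1_eq; reflexivity|]; simpl.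
rewrite <- xshift_mul, xtail_add, xtail_xshift.
replace (xtail (cst (IZR x))) with x0 by (apply l1_eq; reflexivity); ring.
Qed.

Lemma inb_tail (a : zball) (x : X) : inb a x -> inb (btail a) (xtail x).
Proof.
unfold inb, btail; simpl; intros H; apply Rle_trans with (2 := H).
rewrite pz_tail, <- xtail_mul_cst.
replace (_ - _)%X with (xtail (cst (IZR unit_z) * x - pz (fst a)))%X by (apply l1_eq; reflexivity).
apply nrm_xtail.
Qed.

Lemma inb_cst (c e : Z) (r : R) :
  Rabs (IZR unit_z * r - IZR c) <= IZR e -> inb ([c], e) (cst r).
Proof.
unfold inb; simpl; intros H; rewrite <- nrm_cst in H.
rewrite cst_sub, cst_mul in H.
replace (_ - _)%X with (cst (IZR unit_z) * cst r - cst (IZR c))%X by ring; exact H.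
Qed.

Lemma inb_unit : inb bunit x1.
Proof. apply inb_cst; rewrite Rmult_1_r, Rminus_diag, Rabs_R0; apply Rle_refl. Qed.

Lemma inb_w : inb bw xw.
Proof.
unfold inb; simpl; replace (_ - _)%X with (- cst 0)%X by ring.
rewrite nrm_opp, nrm_cst, Rabs_R0; apply Rle_refl.
Qed.

Lemma inb_x2 : inb ([(2 * unit_z)%Z], 0%Z) x2.
Proof. apply inb_cst; rewrite mult_IZR; replace (_ - _) with 0 by ring; rewrite Rabs_R0; apply Rle_refl. Qed.

Lemma inb_xhalf : inb ([(unit_z / 2)%Z], 0%Z) xhalf.
Proof.
apply inb_cst; replace (IZR (unit_z / 2)) with (IZR unit_z * / 2).
- rewrite Rminus_diag, Rabs_R0; apply Rle_refl.
- rewrite unit_val; change (4503599627370496 / 2)%Z with 2251799813685248%Z; lra.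
Qed.

Lemma inb_cis : inb ([(5 * unit_z / 11)%Z], 1%Z) cis.
Proof.
apply inb_cst; rewrite unit_val; change (5 * 4503599627370496 / 11)%Z with 2047090739713861%Z.
apply Rabs_le; lra.
Qed.

Lemma inb_pows (thr : Z) (a : zball) (x : X) (p : zball) (k n : nat) :
  inb a x -> inb p (x ^ k)%X ->
  forall j, (j < length (bpows thr a p n))%nat ->
  inb (nth j (bpows thr a p n) ([], 0%Z)) (x ^ (j + k))%X.
Proof.
intros Ha; revert p k; induction n as [|n IH]; intros p k Hp j Hj; simpl in *.
- destruct j as [|j]; [exact Hp | lia].
- destruct j as [|j]; [exact Hp|].
  replace (S j + k)%nat with (j + S k)%nat by lia.
  apply IH; [apply inb_mul; assumption | lia].
Qed.

Definition powers (r : list zball) (x : X) : Prop :=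
  forall j, (j < length r)%nat -> inb (nth j r ([], 0%Z)) (x ^ j)%X.

Lemma bpows_powers (thr : Z) (a : zball) (x : X) (n : nat) :
  inb a x -> powers (bpows thr a bunit n) x.
Proof.
intros H j Hj; rewrite <- (Nat.add_0_r j) at 2.
apply inb_pows; [exact H | apply inb_unit | exact Hj].
Qed.

(** Horner's splitting, which lets [lcz_bound] and [lc_pder] recurse along a list of
    coefficients. *)
Lemma lc_cons (c : R) (f : X) (y : nat -> X) (M : R) : bounded_by M y ->
  lc (cst c + xw * f)%X y = (cst c * y 0%nat + lc f (fun k => y (S k)))%X.
Proof.
intros H.
assert (H' : bounded_by M (fun k => y (S k))) by (intros k; apply H).
rewrite <- xshift_mul, <- scal_cst; apply l1_eq; intros n; rewrite xadd_coef.
rewrite (lc_coef _ _ M H), (lc_coef _ _ M H'), Series_incr_1.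
- f_equal.
  + change (scal c (y 0%nat) n) with (c * y 0%nat n); rewrite xadd_coef; simpl.
    rewrite Rplus_0_r; reflexivity.
  + apply Series_ext; intros k; rewrite xadd_coef; simpl; rewrite Rplus_0_l; reflexivity.
- apply (ex_series_lc_coef _ y M n H).
Qed.

Lemma lc_x0 (y : nat -> X) (M : R) : bounded_by M y -> lc x0 y = x0.
Proof.
intros H; assert (E := lc_cst_l 0 x0 y M H).
rewrite cst_0 in E; replace (x0 * x0)%X with x0 in E by ring; rewrite E; ring.
Qed.

Lemma lcz_bound (y : nat -> X) : bounded_by 1 y -> forall (c : list Z) (r : list zball),
  (forall j, (j < length r)%nat -> inb (nth j r ([], 0%Z)) (y j)) ->
  nrm (cst (IZR unit_z) * lc (pz c) y - pz (fst (lcz c r)))%X <= IZR (snd (lcz c r)).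
Proof.
intros H c; revert y H; induction c as [|x c IH]; intros y H r Hr.
- simpl; rewrite (lc_x0 y 1 H); replace (_ - _)%X with x0 by ring.
  rewrite nrm_x0; apply Rle_refl.
- destruct r as [|b r].
  + change (snd (lcz (x :: c) [])) with (unit_z * nz (x :: c))%Z; simpl fst; simpl pz at 2.
    replace (_ - _)%X with (cst (IZR unit_z) * lc (pz (x :: c)) y)%X by ring.
    assert (U := unit_pos).
    rewrite mult_IZR, nrm_cst_mul, Rabs_pos_eq by lra; apply Rmult_le_compat_l; [lra|].
    apply Rle_trans with (1 := lc_norm _ y 1 H); rewrite Rmult_1_l; apply nrm_pz.
  + simpl pz at 1; rewrite (lc_cons _ _ y 1 H); simpl; rewrite pz_add, pz_sc, plus_IZR, mult_IZR, abs_IZR.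
    replace (_ - _)%X with (cst (IZR x) * (cst (IZR unit_z) * y 0%nat - pz (fst b))
      + (cst (IZR unit_z) * lc (pz c) (fun k => y (S k)) - pz (fst (lcz c r))))%X by ring.
    apply Rle_trans with (1 := nrm_add _ _), Rplus_le_compat.
    * rewrite nrm_cst_mul; apply Rmult_le_compat_l; [apply Rabs_pos|].
      apply (Hr 0%nat); simpl; lia.
    * apply IH; [intros k; apply H|]; intros j Hj; apply (Hr (S j)); simpl; lia.
Qed.

Lemma inb_comp (thr : Z) (fb : zball) (f : X) (r : list zball) (a : X) :
  inb fb f -> nrm a <= 1 -> powers r a -> inb (bcomp thr fb r) (xcomp f a).
Proof.
intros Hf Ha Hr; assert (B := xpow_bounded a Ha).
unfold bcomp; apply inb_round; rewrite plus_IZR, mult_IZR.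
(* Only the polynomial centre of [f] meets the enclosed powers; the deviation of [f] from it passes
   through the composition with factor 1. *)
assert (E : (cst (IZR unit_z) * xcomp f a)%X =
  (lc (pz (fst fb)) (xpow a) + lc (cst (IZR unit_z) * f - pz (fst fb)) (xpow a))%X).
{ rewrite <- (lc_add_l _ _ _ 1 B); unfold xcomp; rewrite <- (lc_cst_l _ _ _ 1 B); f_equal; ring. }
rewrite E; replace (_ - _)%X with ((cst (IZR unit_z) * lc (pz (fst fb)) (xpow a) - pz (fst (lcz (fst fb) r)))
  + cst (IZR unit_z) * lc (cst (IZR unit_z) * f - pz (fst fb)) (xpow a))%X by ring.
apply Rle_trans with (1 := nrm_add _ _), Rplus_le_compat; [apply lcz_bound; assumption|].
assert (U := unit_pos).
rewrite nrm_cst_mul, Rabs_pos_eq by lra; apply Rmult_le_compat_l; [lra|].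
apply Rle_trans with (1 := lc_norm _ _ 1 B); rewrite Rmult_1_l; exact Hf.
Qed.

Lemma dpow_S (a : X) (k : nat) : dpow a (S k) = (cst (IZR (1 + Z.of_nat k)) * a ^ k)%X.
Proof.
induction k as [|k IH]; [simpl; replace (cst 1) with x1 by reflexivity; ring|].
change (dpow a (S (S k))) with (a * dpow a (S k) + a ^ S k)%X; rewrite IH.
rewrite Nat2Z.inj_succ, <- Z.add_1_l, (cst_IZR_add 1 (1 + Z.of_nat k)).
change (cst 1) with x1; simpl; ring.
Qed.

(** The offset [k] makes the induction possible: removing the head of the list advances the
    multiplier and the exponent together. *)
Lemma lc_pder (a : X) (M : R) (Ha : nrm a <= 1) (l : list Z) (k : nat) :
  bounded_by M (fun j => dpow a (S (k + j))) ->
  lc (pz l) (fun j => dpow a (S (k + j))) =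
  lc (pz (pder (1 + Z.of_nat k) l)) (fun j => (a ^ (k + j))%X).
Proof.
revert k; induction l as [|x l IH]; intros k H.
- cbn [pz pder]; rewrite (lc_x0 _ M H); symmetry; apply (lc_x0 _ 1).
  intros j; apply nrm_pow_le1, Ha.
- cbn [pz pder]; rewrite (lc_cons _ _ _ M H), (lc_cons _ _ (fun j => (a ^ (k + j))%X) 1)
    by (intros j; apply nrm_pow_le1, Ha).
  rewrite !Nat.add_0_r, dpow_S, cst_IZR_mul; f_equal; [ring|].
  replace (1 + Z.of_nat k + 1)%Z with (1 + Z.of_nat (S k))%Z by lia.
  assert (E1 : (fun j => dpow a (S (k + S j))) = (fun j => dpow a (S (S k + j)))).
  { apply functional_extensionality; intros j; do 2 f_equal; lia. }
  assert (E2 : (fun j => (a ^ (k + S j))%X) = (fun j => (a ^ (S k + j))%X)).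
  { apply functional_extensionality; intros j; f_equal; lia. }
  rewrite E1, E2; apply IH; rewrite <- E1; intros j; apply H.
Qed.

Lemma xdcomp_pz (a : X) (l : list Z) : nrm a < 1 ->
  xdcomp (pz l) a = xcomp (pz (pder 1 (tl l))) a.
Proof.
intros H; assert (B := dpow_bounded a _ (Rle_refl _) H); unfold xdcomp, xcomp.
destruct l as [|x l]; simpl tl.
- cbn [pz pder]; rewrite (lc_x0 _ _ B); symmetry; apply (lc_x0 _ 1), xpow_bounded; lra.
- cbn [pz]; rewrite (lc_cons _ _ _ _ B); change (dpow a 0) with x0.
  assert (E := lc_pder a _ (Rlt_le _ _ H) l 0 (fun j => B (S j))).
  transitivity (lc (pz l) (fun k => dpow a (S k))); [ring | exact E].
Qed.

Lemma inb_dcomp (thr : Z) (fb ab : zball) (f : X) (r : list zball) (a : X) :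
  inb fb f -> inb ab a -> (nb ab < unit_z)%Z -> powers r a ->
  inb (bdcomp thr fb ab r) (xdcomp f a).
Proof.
intros Hf Ha Hn Hr; assert (U := unit_pos); assert (Na := inb_norm _ _ Ha).
assert (L : IZR (nb ab) < IZR unit_z) by (apply IZR_lt, Hn).
assert (A1 : nrm a < 1) by nra.
assert (B := xpow_bounded a (Rlt_le _ _ A1)).
assert (D := dpow_bounded a _ (Rle_refl _) A1).
set (e := (unit_z * snd fb / (unit_z - nb ab) + 1)%Z).
assert (Se := inb_radius _ _ Hf).
(* The denominator in [e] is at most $2^{52}(1-\|a\|)$ by [Na], and the added 1 compensates the
   rounding of the quotient. *)
assert (Ee : IZR (snd fb) * (1 / (1 - nrm a)) <= IZR e).
{ assert (Q : IZR (unit_z * snd fb) <= IZR (unit_z - nb ab) * IZR e).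
  { rewrite <- mult_IZR; apply IZR_le; unfold e.
    assert (V := Z.mul_succ_div_gt (unit_z * snd fb) (unit_z - nb ab) ltac:(lia)); lia. }
  rewrite mult_IZR, minus_IZR in Q.
  apply Rmult_le_reg_l with (1 - nrm a); [lra|].
  replace ((1 - nrm a) * (IZR (snd fb) * (1 / (1 - nrm a)))) with (IZR (snd fb)) by (field; lra).
  apply Rmult_le_reg_l with (1 := U); apply Rle_trans with (1 := Q).
  rewrite <- Rmult_assoc; apply Rmult_le_compat_r; [|lra].
  apply IZR_le; unfold e; apply le_IZR in Se.
  assert (0 <= unit_z * snd fb / (unit_z - nb ab))%Z by (apply Z.div_pos; rewrite ?unit_val in *; lia); lia. }
unfold bdcomp; fold e.
set (c := pder 1 (tl (fst fb))).
unfold bcomp; apply inb_round; rewrite plus_IZR, mult_IZR; simpl fst; simpl snd.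
assert (E : (cst (IZR unit_z) * xdcomp f a)%X =
  (lc (pz c) (xpow a) + lc (cst (IZR unit_z) * f - pz (fst fb)) (dpow a))%X).
{ change (lc (pz c) (xpow a)) with (xcomp (pz c) a); unfold c; rewrite <- xdcomp_pz by exact A1.
  unfold xdcomp; rewrite <- (lc_add_l _ _ _ _ D), <- (lc_cst_l _ _ _ _ D); f_equal; ring. }
rewrite E; replace (_ - _)%X with ((cst (IZR unit_z) * lc (pz c) (xpow a) - pz (fst (lcz c r)))
  + cst (IZR unit_z) * lc (cst (IZR unit_z) * f - pz (fst fb)) (dpow a))%X by ring.
apply Rle_trans with (1 := nrm_add _ _), Rplus_le_compat; [apply lcz_bound; assumption|].
rewrite nrm_cst_mul, Rabs_pos_eq by lra; apply Rmult_le_compat_l; [lra|].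
apply Rle_trans with (1 := lc_norm _ _ _ D).
apply Rle_trans with (2 := Ee); rewrite Rmult_comm; apply Rmult_le_compat_r; [|exact Hf].
apply Rdiv_le_0_compat; lra.
Qed.

(** From $y-b=b(ay-1)$ the error is at most $\|b\|$ times the defect; $\|b\|\le|y|+\|y-b\|$ then
    eliminates the unknown norm. *)
Lemma inb_inv (thr : Z) (ab : zball) (a b : X) :
  inb ab a -> (a * b)%X = x1 ->
  (nb (bsub (bmul thr ab ([(unit_z * unit_z / hd 0 (fst ab))%Z], 0%Z)) bunit) < unit_z)%Z ->
  inb (binv thr ab) b.
Proof.
intros Ha E Hd; unfold binv.
set (y := (unit_z * unit_z / hd 0 (fst ab))%Z) in *.
set (d := nb (bsub (bmul thr ab ([y], 0%Z)) bunit)) in *.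
assert (U := unit_pos).
set (yr := IZR y / IZR unit_z).
assert (Y : inb ([y], 0%Z) (cst yr)).
{ apply inb_cst; unfold yr; replace (_ - _) with 0 by (field; lra); rewrite Rabs_R0; apply Rle_refl. }
assert (D := inb_norm _ _ (inb_sub _ _ _ _ (inb_mul thr _ _ _ _ Ha Y) inb_unit)); fold d in D.
set (t := (a * cst yr - x1)%X) in *.
assert (Hd' : IZR d < IZR unit_z) by (apply IZR_lt, Hd).
assert (T := nrm_ge0 t).
assert (Eb : (cst yr - b)%X = (b * t)%X).
{ transitivity ((a * b) * cst yr - b)%X; [rewrite E; ring | unfold t; ring]. }
assert (Nb : nrm (cst yr - b)%X <= nrm b * nrm t) by (rewrite Eb; apply nrm_mul).
assert (Nb2 : nrm b <= Rabs yr + nrm (cst yr - b)%X).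
{ rewrite <- nrm_cst; replace b with (cst yr - (cst yr - b))%X at 1 by ring; apply nrm_sub. }
assert (B0 := nrm_ge0 b).
unfold inb; simpl.
replace (_ - _)%X with (- (cst (IZR unit_z) * (cst yr - b)))%X.
2: { unfold yr; replace (cst (IZR y)) with (cst (IZR unit_z) * cst (IZR y / IZR unit_z))%X; [ring|].
     rewrite <- cst_mul; f_equal; field; lra. }
rewrite nrm_opp, nrm_cst_mul, Rabs_pos_eq by lra.
set (e := (Z.abs y * d / (unit_z - d) + 1)%Z).
assert (Q : IZR (Z.abs y * d) <= IZR (unit_z - d) * IZR e).
{ rewrite <- mult_IZR; apply IZR_le; unfold e.
  assert (V := Z.mul_succ_div_gt (Z.abs y * d) (unit_z - d) ltac:(lia)); lia. }
rewrite mult_IZR, minus_IZR, abs_IZR in Q.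
assert (Yr : Rabs (IZR y) = IZR unit_z * Rabs yr).
{ rewrite <- (Rabs_pos_eq (IZR unit_z)) at 1 by lra; rewrite <- Rabs_mult; f_equal; unfold yr; field; lra. }
set (z := nrm (cst yr - b)%X) in *.
assert (Z1 : IZR unit_z * z <= (Rabs yr + z) * IZR d).
{ apply Rle_trans with (IZR unit_z * (nrm b * nrm t)); [apply Rmult_le_compat_l; lra|].
  replace (IZR unit_z * (nrm b * nrm t)) with (nrm b * (IZR unit_z * nrm t)) by ring.
  apply Rmult_le_compat; try assumption; nra. }
apply Rmult_le_reg_l with (IZR unit_z - IZR d); [lra|].
apply Rle_trans with (2 := Q); rewrite Yr; nra.
Qed.

(** * Enclosure of [T] and of its derivative *)

(* [letb] stands for [let]: it shares intermediate results under evaluation and can be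
   eliminated one binding at a time. *)
Definition letb {A B : Type} (a : A) (k : A -> B) : B := k a.

Lemma letb_elim {A B : Type} (a : A) (k : A -> B) (r : B) :
  letb a k = r -> exists x, x = a /\ k x = r.
Proof. intros H; exists a; split; [reflexivity | exact H]. Qed.

Notation "x <- a ;; b" := (letb a (fun x => b)) (at level 100, a at next level, right associativity).

(** The data of the column test: [v_dl0] is the derivative of $\lambda$ in the exceptional direction
    $f=1$, the lists hold the powers of the six arguments, and the last seven entries are the
    coefficients of the factorized derivative. *)
Record vals := Vals {
  v_T1 : zball; v_T2 : zball; v_il : zball; v_dl0 : zball;
  v_alp : list zball; v_pp : list zball; v_up : list zball;
  v_qp : list zball; v_hp : list zball; v_mp : list zball;
  v_A1 : zball; v_A2 : zball; v_V1 : zball;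
  v_B1 : zball; v_B2 : zball; v_B3 : zball; v_V2 : zball }.

Definition b2 : zball := ([(2 * unit_z)%Z], 0%Z).
Definition bhalf : zball := ([(unit_z / 2)%Z], 0%Z).
Definition bis : zball := ([(5 * unit_z / 11)%Z], 1%Z).

Definition lt1 (a : zball) : bool := (nb a <? unit_z)%Z.

(** Each guard is a hypothesis of a soundness lemma. All are tested at the end, since the integer
    computation is total. *)
Definition run (thr : Z) (n : nat) (fb gb : zball) : option vals :=
  let mul := bmul thr in
  let pows a := bpows thr a bunit n in
  c0 <- ([hd 0%Z (fst fb)], snd fb) ;;
  al <- mul (bsub (mul c0 c0) bunit) bis ;;
  alp <- pows al ;;
  lam <- bneg (bcomp thr fb alp) ;;
  fda <- bdcomp thr fb al alp ;;
  il <- binv thr lam ;;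
  ws <- badd bw bis ;;
  l2 <- mul lam lam ;;
  p <- bsub (mul l2 ws) bis ;;
  pp <- pows p ;;
  fp <- bcomp thr fb pp ;;
  fdp <- bdcomp thr fb p pp ;;
  us <- mul fp fp ;;
  ut <- mul b2 us ;;
  up <- pows ut ;;
  gu <- bcomp thr gb up ;;
  gdu <- bdcomp thr gb ut up ;;
  t1 <- mul il (bsub (mul us gu) bunit) ;;
  m <- mul l2 bw ;;
  mp <- pows m ;;
  gm <- bcomp thr gb mp ;;
  gdm <- bdcomp thr gb m mp ;;
  v <- mul (mul bhalf m) gm ;;
  q <- mul bis (mul v (bsub v b2)) ;;
  qp <- pows q ;;
  fq <- bcomp thr fb qp ;;
  fdq <- bdcomp thr fb q qp ;;
  h <- mul bis (bsub (mul fq fq) bunit) ;;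
  hp <- pows h ;;
  fh <- bcomp thr fb hp ;;
  fdh <- bdcomp thr fb h hp ;;
  bb1 <- mul b2 il ;;
  t2 <- btail (mul bb1 fh) ;;
  a1 <- mul (mul bb1 (badd gu (mul ut gdu))) fp ;;
  a2 <- mul il us ;;
  v1 <- bsub (mul (mul b2 (mul a1 fdp)) (mul lam ws)) (mul il t1) ;;
  bb2 <- mul (mul b2 (mul bb1 fdh)) (mul fq bis) ;;
  bq <- mul (mul b2 (mul bb2 fdq)) (mul (bsub v bunit) bis) ;;
  bb3 <- mul bq (mul bhalf m) ;;
  v2 <- bsub (mul (mul bq (badd gm (mul m gdm))) (mul lam bw)) (mul (mul il bb1) fh) ;;
  dl0 <- bneg (badd bunit (mul fda (mul bis (mul b2 c0)))) ;;
  if (snd lam <? Z.abs (hd 0 (fst lam)))%Z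
     && (nb (bsub (mul lam ([(unit_z * unit_z / hd 0 (fst lam))%Z], 0%Z)) bunit) <? unit_z)%Z
     && lt1 al && lt1 p && lt1 ut && lt1 m && lt1 q && lt1 h
  then Some (Vals t1 t2 il dl0 alp pp up qp hp mp a1 a2 v1 bb1 bb2 bb3 v2) else None.

Record enclosed (F : Y) (v : vals) : Prop := Enclosed {
  e_T1 : inb (v_T1 v) (tT1 F); e_T2 : inb (v_T2 v) (tT2 F);
  e_il : inb (v_il v) (til F);
  e_dl0 : inb (v_dl0 v) (- (x1 + xdcomp (pf F) (tal F) * (cis * (x2 * tc F))))%X;
  e_alp : powers (v_alp v) (tal F); e_pp : powers (v_pp v) (tp F);
  e_up : powers (v_up v) (tut F); e_qp : powers (v_qp v) (tq F);
  e_hp : powers (v_hp v) (th F); e_mp : powers (v_mp v) (tm F);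
  e_A1 : inb (v_A1 v) (dA1 F); e_A2 : inb (v_A2 v) (dA2 F); e_V1 : inb (v_V1 v) (dV1 F);
  e_B1 : inb (v_B1 v) (dB1 F); e_B2 : inb (v_B2 v) (dB2 F); e_B3 : inb (v_B3 v) (dB3 F);
  e_V2 : inb (v_V2 v) (dV2 F) }.

Lemma inb_coef0 (a : zball) (x : X) : inb a x -> inb ([hd 0%Z (fst a)], snd a) (cst (x 0%nat)).
Proof.
intros H; apply inb_cst; apply Rle_trans with (2 := H).
replace (_ - _) with ((cst (IZR unit_z) * x - pz (fst a))%X 0%nat); [apply (l1_abs_coef_le (_ - _)%X 0)|].
rewrite <- scal_cst; change (IZR unit_z * x 0%nat - pz (fst a) 0%nat = IZR unit_z * x 0%nat - IZR (hd 0%Z (fst a))).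
f_equal; destruct (fst a) as [|c l]; [reflexivity|].
cbn [pz hd]; rewrite <- xshift_mul; apply Rplus_0_r.
Qed.

Lemma lt1_norm (a : zball) (x : X) : inb a x -> lt1 a = true -> nrm x < 1.
Proof.
intros H L; apply Z.ltb_lt, IZR_lt in L; assert (N := inb_norm _ _ H); assert (U := unit_pos); nra.
Qed.

Lemma inb_nonzero (a : zball) (r : R) :
  inb a (cst r) -> (snd a < Z.abs (hd 0%Z (fst a)))%Z -> r <> 0.
Proof.
intros H C Z; apply inb_coef0 in H; subst r.
apply IZR_lt in C; rewrite abs_IZR, <- nrm_cst in C.
unfold inb in H; cbn [fst snd pz] in H.
change (cst (cst 0 0%nat)) with (cst 0) in H; rewrite cst_0 in H.
replace (_ - _)%X with (- cst (IZR (hd 0%Z (fst a))))%X in H by ring.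
rewrite nrm_opp in H; lra.
Qed.

Opaque inb powers xadd xsub xopp xmul xcomp xdcomp cst xtail bmul badd bneg bsub.

Ltac inb_tac :=
  lazymatch goal with
  | |- inb (bmul _ _ _) _ => apply inb_mul; inb_tac
  | |- inb (badd _ _) _ => apply inb_add; inb_tac
  | |- inb (bsub _ _) _ => apply inb_sub; inb_tac
  | |- inb (bneg _) _ => apply inb_neg; inb_tac
  | |- inb (btail _) _ => apply inb_tail; inb_tac
  | |- inb bunit _ => exact inb_unit
  | |- inb bw _ => exact inb_w
  | |- inb b2 _ => exact inb_x2
  | |- inb bhalf _ => exact inb_xhalf
  | |- inb bis _ => exact inb_cis
  | _ => assumption
  end.

Lemma run_sound (thr : Z) (n : nat) (fb gb : zball) (vv : vals) (F : Y) :
  inb fb (pf F) -> inb gb (pg F) -> run thr n fb gb = Some vv ->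
  good F /\ enclosed F vv.
Proof.
intros If Ig H; unfold run in H.
(* Each binding becomes a variable with its defining equation, so that no enclosure is ever expanded
   inside another. *)
repeat match type of H with letb ?a (fun x => _) = _ =>
  let y := fresh x in let E := fresh "E" in apply letb_elim in H; destruct H as [y [E H]] end.
match type of H with (if ?c then _ else _) = _ => destruct c eqn:C; [|discriminate H] end.
rewrite !Bool.andb_true_iff in C; destruct C as [[[[[[[C1 C2] C3] C4] C5] C6] C7] C8].
injection H as H; subst vv.
assert (I0 : inb c0 (tc F)) by (rewrite E; apply inb_coef0, If).
assert (Ial : inb al (tal F)) by (rewrite E0; inb_tac).
assert (Nal := lt1_norm _ _ Ial C3).
assert (Ialp : powers alp (tal F)) by (rewrite E1; apply bpows_powers, Ial).
assert (Ilam : inb lam (tlam F)) by (rewrite E2; apply inb_neg, inb_comp; [exact If | lra | exact Ialp]).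
assert (L0 : lambda (pf F) <> 0).
{ apply (inb_nonzero lam); [rewrite <- tlam_cst by lra; exact Ilam | apply Z.ltb_lt, C1]. }
assert (Iil : inb il (til F)).
{ rewrite E4; apply (inb_inv thr lam (tlam F)); [exact Ilam | | apply Z.ltb_lt, C2].
  rewrite tlam_cst by lra; unfold til, x1; rewrite <- cst_mul; f_equal; field; exact L0. }
assert (Iws : inb ws tws) by (rewrite E5; inb_tac).
assert (Ip : inb p (tp F)) by (rewrite E7, E6; inb_tac).
assert (Np := lt1_norm _ _ Ip C4).
assert (Ipp : powers pp (tp F)) by (rewrite E8; apply bpows_powers, Ip).
assert (Ifp : inb fp (tfp F)) by (rewrite E9; apply inb_comp; [exact If | lra | exact Ipp]).
assert (Iu : inb us (tu F)) by (rewrite E11; inb_tac).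
assert (Iut : inb ut (tut F)) by (rewrite E12; inb_tac).
assert (Nut := lt1_norm _ _ Iut C5).
assert (Iup : powers up (tut F)) by (rewrite E13; apply bpows_powers, Iut).
assert (Igu : inb gu (tgu F)) by (rewrite E14; apply inb_comp; [exact Ig | lra | exact Iup]).
assert (It1 : inb t1 (tT1 F)) by (rewrite E16; inb_tac).
assert (Im : inb m (tm F)) by (rewrite E17, E6; inb_tac).
assert (Nm := lt1_norm _ _ Im C6).
assert (Imp : powers mp (tm F)) by (rewrite E18; apply bpows_powers, Im).
assert (Igm : inb gm (tgm F)) by (rewrite E19; apply inb_comp; [exact Ig | lra | exact Imp]).
assert (Iv : inb v (tv F)) by (rewrite E21; inb_tac).
assert (Iq : inb q (tq F)) by (rewrite E22; inb_tac).
assert (Nq := lt1_norm _ _ Iq C7).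
assert (Iqp : powers qp (tq F)) by (rewrite E23; apply bpows_powers, Iq).
assert (Ifq : inb fq (tfq F)) by (rewrite E24; apply inb_comp; [exact If | lra | exact Iqp]).
assert (Ih : inb h (th F)) by (rewrite E26; unfold th; inb_tac).
assert (Nh := lt1_norm _ _ Ih C8).
assert (Ihp : powers hp (th F)) by (rewrite E27; apply bpows_powers, Ih).
assert (Ifh : inb fh (tfh F)) by (rewrite E28; apply inb_comp; [exact If | lra | exact Ihp]).
apply Z.ltb_lt in C3, C4, C5, C6, C7, C8.
assert (Da : inb fda (xdcomp (pf F) (tal F))) by (rewrite E3; apply inb_dcomp; assumption).
assert (Dp : inb fdp (xdcomp (pf F) (tp F))) by (rewrite E10; apply inb_dcomp; assumption).
assert (Du : inb gdu (xdcomp (pg F) (tut F))) by (rewrite E15; apply inb_dcomp; assumption).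
assert (Dm : inb gdm (xdcomp (pg F) (tm F))) by (rewrite E20; apply inb_dcomp; assumption).
assert (Dq : inb fdq (xdcomp (pf F) (tq F))) by (rewrite E25; apply inb_dcomp; assumption).
assert (Dh : inb fdh (xdcomp (pf F) (th F))) by (rewrite E29; apply inb_dcomp; assumption).
assert (JB1 : inb bb1 (dB1 F)) by (rewrite E30; inb_tac).
assert (JA1 : inb a1 (dA1 F)) by (rewrite E32; inb_tac).
assert (JB2 : inb bb2 (dB2 F)) by (rewrite E35; unfold dB2; inb_tac).
assert (JBq : inb bq (dBq F)).
{ rewrite E36; unfold dBq; inb_tac. }
split; [repeat split; assumption|].
refine (Enclosed F (Vals _ _ _ _ _ _ _ _ _ _ _ _ _ _ _ _ _) It1 _ Iil _ Ialp Ipp Iup Iqp Ihp Imp JA1 _ _ JB1 JB2 _ _);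
  cbn [v_T2 v_dl0 v_A2 v_V1 v_B3 v_V2].
- rewrite E31; unfold tT2; inb_tac.
- rewrite E39; inb_tac.
- rewrite E33; unfold dA2; inb_tac.
- rewrite E34; unfold dV1; inb_tac.
- rewrite E37; unfold dB3; inb_tac.
- rewrite E38; unfold dV2; inb_tac.
Qed.

Transparent l1_norm inb powers xadd xsub xopp xmul xcomp xdcomp cst xtail bmul badd bneg bsub.

(** * Numerical data *)

(* Taylor coefficients of the approximate fixed point, in units of [2^-52]. *)
Definition f0z : list Z :=
[-3386456113962923; -11416188724291796; 1342756647260142; 406803521407248; -32605311649322;
-3980692239900; 478784377066; -1858066930; -4875862460; 348802174; 47232669; -4665041; -477611;
58760; 3596]%Z.

Definition g0z : list Z :=
[28116373694928324; -9575108781558236; 741213579253993; 236733061070530; -83417766480066;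
14577990802394; -1275193193466; -147065246682; 79845288030; -14915953077; 1174471321; 139048206;
-60854812; 9584452; -506846; -134874; 40857; -4979]%Z.

(* Columns of [Gamma], the rounded derivative of [T] at the approximate fixed point, in units
   of [2^-20]: images of [z^k] in the first and then in the second component. *)
Definition gam_f : list (list Z * list Z) :=
[([35822285; 20571326; -15788500; -5030816; 699714; 86368; -14287; 218; 187; -18; -2], [-84329787;
77996151; -9641306; -4637010; 2066335; -438064; 44611; 6199; -3725; 773; -67; -9; 4]);
([-8538786;
893479; 1541431; 185703; -49747; -2940; 778; -35; -8; 1], [321390; -3014781; 455696; 250694;
-113165; 23807; -2294; -399; 220; -45; 4; 1]);
([3348341; -1194827; -282492; 37288; -20; -358; 96;
-1; -1], [-84147; 1853774; -913099; 151068; 9687; -10571; 2578; -269; -28; 17; -3]);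
([-1373094;
768110; -12413; -37777; 8492; -96; -180; 18; 1], [-80067; -525083; 50306; 193366; -113797; 31785;
-4570; 14; 143; -31; 2]);
([576048; -420713; 62389; 16549; -7069; 580; 95; -20; 1], [34916;
179071; 35261; -69938; -12287; 35257; -19376; 5859; -1052; 80; 13; -5; 1]);
([-244342; 215911;
-53525; -3701; 4230; -666; -12; 15; -1], [-10670; -55680; -38002; 17677; 23224; -12294; -5265;
7717; -3911; 1184; -226; 21; 2]);
([104182; -107068; 35887; -1463; -2074; 532; -32; -7; 1], [2853;
16081; 19010; 2938; -13259; -1751; 6978; -1900; -1679; 1732; -810; 240; -47]);
([-44528; 51969;
-21650; 2690; 814; -348; 44; 1; -1], [-711; -4392; -7393; -4597; 3562; 4238; -2338; -1638; 1666;
-184; -473; 386; -168]);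
([19053; -24848; 12293; -2401; -195; 196; -39; 2; 1], [169; 1150; 2509;
2610; -111; -2230; -318; 1384; -160; -582; 346; 14; -123]);
([-8157; 11746; -6703; 1738; -55; -95;
28; -3], [-39; -291; -780; -1120; -473; 710; 649; -411; -365; 307; 62; -160; 65]);
([3493; -5503;
3550; -1131; 124; 38; -18; 3], [9; 72; 228; 415; 334; -112; -364; -23; 246; -9; -132; 51;
35]);
([-1496; 2559; -1838; 689; -118; -9; 10; -2], [-2; -17; -63; -140; -161; -33; 133; 92; -78;
-65; 54; 23; -35]);
([641; -1182; 935; -401; 90; -3; -5; 2], [0; 4; 17; 44; 65; 38; -32; -57; 4;
43; -2; -26; 7])]%Z.

Definition gam_g : list (list Z * list Z) :=
[([633894; -525931; 111028; -740; -26], [1048576; -672957; 56189; 37695; -14083; 2698; -223; -53;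
25; -5]);
([184156; -305581; 191278; -53953; 5991; -63; -2], [0; 60540; -38853; 3244; 2176; -813;
156; -13; -3; 1]);
([53500; -133164; 138596; -77391; 24580; -4269; 335; -4], [0; 0; 3495; -2243;
187; 126; -47; 9; -1]);
([15543; -51581; 75084; -62684; 32891; -11148; 2402; -307; 19], [0; 0; 0;
202; -130; 11; 7; -3; 1]);
([4515; -18731; 35037; -38938; 28502; -14381; 5079; -1246; 205; -21;
1], [0; 0; 0; 0; 12; -7; 1]);
([1312; -6530; 14923; -20712; 19455; -13041; 6405; -2327; 623; -120;
16; -1], [0; 0; 0; 0; 0; 1]);
([381; -2213; 5976; -9947; 11406; -9537; 6001; -2890; 1072; -306;
66; -11; 1], []);
([111; -735; 2289; -4443; 6016; -6028; 4626; -2775; 1316; -496; 148; -35; 6],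
[]);
([32; -240; 848; -1880; 2935; -3428; 3104; -2230; 1289; -604; 231; -72; 18], []);
([9; -78;
306; -763; 1349; -1799; 1878; -1571; 1071; -601; 279; -108; 34], []);
([3; -25; 108; -299; 591;
-887; 1048; -1001; 786; -513; 281; -129; 50], []);
([1; -8; 37; -114; 249; -415; 548; -589; 523;
-390; 246; -132; 60], []);
([0; -2; 13; -43; 102; -187; 272; -324; 322; -270; 192; -117; 62], [])]%Z.

(* Eigenvalues, right and left eigenvectors of [Gamma], in units of [2^-20]. *)
Definition eig1 : Z * (list Z * list Z) * (list Z * list Z) :=
(24500296, ([-292875; -273822; 167855; 59763; -7853; -1032; 165; -2; -2; 0; 0; 0; 0], [1048576;
-918373; 107893; 55639; -24328; 5111; -510; -75; 44; -9; 1; 0; 0]), ([-7367554; 2603883; -1125328;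
497045; -221501; 99146; -44488; 19992; -8993; 4048; -1823; 822; -370], [-260183; -97973; -38421;
-15224; -6074; -2437; -981; -397; -161; -65; -27; -11; -4]))%Z.

Definition eig2 : Z * (list Z * list Z) * (list Z * list Z) :=
(12700366, ([-146185; -290496; 140642; 56734; -7005; -985; 153; -1; -2; 0; 0; 0; 0], [1048576;
-870424; 97977; 53087; -22903; 4784; -471; -72; 41; -8; 1; 0; 0]), ([7259136; -5007306; 2356292;
-1100296; 510512; -236161; 109095; -50356; 23228; -10707; 4933; -2271; 1045], [628733; 267074;
116593; 50133; 21301; 8977; 3762; 1570; 653; 271; 113; 47; 19]))%Z.

Definition eig3 : Z * (list Z * list Z) * (list Z * list Z) :=
(565839, ([-6234; -43449; 93941; -14956; -3941; 862; 40; -17; 0; 0; 0; 0; 0], [-1045870; 1048576;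
-259457; -10318; 20641; -6413; 1084; -42; -34; 11; -1; 0; 0]), ([17577; -644124; 3627140;
-2392768; 1456887; -830961; 456737; -245954; 130732; -68768; 35841; -18508; 9477], [913957;
1938423; 1444305; 908923; 509917; 266303; 132664; 63958; 30114; 13933; 6357; 2866; 1289]))%Z.

(** * Complexification and operator bounds *)

Notation nC := (@l1_norm C_AbsRing).
Notation nYC := (@pair_norm C_AbsRing).

Lemma nYC_triangle (H K : YC) : nYC (plus H K) <= nYC H + nYC K.
Proof. apply pair_norm_triangle. Qed.

Lemma nYC_scal (z : C) (H : YC) : nYC (scal z H) <= Cmod z * nYC H.
Proof. exact (pair_norm_scal z H). Qed.

Lemma nYC_opp (H : YC) : nYC (opp H) = nYC H.
Proof. exact (norm_opp H). Qed.

Lemma nYC_minus (H K : YC) : nYC (minus H K) <= nYC H + nYC K.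
Proof. rewrite <- (nYC_opp K); apply nYC_triangle. Qed.

Lemma nYC_ge0 (H : YC) : 0 <= nYC H.
Proof. exact (norm_ge_0 H). Qed.

Definition join (P Q : Y) : YC :=
  Pair (l1_RI (pf P) (pf Q)) (l1_RI (pg P) (pg Q)).
Definition ReY (H : YC) : Y := Pair (l1_Re (pf H)) (l1_Re (pg H)).
Definition ImY (H : YC) : Y := Pair (l1_Im (pf H)) (l1_Im (pg H)).

Lemma cplx_join (A : Y -> Y) (H : YC) : cplx A H = join (A (ReY H)) (A (ImY H)).
Proof. reflexivity. Qed.

Lemma join_ReIm (H : YC) : join (ReY H) (ImY H) = H.
Proof. apply pair_eq; apply l1_eq; intros k; symmetry; apply surjective_pairing. Qed.

Lemma ReY_join (P Q : Y) : ReY (join P Q) = P.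
Proof. apply pair_eq; apply l1_eq; reflexivity. Qed.

Lemma ImY_join (P Q : Y) : ImY (join P Q) = Q.
Proof. apply pair_eq; apply l1_eq; reflexivity. Qed.

Lemma join_plus (P Q P' Q' : Y) : join (plus P P') (plus Q Q') = plus (join P Q) (join P' Q').
Proof. apply pair_eq; apply l1_eq; reflexivity. Qed.

Lemma ReY_plus (H K : YC) : ReY (plus H K) = plus (ReY H) (ReY K).
Proof. apply pair_eq; apply l1_eq; reflexivity. Qed.

Lemma ImY_plus (H K : YC) : ImY (plus H K) = plus (ImY H) (ImY K).
Proof. apply pair_eq; apply l1_eq; reflexivity. Qed.

Lemma ReY_scal (z : C) (H : YC) :
  ReY (scal z H) = plus (scal (Re z) (ReY H)) (scal (- Im z) (ImY H)).
Proof.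
apply pair_eq; apply l1_eq; intros k; unfold Re, Im, ReY, ImY.
- change (fst z * fst (pf H k) - snd z * snd (pf H k) = fst z * fst (pf H k) + - snd z * snd (pf H k)); ring.
- change (fst z * fst (pg H k) - snd z * snd (pg H k) = fst z * fst (pg H k) + - snd z * snd (pg H k)); ring.
Qed.

Lemma ImY_scal (z : C) (H : YC) :
  ImY (scal z H) = plus (scal (Re z) (ImY H)) (scal (Im z) (ReY H)).
Proof. apply pair_eq; apply l1_eq; reflexivity. Qed.

Lemma join_scal (z : C) (P Q : Y) : scal z (join P Q) =
  join (plus (scal (Re z) P) (scal (- Im z) Q)) (plus (scal (Re z) Q) (scal (Im z) P)).
Proof. rewrite <- (join_ReIm (scal z _)), ReY_scal, ImY_scal, ReY_join, ImY_join; reflexivity. Qed.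

Lemma nC_RI_le (a b : X) : nC (l1_RI a b) <= nrm a + nrm b.
Proof.
unfold l1_norm; rewrite <- Series_plus by apply l1_summable.
apply Series_le; [|apply ex_series_add; apply l1_summable].
intros k; split; [apply abs_ge_0|].
change (Cmod (a k, b k) <= Rabs (a k) + Rabs (b k)).
replace ((a k, b k) : C) with (RtoC (a k) + Ci * RtoC (b k))%C
  by (apply injective_projections; simpl; ring).
apply Rle_trans with (1 := Cmod_triangle _ _); rewrite Cmod_mult, Cmod_Ci, !Cmod_R; lra.
Qed.

Lemma nC_RI_scal (a b : R) (v : X) : nC (l1_RI (scal a v) (scal b v)) = Cmod (a, b) * nrm v.
Proof.
unfold l1_norm; rewrite <- Series_scal_l; apply Series_ext; intros k.
change (Cmod (a * v k, b * v k) = Cmod (a, b) * Rabs (v k)).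
rewrite <- Cmod_R, <- Cmod_mult; f_equal; apply injective_projections; simpl; ring.
Qed.

Lemma nC_RI_0 (a : X) : nC (l1_RI a zero) = nrm a.
Proof.
unfold l1_norm; apply Series_ext; intros k.
change (Cmod (a k, 0) = Rabs (a k)); apply Cmod_R.
Qed.

Lemma nrm_Re (h : l1 C_AbsRing) : nrm (l1_Re h) <= nC h.
Proof.
apply Series_le; [|apply (l1_summable h)].
intros k; split; [apply abs_ge_0 | exact (Rle_trans _ _ _ (Rmax_l _ _) (Rmax_Cmod (h k)))].
Qed.

Lemma nrm_Im (h : l1 C_AbsRing) : nrm (l1_Im h) <= nC h.
Proof.
apply Series_le; [|apply (l1_summable h)].
intros k; split; [apply abs_ge_0 | exact (Rle_trans _ _ _ (Rmax_r _ _) (Rmax_Cmod (h k)))].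
Qed.

Lemma nYC_join_le (P Q : Y) : nYC (join P Q) <= nrmY P + nrmY Q.
Proof.
assert (H1 := nC_RI_le (pf P) (pf Q)); assert (H2 := nC_RI_le (pg P) (pg Q)).
change (nC (l1_RI (pf P) (pf Q)) + nC (l1_RI (pg P) (pg Q)) <=
  nrm (pf P) + nrm (pg P) + (nrm (pf Q) + nrm (pg Q))); lra.
Qed.

Lemma nYC_join_scal (a b : R) (P : Y) : nYC (join (scal a P) (scal b P)) = Cmod (a, b) * nrmY P.
Proof.
change (nC (l1_RI (scal a (pf P)) (scal b (pf P))) + nC (l1_RI (scal a (pg P)) (scal b (pg P)))
  = Cmod (a, b) * (nrm (pf P) + nrm (pg P))).
rewrite !nC_RI_scal; ring.
Qed.

Lemma nYC_join_0 (P : Y) : nYC (join P zero) = nrmY P.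
Proof.
change (nC (l1_RI (pf P) zero) + nC (l1_RI (pg P) zero) = nrm (pf P) + nrm (pg P)).
now rewrite !nC_RI_0.
Qed.

Lemma nrmY_ReY (H : YC) : nrmY (ReY H) <= nYC H.
Proof. apply Rplus_le_compat; apply nrm_Re. Qed.

(** The norm of the source is a parameter because the record serves maps from [X] and from [Y]. *)
Record blin {V : ModuleSpace R_AbsRing} (n : V -> R) (A : V -> Y) : Prop := Blin {
  blin_plus : forall x y : V, A (plus x y) = plus (A x) (A y);
  blin_scal : forall (c : R) (x : V), A (scal c x) = scal c (A x);
  blin_bdd : exists M, 0 <= M /\ forall x, nrmY (A x) <= M * n x }.

Arguments blin_plus {V n A} _ x y.
Arguments blin_scal {V n A} _ c x.
Arguments blin_bdd {V n A} _.

Notation opX := (blin (V := @l1_ModuleSpace R_AbsRing) nrm).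
Notation opY := (blin (V := @pair_ModuleSpace R_AbsRing) nrmY).

Lemma ctail_summable (h : l1 C_AbsRing) : ex_series (fun k => abs (h (S k))).
Proof. apply (ex_series_incr_1 (V := R_NormedModule) (fun k => abs (h k))), (l1_summable h). Qed.

Definition ctail (h : l1 C_AbsRing) : l1 C_AbsRing := L1 (K := C_AbsRing) _ (ctail_summable h).

Lemma opX_shift (B : X -> Y) : opX B -> opX (fun f => B (xshift f)).
Proof.
intros [a s [M [M0 b]]]; split.
- intros x y; rewrite <- a; f_equal; apply l1_eq; intros [|k]; [|reflexivity].
  symmetry; exact (Rplus_0_l 0).
- intros c x; rewrite <- s; f_equal; apply l1_eq; intros [|k]; [|reflexivity].
  symmetry; exact (Rmult_0_r c).
- exists M; split; [exact M0|]; intros x; rewrite <- (nrm_xshift x); apply b.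
Qed.

Lemma real_decomp (f : X) : f = plus (scal (f 0%nat) x1) (xshift (xtail f)).
Proof.
apply l1_eq; intros [|k].
- change (f 0%nat = f 0%nat * 1 + 0); rewrite Rmult_1_r, Rplus_0_r; reflexivity.
- change (f (S k) = f 0%nat * 0 + f (S k)); rewrite Rmult_0_r, Rplus_0_l; reflexivity.
Qed.

(** The head coefficient [h 0] contributes exactly its modulus times the norm of the first column,
    because it multiplies a real vector; the rest is the shifted operator on the tail. The crude
    factor 2, from separating real and imaginary parts, only meets the tail after [N] steps and
    disappears in the limit. *)
Lemma col_bound_partial (eps M : R) (N : nat) : 0 <= M -> forall (B : X -> Y) (h : l1 C_AbsRing),
  opX B -> (forall f, nrmY (B f) <= M * nrm f) -> (forall k, nrmY (B (xw ^ k)%X) <= eps) ->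
  nYC (join (B (l1_Re h)) (B (l1_Im h)))
  <= eps * rsum (fun k => Cmod (h k)) N
     + 2 * M * Series (fun k => Cmod (h (N + k)%nat)).
Proof.
intros M0; induction N as [|N IH]; intros B h HB HM Hc.
- change (rsum (fun k => Cmod (h k)) 0) with 0.
  change (Series (fun k => Cmod (h (0 + k)%nat))) with (nC h).
  apply Rle_trans with (1 := nYC_join_le _ _).
  assert (H1 := HM (l1_Re h)); assert (H2 := HM (l1_Im h)).
  assert (H3 := nrm_Re h); assert (H4 := nrm_Im h).
  assert (M * nrm (l1_Re h) <= M * nC h) by (apply Rmult_le_compat_l; assumption).
  assert (M * nrm (l1_Im h) <= M * nC h) by (apply Rmult_le_compat_l; assumption).
  lra.
- assert (E : join (B (l1_Re h)) (B (l1_Im h)) =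
    plus (join (scal (Re (h 0%nat)) (B x1)) (scal (Im (h 0%nat)) (B x1)))
     (join (B (xshift (l1_Re (ctail h)))) (B (xshift (l1_Im (ctail h)))))).
  { rewrite <- join_plus, (real_decomp (l1_Re h)), (real_decomp (l1_Im h)) at 1.
    rewrite !(blin_plus HB), !(blin_scal HB); do 3 f_equal; apply l1_eq; intros [|k]; reflexivity. }
  rewrite E; apply Rle_trans with (1 := nYC_triangle _ _).
  rewrite nYC_join_scal, <- surjective_pairing.
  assert (IH' := IH (fun f => B (xshift f)) (ctail h) (opX_shift B HB)
    (fun f => eq_ind _ (fun t => nrmY (B (xshift f)) <= M * t) (HM (xshift f)) _ (nrm_xshift f))
    (fun k => eq_ind _ (fun t => nrmY (B t) <= eps) (Hc (S k)) _ (eq_sym (xshift_mul (xw ^ k)%X)))).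
  assert (S1 : rsum (fun k => Cmod (h k)) (S N) =
     Cmod (h 0%nat) + rsum (fun k => Cmod (ctail h k)) N).
  { apply psum_first. }
  rewrite S1, Rmult_plus_distr_l.
  change (Series (fun k => Cmod (h (S N + k)%nat))) with (Series (fun k => Cmod (ctail h (N + k)%nat))).
  assert (C0 := Cmod_ge_0 (h 0%nat)); assert (H0 := Hc 0%nat); change (xw ^ 0)%X with x1 in H0.
  assert (Cmod (h 0%nat) * nrmY (B x1) <= Cmod (h 0%nat) * eps) by (apply Rmult_le_compat_l; assumption).
  change (fst (h 0%nat), snd (h 0%nat)) with (h 0%nat) in *.
  change (Re (h 0%nat), Im (h 0%nat)) with (fst (h 0%nat), snd (h 0%nat)) in *.
  rewrite <- ?surjective_pairing in *; lra.
Qed.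

Lemma col_bound (eps : R) (B : X -> Y) (h : l1 C_AbsRing) :
  opX B -> (forall k, nrmY (B (xw ^ k)%X) <= eps) ->
  nYC (join (B (l1_Re h)) (B (l1_Im h))) <= eps * nC h.
Proof.
intros HB Hc; destruct (blin_bdd HB) as [M [M0 HM]].
assert (Sh : ex_series (fun k => Cmod (h k))) by exact (l1_summable h).
assert (e0 : 0 <= eps) by (apply Rle_trans with (2 := Hc 0%nat); apply nrmY_ge0).
set (t := nYC (join (B (l1_Re h)) (B (l1_Im h)))).
change (Rbar_le (Finite t) (Finite (eps * nC h))).
apply (is_lim_seq_le (fun _ => t)
  (fun N => eps * nC h + 2 * M * Series (fun k => Cmod (h (N + k)%nat)))).
- intros N; apply Rle_trans with (1 := col_bound_partial eps M N M0 B h HB HM Hc).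
  apply Rplus_le_compat_r, Rmult_le_compat_l; [exact e0|].
  apply psum_le_Series; [intros; apply Cmod_ge_0 | exact Sh].
- apply is_lim_seq_const.
- replace (Finite (eps * nC h)) with (Finite (eps * nC h + 2 * M * 0)) by (f_equal; ring).
  apply is_lim_seq_plus'; [apply is_lim_seq_const|].
  apply (is_lim_seq_scal_l _ (2 * M) 0), (Series_tail_lim _ Sh).
Qed.

Definition e1 (k : nat) : Y := Pair (xw ^ k)%X x0.
Definition e2 (k : nat) : Y := Pair x0 (xw ^ k)%X.

Definition cols_le (A : Y -> Y) (eps : R) : Prop :=
  forall k, nrmY (A (e1 k)) <= eps /\ nrmY (A (e2 k)) <= eps.

Lemma cplx_bound (A : Y -> Y) (eps : R) (H : YC) :
  opY A -> cols_le A eps -> nYC (cplx A H) <= eps * nYC H.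
Proof.
intros [a s [M [M0 b]]] Hc.
assert (P0 : forall x : X, plus x x0 = x) by (intros x; exact (plus_zero_r x)).
assert (P0' : forall x : X, plus x0 x = x) by (intros x; exact (plus_zero_l x)).
assert (S0 : forall c : R, @eq X (scal c x0) x0).
{ intros c; transitivity (cst c * x0)%X; [exact (scal_cst c x0) | ring]. }
assert (O1 : opX (fun f => A (Pair f x0))).
{ split.
  - intros x y; rewrite <- a; f_equal; apply pair_eq; [reflexivity | symmetry; apply P0].
  - intros c x; rewrite <- s; f_equal; apply pair_eq; [reflexivity | symmetry; apply S0].
  - exists M; split; [exact M0|]; intros x; apply Rle_trans with (1 := b _).
    change (M * (nrm x + nrm x0) <= M * nrm x); rewrite nrm_x0, Rplus_0_r; apply Rle_refl. }
assert (O2 : opX (fun g => A (Pair x0 g))).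
{ split.
  - intros x y; rewrite <- a; f_equal; apply pair_eq; [symmetry; apply P0 | reflexivity].
  - intros c x; rewrite <- s; f_equal; apply pair_eq; [symmetry; apply S0 | reflexivity].
  - exists M; split; [exact M0|]; intros x; apply Rle_trans with (1 := b _).
    change (M * (nrm x0 + nrm x) <= M * nrm x); rewrite nrm_x0, Rplus_0_l; apply Rle_refl. }
assert (D : forall F : Y, A F = plus (A (Pair (pf F) x0)) (A (Pair x0 (pg F)))).
{ intros F; rewrite <- a; f_equal; apply pair_eq; [symmetry; apply P0 | symmetry; apply P0']. }
rewrite cplx_join, (D (ReY H)), (D (ImY H)), join_plus.
apply Rle_trans with (1 := nYC_triangle _ _).
change (nYC H) with (nC (pf H) + nC (pg H)); rewrite Rmult_plus_distr_l; apply Rplus_le_compat.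
- exact (col_bound eps _ (pf H) O1 (fun k => proj1 (Hc k))).
- exact (col_bound eps _ (pg H) O2 (fun k => proj2 (Hc k))).
Qed.

Lemma cplx_plus (A : Y -> Y) (H K : YC) : opY A -> cplx A (plus H K) = plus (cplx A H) (cplx A K).
Proof.
intros HA; rewrite !cplx_join, ReY_plus, ImY_plus, !(blin_plus HA); apply join_plus.
Qed.

Lemma cplx_scal (A : Y -> Y) (z : C) (H : YC) : opY A -> cplx A (scal z H) = scal z (cplx A H).
Proof.
intros HA; rewrite !cplx_join, ReY_scal, ImY_scal, !(blin_plus HA), !(blin_scal HA).
symmetry; apply join_scal.
Qed.

Lemma cplx_comp (A B : Y -> Y) (H : YC) : cplx A (cplx B H) = cplx (fun F => A (B F)) H.
Proof. rewrite !cplx_join, ReY_join, ImY_join; reflexivity. Qed.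

Lemma cplx_real (A : Y -> Y) (F : Y) : opY A -> cplx A (join F zero) = join (A F) zero.
Proof.
intros HA; rewrite cplx_join, ReY_join, ImY_join; f_equal.
assert (Z : (zero : Y) = scal 0 zero) by (symmetry; exact (scal_zero_l (V := @pair_ModuleSpace R_AbsRing) zero)).
rewrite Z at 1; rewrite (blin_scal HA); exact (scal_zero_l (V := @pair_ModuleSpace R_AbsRing) (A zero)).
Qed.

(** A real pair keeps its norm under complexification, so the complex bound contains the real
    one. *)
Lemma real_bound (A : Y -> Y) (eps : R) (F : Y) :
  opY A -> cols_le A eps -> nrmY (A F) <= eps * nrmY F.
Proof.
intros HA Hc; rewrite <- (nYC_join_0 (A F)), <- (nYC_join_0 F), <- (cplx_real A F HA).
apply cplx_bound; assumption.
Qed.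

(** * Neumann series *)

Lemma YC_complete (x : nat -> YC) :
  ex_series (fun k => nYC (x k)) ->
  exists v : YC, is_lim_seq (fun m => nYC (minus v (psum x m))) 0.
Proof.
intros Hx.
assert (Ef : ex_series (fun k => nC (pf (x k)))).
{ apply ex_series_dom with (2 := Hx); intros k; rewrite Rabs_pos_eq by apply l1_norm_ge_0.
  assert (P := l1_norm_ge_0 (pg (x k))); change (nYC (x k)) with (nC (pf (x k)) + nC (pg (x k))); lra. }
assert (Eg : ex_series (fun k => nC (pg (x k)))).
{ apply ex_series_dom with (2 := Hx); intros k; rewrite Rabs_pos_eq by apply l1_norm_ge_0.
  assert (P := l1_norm_ge_0 (pf (x k))); change (nYC (x k)) with (nC (pf (x k)) + nC (pg (x k))); lra. }
destruct (family_sum_ex sumC _ complete_sum_C Ef) as [a Ha].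
destruct (family_sum_ex sumC _ complete_sum_C Eg) as [b Hb].
exists (Pair a b).
apply is_lim_seq_squeeze0 with (fun m =>
  Series (fun k => nC (pf (x (m + k)%nat))) + Series (fun k => nC (pg (x (m + k)%nat)))).
- intros m; split; [apply nYC_ge0|].
  assert (E : psum x m = Pair (psum (fun k => pf (x k)) m) (psum (fun k => pg (x k)) m)).
  { induction m as [|m IH]; [reflexivity | simpl; rewrite IH; reflexivity]. }
  rewrite E; exact (Rplus_le_compat _ _ _ _ (Ha m) (Hb m)).
- replace (Finite 0) with (Finite (0 + 0)) by (f_equal; ring).
  apply is_lim_seq_plus'; [exact (Series_tail_lim _ Ef) | exact (Series_tail_lim _ Eg)].
Qed.

Lemma YC_sub_eq (x y : YC) : nYC (minus x y) = 0 -> x = y.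
Proof.
intros H; apply pair_norm_eq_zero in H.
apply (plus_reg_r (opp y)); rewrite plus_opp_r; exact H.
Qed.

Lemma minus_plus_swap {G : AbelianGroup} (a b c e : G) :
  minus (plus a b) (plus c e) = plus (minus a c) (minus b e).
Proof.
unfold minus; rewrite opp_plus, <- !plus_assoc; f_equal.
rewrite !plus_assoc; f_equal; apply plus_comm.
Qed.

Lemma minus_split {G : AbelianGroup} (a b : G) : a = plus (minus a b) b.
Proof. unfold minus; rewrite <- plus_assoc, plus_opp_l, plus_zero_r; reflexivity. Qed.

Lemma minus_minus_plus {G : AbelianGroup} (a b c e : G) :
  minus (minus a (plus b c)) e = minus a (plus b (plus e c)).
Proof.
unfold minus; rewrite !opp_plus, <- !plus_assoc; do 2 f_equal; apply plus_comm.
Qed.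

Lemma YC_split (a b : YC) : a = plus (minus a b) b.
Proof. exact (minus_split (G := @pair_AbelianGroup C_AbsRing) a b). Qed.

Lemma YC_minus_plus (a b c e : YC) : minus (plus a b) (plus c e) = plus (minus a c) (minus b e).
Proof. exact (minus_plus_swap (G := @pair_AbelianGroup C_AbsRing) a b c e). Qed.

(** The partial sums $s_m$ of $\sum E^ky$ satisfy $s_{m+1}=y+Es_m$, and the limit inherits this
    equation because [E] is contracting. *)
Lemma neumann (E : YC -> YC) (q : R) (y : YC) :
  (forall H K, E (plus H K) = plus (E H) (E K)) ->
  (forall H, nYC (E H) <= q * nYC H) -> 0 <= q < 1 ->
  exists v, v = plus y (E v).
Proof.
intros Ep Eb Hq.
set (x := fun k => Nat.iter k E y).
assert (xb : forall k, nYC (x k) <= nYC y * q ^ k).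
{ induction k as [|k IH]; [simpl; lra|].
  change (x (S k)) with (E (x k)); apply Rle_trans with (1 := Eb _); simpl.
  replace (nYC y * (q * q ^ k)) with (q * (nYC y * q ^ k)) by ring.
  apply Rmult_le_compat_l; [lra | exact IH]. }
assert (Hx : ex_series (fun k => nYC (x k))).
{ apply ex_series_dom with (fun k => nYC y * q ^ k).
  - intros k; rewrite Rabs_pos_eq by apply nYC_ge0; apply xb.
  - apply ex_series_mult_l, ex_series_geom; rewrite Rabs_pos_eq; lra. }
destruct (YC_complete x Hx) as [v Hv]; exists v; apply YC_sub_eq.
assert (Ps : forall m, psum x (S m) = plus y (E (psum x m))).
{ assert (E0 : E zero = zero).
  { apply (plus_reg_r (E zero)); rewrite <- Ep, !plus_zero_l; reflexivity. }
  induction m as [|m IH].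
  - change (plus zero y = plus y (E zero)); rewrite E0; apply plus_comm.
  - change (plus (psum x (S m)) (E (x m)) = plus y (E (plus (psum x m) (x m)))).
    rewrite Ep, plus_assoc, <- IH; reflexivity. }
apply Rle_antisym; [|apply nYC_ge0].
change (Rbar_le (nYC (minus v (plus y (E v)))) 0).
apply (is_lim_seq_le (fun _ => nYC (minus v (plus y (E v))))
  (fun m => nYC (minus v (psum x (S m))) + q * nYC (minus v (psum x m)))).
- intros m.
  assert (Ev : E v = plus (E (minus v (psum x m))) (E (psum x m))).
  { rewrite <- Ep; f_equal; apply YC_split. }
  rewrite Ev; replace (minus v (plus y (plus (E (minus v (psum x m))) (E (psum x m)))))
    with (minus (minus v (psum x (S m))) (E (minus v (psum x m)))).
  + apply Rle_trans with (1 := nYC_minus _ _), Rplus_le_compat_l, Eb.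
  + rewrite Ps; exact (minus_minus_plus (G := @pair_AbelianGroup C_AbsRing) v y (E (psum x m)) _).
- apply is_lim_seq_const.
- replace (Finite 0) with (Finite (0 + q * 0)) by (f_equal; ring).
  apply is_lim_seq_plus'.
  + apply (is_lim_seq_incr_1 (fun m => nYC (minus v (psum x m)))), Hv.
  + apply (is_lim_seq_scal_l _ q 0), Hv.
Qed.

(** The left defect bounds [A] from below, which gives injectivity and the norm of the inverse; the
    right defect gives surjectivity through [neumann]. *)
Lemma approximate_inverse (A B : YC -> YC) (q K : R) :
  (forall x y, A (plus x y) = plus (A x) (A y)) ->
  (forall c x, A (scal c x) = scal c (A x)) ->
  (forall x y, B (plus x y) = plus (B x) (B y)) ->
  (forall x, nYC (B x) <= K * nYC x) ->
  (forall x, nYC (minus x (B (A x))) <= q * nYC x) ->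
  (forall x, nYC (minus x (A (B x))) <= q * nYC x) ->
  0 <= q < 1 -> 0 <= K ->
  exists J : YC -> YC, is_inverse A J /\ forall y, nYC (J y) <= K / (1 - q) * nYC y.
Proof.
intros Ap As Bp Bb L Rr Hq HK.
assert (Am : forall x y, A (minus x y) = minus (A x) (A y)).
{ intros x y; apply (plus_reg_r (A y)); rewrite <- Ap, <- !YC_split; reflexivity. }
assert (lower : forall x, nYC x <= K / (1 - q) * nYC (A x)).
{ intros x; assert (H := L x); assert (H' := Bb (A x)).
  assert (T : nYC x <= nYC (minus x (B (A x))) + nYC (B (A x))).
  { rewrite (YC_split x (B (A x))) at 1; apply nYC_triangle. }
  apply Rmult_le_reg_l with (1 - q); [lra|].
  replace ((1 - q) * (K / (1 - q) * nYC (A x))) with (K * nYC (A x)) by (field; lra); lra. }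
assert (inj : forall x y, A x = A y -> x = y).
{ intros x y E; apply YC_sub_eq, Rle_antisym; [|apply nYC_ge0].
  apply Rle_trans with (1 := lower _); rewrite Am, E, (minus_eq_zero (A y)).
  apply Req_le; transitivity (K / (1 - q) * 0); [f_equal | ring].
  exact (norm_zero (V := @pair_NormedModule C_AbsRing)). }
assert (surj : forall y, exists x, A x = y).
{ intros y.
  destruct (neumann (fun v => minus v (A (B v))) q y) as [v Hv]; [| exact Rr | exact Hq |].
  - intros H J; rewrite Bp, Ap; apply YC_minus_plus.
  (* Since $v=y+(v-ABv)$, the point [B v] is a preimage of [y]. *)
  - exists (B v); apply (plus_reg_l (minus v (A (B v)))); rewrite <- YC_split.
    rewrite Hv at 1; apply plus_comm. }
set (J := fun y => proj1_sig (constructive_indefinite_description _ (surj y))).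
assert (AJ : forall y, A (J y) = y).
{ intros y; exact (proj2_sig (constructive_indefinite_description _ (surj y))). }
assert (Jb : forall y, nYC (J y) <= K / (1 - q) * nYC y).
{ intros y; rewrite <- (AJ y) at 2; apply lower. }
assert (KQ : 0 <= K / (1 - q)) by (apply Rdiv_le_0_compat; lra).
exists J; split; [|exact Jb]; repeat split.
- intros x y; apply inj; rewrite Ap, !AJ; reflexivity.
- intros c x; apply inj; rewrite As, !AJ; reflexivity.
- exists (K / (1 - q) + 1); split; [lra|]; intros x.
  assert (P := nYC_ge0 x); apply Rle_trans with (1 := Jb x).
  change (norm x) with (nYC x); lra.
- intros x; apply inj, AJ.
- exact AJ.
Qed.

Lemma inv_op_unique {K : AbsRing} {V W : NormedModule K} (A : V -> W) (J : W -> V) :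
  is_inverse A J -> forall y, inv_op A y = J y.
Proof.
intros HJ y; assert (H2 := proj2 (proj2 HJ)).
assert (E : is_inverse A (inv_op A)).
{ apply (epsilon_spec (inhabits (fun _ : W => zero)) (is_inverse A)); exists J; exact HJ. }
destruct E as [_ [E1 E2]]; rewrite <- (E1 (J y)), H2; reflexivity.
Qed.

(** * Finite-rank operators with integer data *)

Definition vecz : Type := (list Z * list Z)%type.
Definition vec (c : vecz) : Y := Pair (pz (fst c)) (pz (snd c)).
Definition vadd (a b : vecz) : vecz := (padd (fst a) (fst b), padd (snd a) (snd b)).
Definition vsc (x : Z) (a : vecz) : vecz := (psc x (fst a), psc x (snd a)).
Definition nzY (a : vecz) : Z := (nz (fst a) + nz (snd a))%Z.

(** The columns consume the coefficients of [f] through the backward shift, so that linearity and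
    bounds follow by induction on the list; [gapp_coef] recovers the sums over indices when the
    matrix product is met. *)
Fixpoint gapp (cols : list vecz) (f : X) : Y :=
  match cols with
  | [] => zero
  | c :: t => plus (scal (f 0%nat) (vec c)) (gapp t (xtail f))
  end.

Fixpoint zgapp (cols : list vecz) (l : list Z) : vecz :=
  match cols, l with
  | c :: t, x :: l' => vadd (vsc x c) (zgapp t l')
  | _, _ => ([], [])
  end.

Fixpoint lf (a : list Z) (f : X) : R :=
  match a with [] => 0 | c :: t => IZR c * f 0%nat + lf t (xtail f) end.

Fixpoint zdot (a b : list Z) : Z :=
  match a, b with
  | x :: a', y :: b' => (x * y + zdot a' b')%Z
  | _, _ => 0%Z
  end.

Definition scale20 : Z := 1048576%Z.

Definition gam (F : Y) : Y :=
  scal (/ IZR scale20) (plus (gapp gam_f (pf F)) (gapp gam_g (pg F))).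
Definition zgam (c : vecz) : vecz := vadd (zgapp gam_f (fst c)) (zgapp gam_g (snd c)).

Definition eig : Type := (Z * vecz * vecz)%type.
Definition lfY (a : vecz) (F : Y) : R := lf (fst a) (pf F) + lf (snd a) (pg F).
Definition zdotY (a b : vecz) : Z := (zdot (fst a) (fst b) + zdot (snd a) (snd b))%Z.

(** The spectral projection [r l] of an eigenvalue with eigenvectors [r] and [l]. *)
Definition proj (e : eig) (F : Y) : Y :=
  scal (/ IZR (scale20 * scale20)) (scal (lfY (snd e) F) (vec (snd (fst e)))).
Definition zproj (e : eig) (c : vecz) : vecz := vsc (zdotY (snd e) c) (snd (fst e)).

Lemma pf_plus (F G : Y) : pf (plus F G) = (pf F + pf G)%X. Proof. reflexivity. Qed.
Lemma pg_plus (F G : Y) : pg (plus F G) = (pg F + pg G)%X. Proof. reflexivity. Qed.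
Lemma pf_minus (F G : Y) : pf (minus F G) = (pf F - pf G)%X. Proof. reflexivity. Qed.
Lemma pg_minus (F G : Y) : pg (minus F G) = (pg F - pg G)%X. Proof. reflexivity. Qed.
Lemma pf_zero : pf (zero : Y) = x0. Proof. reflexivity. Qed.
Lemma pg_zero : pg (zero : Y) = x0. Proof. reflexivity. Qed.

(** An identity in [Y] splits into two identities in the ring [X], with the scalars turned into
    constant functions. *)
Ltac yring :=
  apply pair_eq; rewrite ?pf_plus, ?pf_minus, ?pf_scal, ?pg_plus, ?pg_minus, ?pg_scal, ?pf_zero, ?pg_zero;
  rewrite ?pf_plus, ?pf_minus, ?pf_scal, ?pg_plus, ?pg_minus, ?pg_scal, ?pf_zero, ?pg_zero;
  rewrite ?cst_add, ?cst_mul, ?cst_opp, ?cst_sub, ?cst_0; try ring.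

Lemma vec_add (a b : vecz) : vec (vadd a b) = plus (vec a) (vec b).
Proof. apply pair_eq; apply pz_add. Qed.

Lemma vec_sc (x : Z) (a : vecz) : vec (vsc x a) = scal (IZR x) (vec a).
Proof. apply pair_eq; [rewrite pf_scal | rewrite pg_scal]; apply pz_sc. Qed.

Lemma nrmY_vec (a : vecz) : nrmY (vec a) <= IZR (nzY a).
Proof. unfold nzY; rewrite plus_IZR; apply Rplus_le_compat; apply nrm_pz. Qed.

Lemma nrmY_plus (F G : Y) : nrmY (plus F G) <= nrmY F + nrmY G.
Proof. apply pair_norm_triangle. Qed.

Lemma nrmY_scal (c : R) (F : Y) : nrmY (scal c F) = Rabs c * nrmY F.
Proof.
change (nrm (pf (scal c F)) + nrm (pg (scal c F)) = Rabs c * (nrm (pf F) + nrm (pg F))).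
rewrite pf_scal, pg_scal, !nrm_cst_mul; ring.
Qed.

Lemma pz_head (x : Z) (l : list Z) : pz (x :: l) 0%nat = IZR x.
Proof. cbn [pz]; rewrite <- xshift_mul; apply Rplus_0_r. Qed.

Lemma gapp_pz (cols : list vecz) (l : list Z) : gapp cols (pz l) = vec (zgapp cols l).
Proof.
revert l; induction cols as [|c t IH]; intros l; [reflexivity|].
cbn [gapp]; rewrite <- pz_tail, IH; destruct l as [|x l]; cbn [tl zgapp].
- change (pz [] 0%nat) with 0.
  destruct t; cbn [zgapp]; change (vec ([], [])) with (zero : Y); yring.
- rewrite vec_add, vec_sc, pz_head; reflexivity.
Qed.

Lemma lf_pz (a l : list Z) : lf a (pz l) = IZR (zdot a l).
Proof.
revert l; induction a as [|c t IH]; intros l; [reflexivity|].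
cbn [lf]; rewrite <- pz_tail, IH; destruct l as [|x l]; cbn [tl zdot].
- change (pz [] 0%nat) with 0; destruct t; cbn [zdot]; ring.
- rewrite pz_head, plus_IZR, mult_IZR; reflexivity.
Qed.

Lemma gapp_plus (cols : list vecz) (f g : X) :
  gapp cols (f + g)%X = plus (gapp cols f) (gapp cols g).
Proof.
revert f g; induction cols as [|c t IH]; intros f g; cbn [gapp].
- yring.
- rewrite xtail_add, IH, xadd_coef; yring.
Qed.

Lemma gapp_scal (cols : list vecz) (c : R) (f : X) :
  gapp cols (cst c * f)%X = scal c (gapp cols f).
Proof.
revert f; induction cols as [|v t IH]; intros f; cbn [gapp].
- yring.
- rewrite xtail_mul_cst, IH, <- scal_cst; change (scal c f 0%nat) with (c * f 0%nat); yring.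
Qed.

Lemma gapp_bdd (cols : list vecz) : exists M, 0 <= M /\ forall f, nrmY (gapp cols f) <= M * nrm f.
Proof.
induction cols as [|v t [M [M0 IH]]]; cbn [gapp].
- exists 0; split; [lra|]; intros f; rewrite Rmult_0_l.
  apply Req_le; exact (norm_zero (V := @pair_NormedModule R_AbsRing)).
- exists (nrmY (vec v) + M); split; [assert (P := nrmY_ge0 (vec v)); lra|]; intros f.
  apply Rle_trans with (1 := nrmY_plus _ _); rewrite Rmult_plus_distr_r; apply Rplus_le_compat.
  + rewrite nrmY_scal, Rmult_comm; apply Rmult_le_compat_l; [apply nrmY_ge0|].
    exact (l1_abs_coef_le f 0).
  + apply Rle_trans with (1 := IH _), Rmult_le_compat_l; [exact M0 | apply nrm_xtail].
Qed.

Lemma lf_plus (a : list Z) (f g : X) : lf a (f + g)%X = lf a f + lf a g.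
Proof.
revert f g; induction a as [|c t IH]; intros f g; cbn [lf]; [ring|].
rewrite xtail_add, IH, xadd_coef; ring.
Qed.

Lemma lf_scal (a : list Z) (c : R) (f : X) : lf a (cst c * f)%X = c * lf a f.
Proof.
revert f; induction a as [|v t IH]; intros f; cbn [lf]; [ring|].
rewrite xtail_mul_cst, IH, <- scal_cst; change (scal c f 0%nat) with (c * f 0%nat); ring.
Qed.

Lemma lf_bdd (a : list Z) : exists M, 0 <= M /\ forall f, Rabs (lf a f) <= M * nrm f.
Proof.
induction a as [|v t [M [M0 IH]]]; cbn [lf].
- exists 0; split; [lra|]; intros f; rewrite Rabs_R0; lra.
- exists (Rabs (IZR v) + M); split; [assert (P := Rabs_pos (IZR v)); lra|]; intros f.
  apply Rle_trans with (1 := Rabs_triang _ _); rewrite Rmult_plus_distr_r; apply Rplus_le_compat.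
  + rewrite Rabs_mult; apply Rmult_le_compat_l; [apply Rabs_pos | exact (l1_abs_coef_le f 0)].
  + apply Rle_trans with (1 := IH _), Rmult_le_compat_l; [exact M0 | apply nrm_xtail].
Qed.

Lemma opY_gam : opY gam.
Proof.
split.
- intros F G; unfold gam; rewrite pf_plus, pg_plus, !gapp_plus; yring.
- intros c F; unfold gam; rewrite pf_scal, pg_scal, !gapp_scal; yring.
- destruct (gapp_bdd gam_f) as [M [M0 HM]]; destruct (gapp_bdd gam_g) as [N [N0 HN]].
  exists (Rabs (/ IZR scale20) * (M + N)); split.
  + apply Rmult_le_pos; [apply Rabs_pos | lra].
  + intros F; unfold gam; rewrite nrmY_scal, Rmult_assoc.
    apply Rmult_le_compat_l; [apply Rabs_pos|]; apply Rle_trans with (1 := nrmY_plus _ _).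
    assert (H1 := HM (pf F)); assert (H2 := HN (pg F)).
    assert (P1 := nrm_ge0 (pf F)); assert (P2 := nrm_ge0 (pg F)).
    change (nrmY F) with (nrm (pf F) + nrm (pg F)); nra.
Qed.

Lemma opY_proj (e : eig) : opY (proj e).
Proof.
split.
- intros F G; unfold proj, lfY; rewrite pf_plus, pg_plus, !lf_plus; yring.
- intros c F; unfold proj, lfY; rewrite pf_scal, pg_scal, !lf_scal; yring.
- destruct (lf_bdd (fst (snd e))) as [M [M0 HM]]; destruct (lf_bdd (snd (snd e))) as [N [N0 HN]].
  set (r := nrmY (vec (snd (fst e)))).
  assert (r0 : 0 <= r) by apply nrmY_ge0.
  exists (Rabs (/ IZR (scale20 * scale20)) * ((M + N) * r)); split.
  + apply Rmult_le_pos; [apply Rabs_pos | apply Rmult_le_pos; lra].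
  + intros F; unfold proj; rewrite !nrmY_scal, Rmult_assoc.
    apply Rmult_le_compat_l; [apply Rabs_pos|].
    replace ((M + N) * r * nrmY F) with (((M + N) * nrmY F) * r) by ring.
    apply Rmult_le_compat_r; [exact r0|].
    unfold lfY; apply Rle_trans with (1 := Rabs_triang _ _).
    assert (H1 := HM (pf F)); assert (H2 := HN (pg F)).
    assert (P1 := nrm_ge0 (pf F)); assert (P2 := nrm_ge0 (pg F)).
    change (nrmY F) with (nrm (pf F) + nrm (pg F)); nra.
Qed.

Lemma opY_id : opY (fun F => F).
Proof.
split; [reflexivity | reflexivity | exists 1; split; [lra|]; intros; lra].
Qed.

Lemma opY_comp (A B : Y -> Y) : opY A -> opY B -> opY (fun F => A (B F)).
Proof.
intros [a s [M [M0 b]]] [a' s' [M' [M0' b']]]; split.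
- intros; rewrite a', a; reflexivity.
- intros; rewrite s', s; reflexivity.
- exists (M * M'); split; [apply Rmult_le_pos; assumption|]; intros x.
  apply Rle_trans with (1 := b _); rewrite Rmult_assoc; apply Rmult_le_compat_l; auto.
Qed.

Lemma nrmY_minus (F G : Y) : nrmY (minus F G) <= nrmY F + nrmY G.
Proof. rewrite <- (norm_opp G : nrmY (opp G) = nrmY G); apply nrmY_plus. Qed.

Lemma opY_minus (A B : Y -> Y) : opY A -> opY B -> opY (fun F => minus (A F) (B F)).
Proof.
intros [a s [M [M0 b]]] [a' s' [M' [M0' b']]]; split.
- intros; rewrite a', a; yring.
- intros; rewrite s', s; yring.
- exists (M + M'); split; [lra|]; intros x.
  apply Rle_trans with (1 := nrmY_minus _ _); rewrite Rmult_plus_distr_r.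
  apply Rplus_le_compat; auto.
Qed.

Lemma opY_scal (r : R) (A : Y -> Y) : opY A -> opY (fun F => scal r (A F)).
Proof.
intros [a s [M [M0 b]]]; split.
- intros; rewrite a; yring.
- intros; rewrite s; yring.
- exists (Rabs r * M); split; [apply Rmult_le_pos; [apply Rabs_pos | exact M0]|]; intros x.
  rewrite nrmY_scal, Rmult_assoc; apply Rmult_le_compat_l; [apply Rabs_pos | apply b].
Qed.

(** * Exact integer representation of rational operators *)

(** [S] is a common denominator: on integer vectors the operator is computed exactly by [z], so that
    its column norms can be compared by evaluation in the integers. *)
Definition rep (A : Y -> Y) (z : vecz -> vecz) (S : Z) : Prop :=
  (0 < S)%Z /\ forall c, scal (IZR S) (A (vec c)) = vec (z c).

Lemma scal_inv_r (r : R) (F : Y) : r <> 0 -> scal r (scal (/ r) F) = F.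
Proof.
intros H; apply pair_eq; rewrite ?pf_scal, ?pg_scal.
- transitivity (cst r * cst (/ r) * pf F)%X; [ring|]; rewrite <- cst_mul, Rinv_r by exact H; change (cst 1) with x1; ring.
- transitivity (cst r * cst (/ r) * pg F)%X; [ring|]; rewrite <- cst_mul, Rinv_r by exact H; change (cst 1) with x1; ring.
Qed.

Lemma rep_gam : rep gam zgam scale20.
Proof.
split; [reflexivity|]; intros c; unfold gam, zgam.
rewrite scal_inv_r by (apply not_0_IZR; discriminate).
rewrite vec_add; unfold vec; cbn [pf pg]; rewrite !gapp_pz; reflexivity.
Qed.

Lemma rep_proj (e : eig) : rep (proj e) (zproj e) (scale20 * scale20).
Proof.
split; [reflexivity|]; intros c; unfold proj, zproj.
rewrite scal_inv_r by (apply not_0_IZR; discriminate).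
rewrite vec_sc; f_equal; unfold lfY, zdotY; rewrite plus_IZR, <- !lf_pz; reflexivity.
Qed.

Lemma rep_comp (A B : Y -> Y) (z y : vecz -> vecz) (S S' : Z) :
  opY A -> rep A z S -> rep B y S' -> rep (fun F => A (B F)) (fun c => z (y c)) (S * S').
Proof.
intros HA [P R] [P' R']; split; [apply Z.mul_pos_pos; assumption|]; intros c.
rewrite <- R, <- R', (blin_scal HA), mult_IZR; yring.
Qed.

Lemma rep_scal (A : Y -> Y) (z : vecz -> vecz) (S m k : Z) : (0 < k)%Z ->
  rep A z S -> rep (fun F => scal (IZR m / IZR k) (A F)) (fun c => vsc m (z c)) (k * S).
Proof.
intros K [P R]; split; [apply Z.mul_pos_pos; assumption|]; intros c.
rewrite vec_sc, <- R, mult_IZR; unfold Rdiv; assert (N : IZR k <> 0) by (apply not_0_IZR; lia).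
apply pair_eq; rewrite ?pf_scal, ?pg_scal, ?cst_mul.
- transitivity (cst (IZR k) * cst (/ IZR k) * (cst (IZR S) * (cst (IZR m) * pf (A (vec c)))))%X; [ring|].
  rewrite <- cst_mul, Rinv_r by exact N; change (cst 1) with x1; ring.
- transitivity (cst (IZR k) * cst (/ IZR k) * (cst (IZR S) * (cst (IZR m) * pg (A (vec c)))))%X; [ring|].
  rewrite <- cst_mul, Rinv_r by exact N; change (cst 1) with x1; ring.
Qed.

Definition unitl (k : nat) : list Z := repeat 0%Z k ++ [1%Z].

Lemma pz_unitl (k : nat) : pz (unitl k) = (xw ^ k)%X.
Proof.
induction k as [|k IH].
- change ((x1 + xw * x0)%X = x1); ring.
- change ((cst 0 + xw * pz (unitl k))%X = (xw * xw ^ k)%X); rewrite IH, cst_0; ring.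
Qed.

Lemma e1_vec (k : nat) : e1 k = vec (unitl k, []).
Proof. unfold e1, vec; cbn [fst snd]; rewrite pz_unitl; reflexivity. Qed.

Lemma e2_vec (k : nat) : e2 k = vec ([], unitl k).
Proof. unfold e2, vec; cbn [fst snd]; rewrite pz_unitl; reflexivity. Qed.

(** The bound is [m / 1000]. *)
Definition check_cols (z : vecz -> vecz) (S m : Z) : bool :=
  forallb (fun k => (1000 * nzY (z (unitl k, [])) <=? m * S)%Z
    && (1000 * nzY (z ([], unitl k)) <=? m * S)%Z) (seq 0 13).

Lemma rep_cols_le (A : Y -> Y) (z : vecz -> vecz) (S m : Z) :
  rep A z S -> check_cols z S m = true ->
  (forall k, (13 <= k)%nat -> nrmY (A (e1 k)) <= IZR m / 1000 /\ nrmY (A (e2 k)) <= IZR m / 1000) ->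
  cols_le A (IZR m / 1000).
Proof.
intros [P R] C Hh k; destruct (le_lt_dec 13 k) as [L|L]; [apply Hh, L|].
unfold check_cols in C; rewrite forallb_forall in C.
assert (I : In k (seq 0 13)) by (apply in_seq; lia).
specialize (C k I); apply andb_true_iff in C; destruct C as [C1 C2].
apply Z.leb_le, IZR_le in C1, C2.
assert (PS : 0 < IZR S) by (apply IZR_lt, P).
assert (Q : forall c, 1000 * IZR (nzY (z c)) <= IZR m * IZR S -> nrmY (A (vec c)) <= IZR m / 1000).
{ intros c Hc; apply Rmult_le_reg_l with (1 := PS).
  rewrite <- (Rabs_pos_eq (IZR S)) at 1 by lra; rewrite <- nrmY_scal, R.
  apply Rle_trans with (1 := nrmY_vec _); lra. }
rewrite e1_vec, e2_vec; rewrite !mult_IZR in C1, C2; split; apply Q; assumption.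
Qed.

Definition high0 (A : Y -> Y) : Prop :=
  forall k, (13 <= k)%nat -> A (e1 k) = zero /\ A (e2 k) = zero.

Lemma high0_cols (A : Y -> Y) (z : vecz -> vecz) (S m : Z) :
  high0 A -> rep A z S -> (0 <= m)%Z -> check_cols z S m = true -> cols_le A (IZR m / 1000).
Proof.
intros H R M C; apply (rep_cols_le A z S m R C); intros k L.
destruct (H k L) as [E1 E2]; rewrite E1, E2.
assert (Z0 : nrmY zero = 0) by (exact (norm_zero (V := @pair_NormedModule R_AbsRing))).
rewrite Z0; apply IZR_le in M; split; lra.
Qed.

Lemma opY_zero (A : Y -> Y) : opY A -> A zero = zero.
Proof.
intros HA; apply (plus_reg_r (A zero)).
rewrite <- (blin_plus HA); etransitivity; [|symmetry; apply plus_zero_l].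
f_equal; apply plus_zero_l.
Qed.

Lemma xpow_head (k : nat) : (xw ^ S k)%X 0%nat = 0.
Proof. change (xw ^ S k)%X with (xw * xw ^ k)%X; rewrite <- xshift_mul; reflexivity. Qed.

Lemma xpow_tail (k : nat) : xtail (xw ^ S k)%X = (xw ^ k)%X.
Proof. change (xw ^ S k)%X with (xw * xw ^ k)%X; rewrite <- xshift_mul; apply xtail_xshift. Qed.

Lemma xtail_x0 : xtail x0 = x0.
Proof. apply l1_eq; reflexivity. Qed.

Lemma gapp_x0 (cols : list vecz) : gapp cols x0 = zero.
Proof.
induction cols as [|c t IH]; [reflexivity|]; cbn [gapp]; rewrite xtail_x0, IH.
change (x0 0%nat) with 0; yring.
Qed.

Lemma lf_x0 (a : list Z) : lf a x0 = 0.
Proof.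
induction a as [|c t IH]; [reflexivity|]; cbn [lf]; rewrite xtail_x0, IH.
change (x0 0%nat) with 0; ring.
Qed.

Lemma gapp_high (cols : list vecz) (k : nat) : (length cols <= k)%nat -> gapp cols (xw ^ k)%X = zero.
Proof.
revert k; induction cols as [|c t IH]; intros k L; [reflexivity|].
destruct k as [|k]; cbn [length] in L; [lia|].
cbn [gapp]; rewrite xpow_head, xpow_tail, IH by lia; yring.
Qed.

Lemma lf_high (a : list Z) (k : nat) : (length a <= k)%nat -> lf a (xw ^ k)%X = 0.
Proof.
revert k; induction a as [|c t IH]; intros k L; [reflexivity|].
destruct k as [|k]; cbn [length] in L; [lia|].
cbn [lf]; rewrite xpow_head, xpow_tail, IH by lia; ring.
Qed.

Lemma high0_gam : high0 gam.
Proof.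
intros k L; unfold gam, e1, e2; cbn [pf pg].
rewrite !gapp_x0, !gapp_high by exact L; split; yring.
Qed.

Lemma high0_proj (e : eig) :
  (length (fst (snd e)) <= 13)%nat -> (length (snd (snd e)) <= 13)%nat -> high0 (proj e).
Proof.
intros L1 L2 k L; unfold proj, lfY, e1, e2; cbn [pf pg].
rewrite !lf_x0, !lf_high by lia; split; yring.
Qed.

Lemma high0_comp (A B : Y -> Y) : opY A -> high0 B -> high0 (fun F => A (B F)).
Proof.
intros HA H k L; destruct (H k L) as [E1 E2]; rewrite E1, E2; split; apply opY_zero, HA.
Qed.

Lemma high0_minus (A B : Y -> Y) : high0 A -> high0 B -> high0 (fun F => minus (A F) (B F)).
Proof.
intros H H' k L; destruct (H k L) as [E1 E2]; destruct (H' k L) as [E3 E4].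
rewrite E1, E2, E3, E4; split; yring.
Qed.

Lemma high0_scal (r : R) (A : Y -> Y) : high0 A -> high0 (fun F => scal r (A F)).
Proof. intros H k L; destruct (H k L) as [E1 E2]; rewrite E1, E2; split; yring. Qed.

Lemma opY_sum (A B : Y -> Y) : opY A -> opY B -> opY (fun F => plus (A F) (B F)).
Proof.
intros [a s [M [M0 b]]] [a' s' [M' [M0' b']]]; split.
- intros; rewrite a', a; yring.
- intros; rewrite s', s; yring.
- exists (M + M'); split; [lra|]; intros x.
  apply Rle_trans with (1 := nrmY_plus _ _); rewrite Rmult_plus_distr_r.
  apply Rplus_le_compat; auto.
Qed.

Lemma rep_sum (A B : Y -> Y) (z y : vecz -> vecz) (S : Z) :
  rep A z S -> rep B y S -> rep (fun F => plus (A F) (B F)) (fun c => vadd (z c) (y c)) S.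
Proof.
intros [P R] [P' R']; split; [exact P|]; intros c.
rewrite vec_add, <- R, <- R'; yring.
Qed.

Lemma rep_diff (A B : Y -> Y) (z y : vecz -> vecz) (S : Z) :
  rep A z S -> rep B y S ->
  rep (fun F => minus (A F) (B F)) (fun c => vadd (z c) (vsc (-1) (y c))) S.
Proof.
intros [P R] [P' R']; split; [exact P|]; intros c.
rewrite vec_add, vec_sc, <- R, <- R'; yring;
change (IZR (-1)) with (- (1)); rewrite cst_opp; change (cst 1) with x1; ring.
Qed.

(** * The resolvent of [Gamma] on the unit circle *)

Definition mu (e : eig) : R := IZR (fst (fst e)) / IZR scale20.
Definition P_sum (F : Y) : Y := plus (plus (proj eig1 F) (proj eig2 F)) (proj eig3 F).
Definition C0 (F : Y) : Y := minus F (P_sum F).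
(** The certified bound of [GC] is 1.57, those of [GGC] and [GCG] are 0.166 and 0.165. Truncating
    the expansion on the complement after one term would leave 1.57 as defect bound; two terms bring
    it well below 1. *)
Definition GC (F : Y) : Y := gam (C0 F).
Definition GGC (F : Y) : Y := gam (GC F).
Definition GCG (F : Y) : Y := GC (gam F).
(** [comm], [defr] and [defl] vanish for exact spectral projections; here they measure the rounding
    of the eigenvalues and eigenvectors. *)
Definition comm (F : Y) : Y := minus (GC F) (C0 (gam F)).
Definition defr (e : eig) (F : Y) : Y := minus (gam (proj e F)) (scal (mu e) (proj e F)).
Definition defl (e : eig) (F : Y) : Y := minus (proj e (gam F)) (scal (mu e) (proj e F)).

Definition zP_sum (c : vecz) : vecz := vadd (vadd (zproj eig1 c) (zproj eig2 c)) (zproj eig3 c).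
Definition zC0 (c : vecz) : vecz := vadd (vsc (scale20 * scale20) c) (vsc (-1) (zP_sum c)).
Definition zGC (c : vecz) : vecz := zgam (zC0 c).
Definition zcomm (c : vecz) : vecz := vadd (zGC c) (vsc (-1) (zC0 (zgam c))).
Definition zdefr (e : eig) (c : vecz) : vecz :=
  vadd (zgam (zproj e c)) (vsc (-1) (vsc (fst (fst e)) (zproj e c))).
Definition zdefl (e : eig) (c : vecz) : vecz :=
  vadd (zproj e (zgam c)) (vsc (-1) (vsc (fst (fst e)) (zproj e c))).

Lemma opY_C0 : opY C0.
Proof. apply opY_minus; [apply opY_id|].
apply (opY_sum (fun F => plus (proj eig1 F) (proj eig2 F)) (proj eig3)); [|apply opY_proj].
apply opY_sum; apply opY_proj. Qed.

Lemma opY_GC : opY GC.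
Proof. apply (opY_comp gam C0); [apply opY_gam | apply opY_C0]. Qed.

Lemma opY_GGC : opY GGC.
Proof. apply (opY_comp gam GC); [apply opY_gam | apply opY_GC]. Qed.

Lemma opY_GCG : opY GCG.
Proof. apply (opY_comp GC gam); [apply opY_GC | apply opY_gam]. Qed.

Lemma opY_comm : opY comm.
Proof. apply opY_minus; [apply opY_GC | apply opY_comp; [apply opY_C0 | apply opY_gam]]. Qed.

Lemma opY_defr (e : eig) : opY (defr e).
Proof.
apply opY_minus; [apply opY_comp; [apply opY_gam | apply opY_proj] | apply opY_scal, opY_proj].
Qed.

Lemma opY_defl (e : eig) : opY (defl e).
Proof.
apply opY_minus; [apply opY_comp; [apply opY_proj | apply opY_gam] | apply opY_scal, opY_proj].
Qed.

Lemma rep_C0 : rep C0 zC0 (scale20 * scale20).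
Proof.
assert (R : rep P_sum zP_sum (scale20 * scale20)).
{ exact (rep_sum _ _ _ _ _ (rep_sum _ _ _ _ _ (rep_proj eig1) (rep_proj eig2)) (rep_proj eig3)). }
destruct R as [P R]; split; [exact P|]; intros c; unfold zC0.
rewrite vec_add, !vec_sc, <- R; unfold C0; yring;
change (IZR (-1)) with (- (1)); rewrite cst_opp; change (cst 1) with x1; ring.
Qed.

Lemma rep_GC : rep GC zGC (scale20 * (scale20 * scale20)).
Proof. exact (rep_comp gam C0 _ _ _ _ opY_gam rep_gam rep_C0). Qed.

Lemma rep_GGC : rep GGC (fun c => zgam (zGC c)) (scale20 * (scale20 * (scale20 * scale20))).
Proof. exact (rep_comp gam GC _ _ _ _ opY_gam rep_gam rep_GC). Qed.

Lemma rep_GCG : rep GCG (fun c => zGC (zgam c)) (scale20 * (scale20 * scale20) * scale20).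
Proof. exact (rep_comp GC gam _ _ _ _ opY_GC rep_GC rep_gam). Qed.

Lemma rep_comm : rep comm zcomm (scale20 * (scale20 * scale20)).
Proof.
apply (rep_diff GC (fun F => C0 (gam F))); [exact rep_GC|].
exact (rep_comp C0 gam _ _ _ _ opY_C0 rep_C0 rep_gam).
Qed.

Lemma rep_defr (e : eig) : rep (defr e) (zdefr e) (scale20 * (scale20 * scale20)).
Proof.
apply (rep_diff (fun F => gam (proj e F)) (fun F => scal (mu e) (proj e F))).
- exact (rep_comp gam _ _ _ _ _ opY_gam rep_gam (rep_proj e)).
- exact (rep_scal _ _ _ (fst (fst e)) scale20 eq_refl (rep_proj e)).
Qed.

Lemma rep_defl (e : eig) : rep (defl e) (zdefl e) (scale20 * (scale20 * scale20)).
Proof.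
apply (rep_diff (fun F => proj e (gam F)) (fun F => scal (mu e) (proj e F))).
- exact (rep_comp (proj e) gam _ _ _ _ (opY_proj e) (rep_proj e) rep_gam).
- exact (rep_scal _ _ _ (fst (fst e)) scale20 eq_refl (rep_proj e)).
Qed.

Lemma high_proj1 : high0 (proj eig1). Proof. apply high0_proj; apply Nat.leb_le; reflexivity. Qed.
Lemma high_proj2 : high0 (proj eig2). Proof. apply high0_proj; apply Nat.leb_le; reflexivity. Qed.
Lemma high_proj3 : high0 (proj eig3). Proof. apply high0_proj; apply Nat.leb_le; reflexivity. Qed.

Lemma C0_high (k : nat) : (13 <= k)%nat -> C0 (e1 k) = e1 k /\ C0 (e2 k) = e2 k.
Proof.
intros L; unfold C0, P_sum.
destruct (high_proj1 k L) as [a1 a2]; destruct (high_proj2 k L) as [b1 b2];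
destruct (high_proj3 k L) as [c1 c2]; rewrite a1, a2, b1, b2, c1, c2; split; yring.
Qed.

Lemma high_GC : high0 GC.
Proof.
intros k L; unfold GC; destruct (C0_high k L) as [E1 E2]; rewrite E1, E2; apply high0_gam, L.
Qed.

Lemma high_defr (e : eig) : high0 (proj e) -> high0 (defr e).
Proof.
intros H; apply high0_minus; [apply high0_comp; [apply opY_gam | exact H] | apply high0_scal, H].
Qed.

Lemma high_defl (e : eig) : high0 (proj e) -> high0 (defl e).
Proof.
intros H; apply high0_minus; [|apply high0_scal, H].
apply (high0_comp (proj e) gam); [apply opY_proj | apply high0_gam].
Qed.

Lemma nrm_e (k : nat) : nrmY (e1 k) <= 1 /\ nrmY (e2 k) <= 1.
Proof.
assert (H : nrm (xw ^ k)%X <= 1) by (apply nrm_pow_le1; rewrite nrm_xw; lra).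
split.
- change (nrm (xw ^ k)%X + nrm x0 <= 1); rewrite nrm_x0; lra.
- change (nrm x0 + nrm (xw ^ k)%X <= 1); rewrite nrm_x0; lra.
Qed.

(** * Certified column norms of the building blocks *)

Lemma cols_P1 : cols_le (proj eig1) (19870 / 1000).
Proof.
apply (high0_cols _ _ _ _ high_proj1 (rep_proj eig1)); [lia | vm_cast_no_check (eq_refl true)].
Qed.

Lemma cols_P2 : cols_le (proj eig2) (18100 / 1000).
Proof.
apply (high0_cols _ _ _ _ high_proj2 (rep_proj eig2)); [lia | vm_cast_no_check (eq_refl true)].
Qed.

Lemma cols_P3 : cols_le (proj eig3) (8440 / 1000).
Proof.
apply (high0_cols _ _ _ _ high_proj3 (rep_proj eig3)); [lia | vm_cast_no_check (eq_refl true)].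
Qed.

Lemma cols_C0 : cols_le C0 (6770 / 1000).
Proof.
apply (rep_cols_le _ _ _ _ rep_C0); [vm_cast_no_check (eq_refl true)|].
intros k L; destruct (C0_high k L) as [E1 E2]; rewrite E1, E2; destruct (nrm_e k); split; lra.
Qed.

Lemma cols_GC : cols_le GC (1570 / 1000).
Proof. apply (high0_cols _ _ _ _ high_GC rep_GC); [lia | vm_cast_no_check (eq_refl true)]. Qed.

Lemma cols_GGC : cols_le GGC (166 / 1000).
Proof.
apply (high0_cols _ _ _ _ (high0_comp gam GC opY_gam high_GC) rep_GGC);
[lia | vm_cast_no_check (eq_refl true)].
Qed.

Lemma cols_GCG : cols_le GCG (165 / 1000).
Proof.
apply (high0_cols _ _ _ _ (high0_comp GC gam opY_GC high0_gam) rep_GCG);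
[lia | vm_cast_no_check (eq_refl true)].
Qed.

Lemma cols_comm : cols_le comm (2 / 1000).
Proof.
apply (high0_cols _ _ _ _ (high0_minus _ _ high_GC (high0_comp C0 gam opY_C0 high0_gam)) rep_comm);
[lia | vm_cast_no_check (eq_refl true)].
Qed.

Lemma cols_defects (e : eig) : e = eig1 \/ e = eig2 \/ e = eig3 ->
  cols_le (defr e) (1 / 1000) /\ cols_le (defl e) (1 / 1000).
Proof.
intros H; split.
- apply (high0_cols _ _ _ 1 (high_defr e ltac:(destruct H as [H|[H|H]]; subst e;
    [apply high_proj1 | apply high_proj2 | apply high_proj3])) (rep_defr e)); [lia|].
  destruct H as [H|[H|H]]; subst e; vm_cast_no_check (eq_refl true).
- apply (high0_cols _ _ _ 1 (high_defl e ltac:(destruct H as [H|[H|H]]; subst e;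
    [apply high_proj1 | apply high_proj2 | apply high_proj3])) (rep_defl e)); [lia|].
  destruct H as [H|[H|H]]; subst e; vm_cast_no_check (eq_refl true).
Qed.

(** * Algebra of complexified operators *)

Lemma cplx_minus_op (A B : Y -> Y) (H : YC) :
  cplx (fun F => minus (A F) (B F)) H = minus (cplx A H) (cplx B H).
Proof. apply pair_eq; apply l1_eq; reflexivity. Qed.

Lemma cplx_plus_op (A B : Y -> Y) (H : YC) :
  cplx (fun F => plus (A F) (B F)) H = plus (cplx A H) (cplx B H).
Proof. apply pair_eq; apply l1_eq; reflexivity. Qed.

Lemma cplx_scal_op (r : R) (A : Y -> Y) (H : YC) :
  cplx (fun F => scal r (A F)) H = scal (RtoC r) (cplx A H).
Proof.
rewrite !cplx_join, join_scal; f_equal; apply pair_eq; apply l1_eq; intros n; simpl.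
- change (r * pf (A (ReY H)) n = r * pf (A (ReY H)) n + - 0 * pf (A (ImY H)) n).
  rewrite Ropp_0, Rmult_0_l, Rplus_0_r; reflexivity.
- change (r * pg (A (ReY H)) n = r * pg (A (ReY H)) n + - 0 * pg (A (ImY H)) n).
  rewrite Ropp_0, Rmult_0_l, Rplus_0_r; reflexivity.
- change (r * pf (A (ImY H)) n = r * pf (A (ImY H)) n + 0 * pf (A (ReY H)) n).
  rewrite Rmult_0_l, Rplus_0_r; reflexivity.
- change (r * pg (A (ImY H)) n = r * pg (A (ImY H)) n + 0 * pg (A (ReY H)) n).
  rewrite Rmult_0_l, Rplus_0_r; reflexivity.
Qed.

Lemma cplx_id (H : YC) : cplx (fun F => F) H = H.
Proof. apply join_ReIm. Qed.

(** One coefficient of either component. Identities between complexified operators are compared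
    coefficientwise, where they become identities of complex numbers for [ring] and [field]. *)
Definition co (b : bool) (n : nat) (H : YC) : C := if b then pf H n else pg H n.

Lemma co_ext (H K : YC) : (forall b n, co b n H = co b n K) -> H = K.
Proof.
intros E; apply pair_eq; apply l1_eq; intros n; [apply (E true n) | apply (E false n)].
Qed.

Lemma co_plus (b : bool) (n : nat) (H K : YC) : co b n (plus H K) = (co b n H + co b n K)%C.
Proof. destruct b; reflexivity. Qed.

Lemma co_minus (b : bool) (n : nat) (H K : YC) : co b n (minus H K) = (co b n H - co b n K)%C.
Proof. destruct b; reflexivity. Qed.

Lemma co_scal (b : bool) (n : nat) (z : C) (H : YC) : co b n (scal z H) = (z * co b n H)%C.
Proof. destruct b; reflexivity. Qed.

Lemma Cmod_dist (m : R) (z : C) : Cmod z = 1 -> Rabs m - 1 <= Cmod (RtoC m - z)%C /\ 1 - Rabs m <= Cmod (RtoC m - z)%C.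
Proof.
intros Hz; split.
- assert (H := Cmod_triangle (RtoC m - z)%C z); replace (RtoC m - z + z)%C with (RtoC m) in H by ring.
  rewrite Cmod_R in H; lra.
- assert (H := Cmod_triangle (z - RtoC m)%C (RtoC m)); replace (z - RtoC m + RtoC m)%C with z in H by ring.
  rewrite Cmod_R in H; replace (RtoC m - z)%C with (- (z - RtoC m))%C by ring; rewrite Cmod_opp; lra.
Qed.

(** A real number $m\ge0$ has distance $|m-1|$ from the unit circle. *)
Lemma Cinv_bound (m b : R) (z : C) : Cmod z = 1 -> 0 < b -> b <= m - 1 \/ (0 <= m /\ b <= 1 - m) ->
  (RtoC m - z)%C <> RtoC 0 /\ Cmod (/ (RtoC m - z))%C <= / b.
Proof.
intros Hz Hb Hm; destruct (Cmod_dist m z Hz) as [D1 D2].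
assert (L : b <= Cmod (RtoC m - z)%C).
{ destruct Hm as [Hm|[Hm0 Hm]]; rewrite Rabs_pos_eq in D1, D2 by lra; lra. }
assert (N : (RtoC m - z)%C <> RtoC 0) by (apply Cmod_gt_0; lra).
split; [exact N|]; rewrite Cmod_inv by exact N; apply Rinv_le_contravar; lra.
Qed.

Section Resolvent.

Variable z : C.
Hypothesis Hz : Cmod z = 1.

Definition shifted (H : YC) : YC := minus (cplx gam H) (scal z H).

Let c1 : C := (/ (RtoC (mu eig1) - z))%C.
Let c2 : C := (/ (RtoC (mu eig2) - z))%C.
Let c3 : C := (/ (RtoC (mu eig3) - z))%C.
Let y : C := (/ z)%C.

Let z_neq0 : z <> RtoC 0.
Proof. apply Cmod_gt_0; lra. Qed.

Let y_mod : Cmod y = 1.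
Proof. unfold y; rewrite Cmod_inv by exact z_neq0; rewrite Hz; apply Rinv_1. Qed.

(** The eigenvalues are about 23.365, 12.112 and 0.5396; their distances from the circle exceed 22,
    11 and 0.46. *)
Let b1 : (RtoC (mu eig1) - z)%C <> RtoC 0 /\ Cmod c1 <= / 22.
Proof.
apply Cinv_bound; [exact Hz | lra | left].
unfold mu, scale20; cbn [fst eig1]; lra.
Qed.

Let b2' : (RtoC (mu eig2) - z)%C <> RtoC 0 /\ Cmod c2 <= / 11.
Proof.
apply Cinv_bound; [exact Hz | lra | left].
unfold mu, scale20; cbn [fst eig2]; lra.
Qed.

Let b3 : (RtoC (mu eig3) - z)%C <> RtoC 0 /\ Cmod c3 <= / (46 / 100).
Proof.
apply Cinv_bound; [exact Hz | lra | right].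
unfold mu, scale20; cbn [fst eig3]; lra.
Qed.

(* The Laurent expansion of the resolvent of the complementary part is cut after two terms. *)
Definition parametrix (H : YC) : YC :=
  minus (minus
    (plus (plus (scal c1 (cplx (proj eig1) H)) (scal c2 (cplx (proj eig2) H)))
      (scal c3 (cplx (proj eig3) H)))
    (scal y (cplx C0 H))) (scal (y * y)%C (cplx GC H)).

Lemma shifted_plus (H K : YC) : shifted (plus H K) = plus (shifted H) (shifted K).
Proof.
unfold shifted; rewrite (cplx_plus _ _ _ opY_gam); apply co_ext; intros b n.
repeat rewrite ?co_minus, ?co_plus, ?co_scal; ring.
Qed.

Lemma shifted_scal (c : C) (H : YC) : shifted (scal c H) = scal c (shifted H).
Proof.
unfold shifted; rewrite (cplx_scal _ _ _ opY_gam); apply co_ext; intros b n.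
repeat rewrite ?co_minus, ?co_scal; ring.
Qed.

Lemma parametrix_plus (H K : YC) : parametrix (plus H K) = plus (parametrix H) (parametrix K).
Proof.
unfold parametrix; rewrite !(cplx_plus _ _ _ (opY_proj _)), (cplx_plus _ _ _ opY_C0), (cplx_plus _ _ _ opY_GC).
apply co_ext; intros b n; repeat rewrite ?co_minus, ?co_plus, ?co_scal; ring.
Qed.

Lemma nYC_scal_le (c : C) (b m : R) (H K : YC) :
  Cmod c <= b -> nYC K <= m * nYC H -> nYC (scal c K) <= b * m * nYC H.
Proof.
intros Hc HK; apply Rle_trans with (1 := nYC_scal c K); rewrite Rmult_assoc.
apply Rmult_le_compat; [apply Cmod_ge_0 | apply nYC_ge0 | exact Hc | exact HK].
Qed.

(** The constant comes from $19.87/22+18.1/11+8.44/0.46+6.77+1.57<29.2375$. More than half of it is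
    due to the eigenvalue near 0.54, the closest to the circle. *)
Lemma parametrix_bound (H : YC) : nYC (parametrix H) <= 292375 / 10000 * nYC H.
Proof.
unfold parametrix.
assert (Q1 := nYC_scal_le c1 _ _ H _ (proj2 b1) (cplx_bound _ _ H (opY_proj _) cols_P1)).
assert (Q2 := nYC_scal_le c2 _ _ H _ (proj2 b2') (cplx_bound _ _ H (opY_proj _) cols_P2)).
assert (Q3 := nYC_scal_le c3 _ _ H _ (proj2 b3) (cplx_bound _ _ H (opY_proj _) cols_P3)).
assert (Q4 := nYC_scal_le y _ _ H _ (Req_le _ _ y_mod) (cplx_bound _ _ H opY_C0 cols_C0)).
assert (yy : Cmod (y * y)%C <= 1) by (rewrite Cmod_mult, y_mod; lra).
assert (Q5 := nYC_scal_le _ _ _ H _ yy (cplx_bound _ _ H opY_GC cols_GC)).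
assert (P := nYC_ge0 H).
eapply Rle_trans; [apply nYC_minus|].
eapply Rle_trans; [apply Rplus_le_compat; [apply nYC_minus | exact Q5]|].
eapply Rle_trans; [apply Rplus_le_compat_r, Rplus_le_compat; [apply nYC_triangle | exact Q4]|].
eapply Rle_trans; [apply Rplus_le_compat_r, Rplus_le_compat_r, Rplus_le_compat;
  [apply nYC_triangle | exact Q3]|].
assert (Q12 := Rplus_le_compat _ _ _ _ Q1 Q2); lra.
Qed.

Lemma cplx_defr (e : eig) (H : YC) :
  cplx gam (cplx (proj e) H) = plus (cplx (defr e) H) (scal (RtoC (mu e)) (cplx (proj e) H)).
Proof.
unfold defr; rewrite cplx_minus_op, cplx_scal_op, cplx_comp; apply YC_split.
Qed.

Lemma cplx_defl (e : eig) (H : YC) :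
  cplx (proj e) (cplx gam H) = plus (cplx (defl e) H) (scal (RtoC (mu e)) (cplx (proj e) H)).
Proof.
unfold defl; rewrite cplx_minus_op, cplx_scal_op, cplx_comp; apply YC_split.
Qed.

Lemma cplx_C0 (H : YC) : cplx C0 H =
  minus H (plus (plus (cplx (proj eig1) H) (cplx (proj eig2) H)) (cplx (proj eig3) H)).
Proof.
assert (E : cplx P_sum H = plus (plus (cplx (proj eig1) H) (cplx (proj eig2) H)) (cplx (proj eig3) H)).
{ transitivity (plus (cplx (fun F => plus (proj eig1 F) (proj eig2 F)) H) (cplx (proj eig3) H)).
  - exact (cplx_plus_op (fun F => plus (proj eig1 F) (proj eig2 F)) (proj eig3) H).
  - exact (f_equal (fun K : YC => plus K (cplx (proj eig3) H)) (cplx_plus_op (proj eig1) (proj eig2) H)). }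
rewrite <- E; transitivity (minus (cplx (fun F => F) H) (cplx P_sum H)).
- exact (cplx_minus_op (fun F => F) P_sum H).
- exact (f_equal (fun K : YC => minus K (cplx P_sum H)) (cplx_id H)).
Qed.

Lemma cplx_GC (H : YC) : cplx gam (cplx C0 H) = cplx GC H.
Proof. exact (cplx_comp gam C0 H). Qed.

Lemma cplx_GGC (H : YC) : cplx gam (cplx GC H) = cplx GGC H.
Proof. exact (cplx_comp gam GC H). Qed.

Lemma cplx_GCG (H : YC) : cplx GC (cplx gam H) = cplx GCG H.
Proof. exact (cplx_comp GC gam H). Qed.

Lemma cplx_comm (H : YC) : cplx C0 (cplx gam H) = minus (cplx GC H) (cplx comm H).
Proof.
assert (E : cplx comm H = minus (cplx GC H) (cplx C0 (cplx gam H))).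
{ rewrite cplx_comp; exact (cplx_minus_op GC (fun F => C0 (gam F)) H). }
rewrite E; apply co_ext; intros b n; rewrite !co_minus; ring.
Qed.

Lemma cplx_minus (A : Y -> Y) (H K : YC) : opY A -> cplx A (minus H K) = minus (cplx A H) (cplx A K).
Proof.
intros HA; assert (E : cplx A H = plus (cplx A (minus H K)) (cplx A K)).
{ rewrite <- (cplx_plus _ _ _ HA); exact (f_equal (cplx A) (YC_split H K)). }
rewrite E; apply co_ext; intros b n; repeat rewrite ?co_minus, ?co_plus; ring.
Qed.

(** $c_i(P_i\Gamma-zP_i)$ is $P_i$ plus $c_i$ times the left defect, the two terms of the
    complementary part telescope, and $P_1+P_2+P_3+C_0=I$ by definition. What remains is the
    commutator, the eigenvector defects and $z^{-2}$ times [GCG]. *)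
Lemma left_defect (H : YC) : minus H (parametrix (shifted H)) =
  plus (minus (minus (scal (y * y)%C (cplx GCG H)) (scal y (cplx comm H)))
    (plus (scal c1 (cplx (defl eig1) H)) (scal c2 (cplx (defl eig2) H))))
   (scal (- c3)%C (cplx (defl eig3) H)).
Proof.
unfold parametrix, shifted.
rewrite !(cplx_minus _ _ _ (opY_proj _)), (cplx_minus _ _ _ opY_C0), (cplx_minus _ _ _ opY_GC).
rewrite !(cplx_scal _ _ _ (opY_proj _)), (cplx_scal _ _ _ opY_C0), (cplx_scal _ _ _ opY_GC).
rewrite !cplx_defl, cplx_comm, cplx_GCG, cplx_C0.
apply co_ext; intros b n; repeat rewrite ?co_minus, ?co_plus, ?co_scal.
unfold c1, c2, c3, y; destruct b1 as [N1 _]; destruct b2' as [N2 _]; destruct b3 as [N3 _].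
field; repeat split; assumption.
Qed.

(** On this side $\Gamma$ meets $C_0$ from the left and [GC] is that product by definition, so no
    commutator appears. *)
Lemma right_defect (H : YC) : minus H (shifted (parametrix H)) =
  plus (minus (scal (y * y)%C (cplx GGC H))
    (plus (scal c1 (cplx (defr eig1) H)) (scal c2 (cplx (defr eig2) H))))
   (scal (- c3)%C (cplx (defr eig3) H)).
Proof.
unfold shifted, parametrix.
rewrite !(cplx_minus _ _ _ opY_gam), !(cplx_plus _ _ _ opY_gam), !(cplx_scal _ _ _ opY_gam).
rewrite !cplx_defr, cplx_GC, cplx_GGC, cplx_C0.
apply co_ext; intros b n; repeat rewrite ?co_minus, ?co_plus, ?co_scal.
unfold c1, c2, c3, y; destruct b1 as [N1 _]; destruct b2' as [N2 _]; destruct b3 as [N3 _].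
field; repeat split; assumption.
Qed.

(** The two amounts are $0.001(1/22+1/11)$ and $0.001/0.46$, rounded up. *)
Lemma defect_terms (d : eig -> Y -> Y) (H : YC) :
  (forall e, opY (d e)) ->
  (forall e, e = eig1 \/ e = eig2 \/ e = eig3 -> cols_le (d e) (1 / 1000)) ->
  nYC (plus (scal c1 (cplx (d eig1) H)) (scal c2 (cplx (d eig2) H))) <= 1 / 1000 * nYC H /\
  nYC (scal (- c3)%C (cplx (d eig3) H)) <= 3 / 1000 * nYC H.
Proof.
intros O B.
assert (Q1 := nYC_scal_le c1 _ _ H _ (proj2 b1) (cplx_bound _ _ H (O eig1) (B eig1 ltac:(tauto)))).
assert (Q2 := nYC_scal_le c2 _ _ H _ (proj2 b2') (cplx_bound _ _ H (O eig2) (B eig2 ltac:(tauto)))).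
assert (N3 : Cmod (- c3)%C <= / (46 / 100)) by (rewrite Cmod_opp; apply (proj2 b3)).
assert (Q3 := nYC_scal_le _ _ _ H _ N3 (cplx_bound _ _ H (O eig3) (B eig3 ltac:(tauto)))).
assert (P := nYC_ge0 H).
split; [eapply Rle_trans; [apply nYC_triangle|]; assert (Q := Rplus_le_compat _ _ _ _ Q1 Q2); lra | lra].
Qed.

Lemma yy_mod : Cmod (y * y)%C <= 1.
Proof. rewrite Cmod_mult, y_mod; lra. Qed.

(** The terms add up to $0.165+0.002+0.001+0.003=0.171$; the constant 0.172 also covers the 0.170 of
    the right defect. *)
Lemma left_defect_bound (H : YC) : nYC (minus H (parametrix (shifted H))) <= 172 / 1000 * nYC H.
Proof.
rewrite left_defect.
destruct (defect_terms defl H opY_defl (fun e E => proj2 (cols_defects e E))) as [D1 D2].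
assert (Q1 := nYC_scal_le _ _ _ H _ yy_mod (cplx_bound _ _ H opY_GCG cols_GCG)).
assert (Q2 := nYC_scal_le y _ _ H _ (Req_le _ _ y_mod) (cplx_bound _ _ H opY_comm cols_comm)).
eapply Rle_trans; [apply nYC_triangle|].
eapply Rle_trans; [apply Rplus_le_compat; [apply nYC_minus | exact D2]|].
eapply Rle_trans; [apply Rplus_le_compat_r, Rplus_le_compat; [apply nYC_minus | exact D1]|].
assert (Q := Rplus_le_compat _ _ _ _ Q1 Q2); assert (P := nYC_ge0 H); lra.
Qed.

Lemma right_defect_bound (H : YC) : nYC (minus H (shifted (parametrix H))) <= 172 / 1000 * nYC H.
Proof.
rewrite right_defect.
destruct (defect_terms defr H opY_defr (fun e E => proj1 (cols_defects e E))) as [D1 D2].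
assert (Q1 := nYC_scal_le _ _ _ H _ yy_mod (cplx_bound _ _ H opY_GGC cols_GGC)).
eapply Rle_trans; [apply nYC_triangle|].
eapply Rle_trans; [apply Rplus_le_compat; [apply nYC_minus | exact D2]|].
eapply Rle_trans; [apply Rplus_le_compat_r, Rplus_le_compat; [exact Q1 | exact D1]|].
assert (P := nYC_ge0 H); lra.
Qed.

Lemma resolvent : exists J : YC -> YC,
  is_inverse shifted J /\ forall H, nYC (J H) <= 36 * nYC H.
Proof.
destruct (approximate_inverse shifted parametrix (172 / 1000) (292375 / 10000)
  shifted_plus shifted_scal parametrix_plus parametrix_bound left_defect_bound
  right_defect_bound ltac:(lra) ltac:(lra)) as [J [HJ B]].
exists J; split; [exact HJ|]; intros H.
assert (P := nYC_ge0 H); assert (Q := B H).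
(* The quotient $29.2375/0.828$ is about 35.31. *)
replace (292375 / 10000 / (1 - 172 / 1000)) with (292375 / 8280) in Q by field; lra.
Qed.

End Resolvent.

(** * The matrix *)

Definition entry (i j : nat) : R :=
  let c := if lt_dec j 13 then nth j gam_f ([], []) else nth (j - 13) gam_g ([], []) in
  / IZR scale20 * IZR (if lt_dec i 13 then nth i (fst c) 0%Z else nth (i - 13) (snd c) 0%Z).

Definition gam_matrix : @matrix R (2 * d) (2 * d) := mk_matrix (2 * d) (2 * d) entry.

Lemma pz_coef (l : list Z) (i : nat) : pz l i = IZR (nth i l 0%Z).
Proof.
revert i; induction l as [|x l IH]; intros [|i]; try reflexivity.
- apply pz_head.
- transitivity (xtail (pz (x :: l)) i); [reflexivity|].
  rewrite <- pz_tail; apply IH.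
Qed.

Lemma psum_split (u : nat -> R) (m n : nat) :
  rsum u (m + n) =
  rsum u m + rsum (fun k => u (m + k)%nat) n.
Proof.
induction n as [|n IH].
- rewrite Nat.add_0_r; symmetry; apply Rplus_0_r.
- rewrite Nat.add_succ_r.
  change (rsum u (m + n) + u (m + n)%nat =
   rsum u m + (rsum (fun k => u (m + k)%nat) n + u (m + n)%nat)).
  rewrite IH; ring.
Qed.

Lemma psum_ext (u v : nat -> R) (m : nat) : (forall k, (k < m)%nat -> u k = v k) ->
  rsum u m = rsum v m.
Proof.
intros H; induction m as [|m IH]; [reflexivity|].
exact (f_equal2 Rplus (IH (fun k L => H k (Nat.lt_lt_succ_r _ _ L))) (H m (Nat.lt_succ_diag_r m))).
Qed.

Lemma psum_scal (r : R) (u : nat -> R) (m : nat) :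
  rsum (fun k => r * u k) m = r * rsum u m.
Proof.
induction m as [|m IH]; [symmetry; apply Rmult_0_r|].
change (rsum (fun k => r * u k) m + r * u m = r * (rsum u m + u m)).
rewrite IH; ring.
Qed.

Lemma psum_0 (u : nat -> R) (m : nat) :
  (forall k, u k = 0) -> rsum u m = 0.
Proof.
intros H; induction m as [|m IH]; [reflexivity|].
change (rsum u m + u m = 0); rewrite IH, H; apply Rplus_0_r.
Qed.

Lemma gapp_coef (cols : list vecz) (f : X) (i : nat) :
  pf (gapp cols f) i =
    rsum (fun k => f k * IZR (nth i (fst (nth k cols ([], []))) 0%Z)) (length cols) /\
  pg (gapp cols f) i =
    rsum (fun k => f k * IZR (nth i (snd (nth k cols ([], []))) 0%Z)) (length cols).
Proof.
revert f; induction cols as [|c t IH]; intros f; [split; reflexivity|].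
cbn [gapp length]; rewrite !psum_first; cbn [nth].
destruct (IH (xtail f)) as [E1 E2]; split.
- rewrite <- pz_coef; transitivity (f 0%nat * pz (fst c) i + pf (gapp t (xtail f)) i); [reflexivity|].
  rewrite E1; reflexivity.
- rewrite <- pz_coef; transitivity (f 0%nat * pz (snd c) i + pg (gapp t (xtail f)) i); [reflexivity|].
  rewrite E2; reflexivity.
Qed.

(** No column has an entry beyond the 13th row of either component, so the truncation in [mat_op]
    loses nothing. *)
Lemma gam_short (k i : nat) : (13 <= i)%nat ->
  nth i (fst (nth k gam_f ([], []))) 0%Z = 0%Z /\ nth i (snd (nth k gam_f ([], []))) 0%Z = 0%Z /\
  nth i (fst (nth k gam_g ([], []))) 0%Z = 0%Z /\ nth i (snd (nth k gam_g ([], []))) 0%Z = 0%Z.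
Proof.
intros L.
assert (S : forallb (fun c => (length (fst c) <=? 13)%nat && (length (snd c) <=? 13)%nat)
  (([], []) :: gam_f ++ gam_g) = true) by reflexivity.
rewrite forallb_forall in S.
assert (Q : forall c : vecz, In c (([], []) :: gam_f ++ gam_g) ->
  nth i (fst c) 0%Z = 0%Z /\ nth i (snd c) 0%Z = 0%Z).
{ intros c I; specialize (S c I); apply andb_true_iff in S; destruct S as [S1 S2].
  apply Nat.leb_le in S1, S2; split; apply nth_overflow; lia. }
assert (I1 : In (nth k gam_f ([], [])) (([], []) :: gam_f ++ gam_g)).
{ destruct (nth_in_or_default k gam_f ([], [])) as [I|E]; [right; apply in_or_app; left; exact I|].
  rewrite E; left; reflexivity. }
assert (I2 : In (nth k gam_g ([], [])) (([], []) :: gam_f ++ gam_g)).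
{ destruct (nth_in_or_default k gam_g ([], [])) as [I|E]; [right; apply in_or_app; right; exact I|].
  rewrite E; left; reflexivity. }
destruct (Q _ I1); destruct (Q _ I2); repeat split; assumption.
Qed.

Lemma matrix_row (F : Y) (i : nat) : (i < 26)%nat ->
  coeff_mat 0 (Mmult gam_matrix (low_coefs F)) i 0 =
  rsum (fun j => entry i j * pf F j) 13
  + rsum (fun j => entry i (13 + j) * pg F j) 13.
Proof.
intros L; unfold Mmult.
rewrite (coeff_mat_bij 0) by (cbn; lia).
(* The matrix product sums up to the index 25 inclusive; [psum] counts its 26 terms. *)
change (pred (2 * d)) with 25%nat; rewrite psum_sum_n.
change 26%nat with (13 + 13)%nat; rewrite psum_split; f_equal.
- apply psum_ext; intros k Lk; apply (f_equal2 Rmult).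
  + apply (coeff_mat_bij (m := 26) (n := 26) _ entry); lia.
  + transitivity (if lt_dec k d then pf F k else pg F (k - d)%nat).
    * apply (coeff_mat_bij (m := 26) (n := 1) _ (fun i (_ : nat) => if lt_dec i d then pf F i else pg F (i - d)%nat)); lia.
    * destruct (lt_dec k d) as [_|N]; [reflexivity | exfalso; apply N; exact Lk].
- apply psum_ext; intros k Lk; apply (f_equal2 Rmult).
  + apply (coeff_mat_bij (m := 26) (n := 26) _ entry); lia.
  + transitivity (if lt_dec (13 + k) d then pf F (13 + k)%nat else pg F (13 + k - d)%nat).
    * apply (coeff_mat_bij (m := 26) (n := 1) _ (fun i (_ : nat) => if lt_dec i d then pf F i else pg F (i - d)%nat)); lia.
    * destruct (lt_dec (13 + k) d) as [N|_]; [exfalso; unfold d in N; lia|].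
      replace (13 + k - d)%nat with k by (unfold d; lia); reflexivity.
Qed.

Lemma gam_coef (F : Y) (i : nat) :
  pf (gam F) i = / IZR scale20 * (pf (gapp gam_f (pf F)) i + pf (gapp gam_g (pg F)) i) /\
  pg (gam F) i = / IZR scale20 * (pg (gapp gam_f (pf F)) i + pg (gapp gam_g (pg F)) i).
Proof. split; reflexivity. Qed.

(** Links the column form, on which all estimates are made, to the matrix that the theorem asks
    for. *)
Lemma mat_op_gam : mat_op gam_matrix = gam.
Proof.
assert (A : forall a b c : R, a * b * c = a * (c * b)) by (intros; ring).
apply functional_extensionality; intros F; apply pair_eq; apply l1_eq; intros i.
- rewrite (proj1 (gam_coef F i)), (proj1 (gapp_coef _ _ i)), (proj1 (gapp_coef gam_g _ i)).
  change (length gam_f) with 13%nat; change (length gam_g) with 13%nat.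
  unfold mat_op, l1_finite; cbn [pf coef]; destruct (lt_dec i d) as [L|L].
  + rewrite matrix_row by (unfold d in L; lia).
    rewrite Rmult_plus_distr_l, <- !psum_scal; f_equal; apply psum_ext; intros k Lk; unfold entry.
    * destruct (lt_dec k 13) as [_|]; [|lia]; destruct (lt_dec i 13) as [_|N]; [apply A | contradiction].
    * destruct (lt_dec (13 + k) 13) as [|_]; [lia|]; replace (13 + k - 13)%nat with k by lia.
      destruct (lt_dec i 13) as [_|N]; [apply A | contradiction].
  + apply Nat.nlt_ge in L.
    rewrite !psum_0; [symmetry; rewrite Rplus_0_r; apply Rmult_0_r | |];
      intros k; destruct (gam_short k i L) as [S1 [S2 [S3 S4]]];
      (replace (IZR _) with 0 by (symmetry; apply (f_equal IZR); assumption)); apply Rmult_0_r.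
- rewrite (proj2 (gam_coef F i)), (proj2 (gapp_coef _ _ i)), (proj2 (gapp_coef gam_g _ i)).
  change (length gam_f) with 13%nat; change (length gam_g) with 13%nat.
  unfold mat_op, l1_finite; cbn [pg coef]; destruct (lt_dec i d) as [L|L].
  + rewrite matrix_row by (unfold d in *; lia).
    rewrite Rmult_plus_distr_l, <- !psum_scal; f_equal; apply psum_ext; intros k Lk; unfold entry.
    * destruct (lt_dec k 13) as [_|]; [|lia]; destruct (lt_dec (d + i) 13) as [N|_]; [unfold d in N; lia|].
      replace (d + i - 13)%nat with i by (unfold d; lia); apply A.
    * destruct (lt_dec (13 + k) 13) as [|_]; [lia|]; replace (13 + k - 13)%nat with k by lia.
      destruct (lt_dec (d + i) 13) as [N|_]; [unfold d in N; lia|].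
      replace (d + i - 13)%nat with i by (unfold d; lia); apply A.
  + apply Nat.nlt_ge in L.
    rewrite !psum_0; [symmetry; rewrite Rplus_0_r; apply Rmult_0_r | |];
      intros k; destruct (gam_short k i L) as [S1 [S2 [S3 S4]]];
      (replace (IZR _) with 0 by (symmetry; apply (f_equal IZR); assumption)); apply Rmult_0_r.
Qed.

(** * Enclosures near the approximate fixed point *)

Definition f0 : X := (cst (/ IZR unit_z) * pz f0z)%X.
Definition g0 : X := (cst (/ IZR unit_z) * pz g0z)%X.
Definition F0 : Y := Pair f0 g0.

(* [1.1 10^-7] in units of [2^-52]; the margin over [10^-7] leaves room for a neighbourhood of
   every point of the closed ball. *)
Definition radius : Z := 495395960%Z.

Lemma cst_unit_inv (a : X) : (cst (IZR unit_z) * (cst (/ IZR unit_z) * a))%X = a.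
Proof.
assert (U := unit_pos).
transitivity (cst (IZR unit_z) * cst (/ IZR unit_z) * a)%X; [ring|].
rewrite <- cst_mul, Rinv_r by lra; change (cst 1) with x1; ring.
Qed.

Lemma inb_center (l : list Z) : inb (l, 0%Z) (cst (/ IZR unit_z) * pz l)%X.
Proof.
unfold inb; cbn [fst snd]; rewrite cst_unit_inv; replace (_ - _)%X with x0 by ring.
rewrite nrm_x0; apply Rle_refl.
Qed.

Lemma inb_near (l : list Z) (x : X) :
  nrm (x - cst (/ IZR unit_z) * pz l)%X <= 11 / 10 ^ 8 -> inb (l, radius) x.
Proof.
intros H; unfold inb; cbn [fst snd]; assert (U := unit_pos).
rewrite <- (cst_unit_inv (pz l)).
replace (_ - _)%X with (cst (IZR unit_z) * (x - cst (/ IZR unit_z) * pz l))%X by ring.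
rewrite nrm_cst_mul, Rabs_pos_eq by lra.
apply Rle_trans with (IZR unit_z * (11 / 10 ^ 8)); [apply Rmult_le_compat_l; lra|].
rewrite unit_val; unfold radius; lra.
Qed.

(** 45035 units of $2^{-52}$ are just below $10^{-11}$. *)
Definition nonlinear_residual (v : vals) : bool :=
  (nb (bsub (v_T1 v) (f0z, 0%Z)) + nb (bsub (v_T2 v) (g0z, 0%Z)) <=? 45035)%Z.

(** The 18 powers match the 18 coefficients of [g0z], so that no coefficient is charged to the
    radius for want of a power. The threshold of 64 units is about $1.4\cdot10^{-14}$. *)
Lemma check_center :
  match run 64 17 (f0z, 0%Z) (g0z, 0%Z) with Some v => nonlinear_residual v | None => false end = true.
Proof. vm_cast_no_check (eq_refl true). Qed.

Lemma residual_F0 : nrmY (minus (T F0) F0) <= / 10 ^ 11.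
Proof.
assert (C := check_center).
destruct (run 64 17 (f0z, 0%Z) (g0z, 0%Z)) as [v|] eqn:E; [|discriminate C].
destruct (run_sound _ _ _ _ _ F0 (inb_center f0z) (inb_center g0z) E) as [G I].
rewrite (T_good F0 G).
change (nrm (tT1 F0 - f0)%X + nrm (tT2 F0 - g0)%X <= / 10 ^ 11).
assert (I1 := inb_norm _ _ (inb_sub _ _ _ _ (e_T1 _ _ I) (inb_center f0z))).
assert (I2 := inb_norm _ _ (inb_sub _ _ _ _ (e_T2 _ _ I) (inb_center g0z))).
apply Z.leb_le, IZR_le in C; rewrite plus_IZR in C.
change (cst (/ IZR unit_z) * pz f0z)%X with f0 in I1; change (cst (/ IZR unit_z) * pz g0z)%X with g0 in I2.
assert (S := Rplus_le_compat _ _ _ _ I1 I2); rewrite <- Rmult_plus_distr_l in S.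
assert (U := unit_pos); apply Rmult_le_reg_l with (1 := U).
apply Rle_trans with (1 := S), Rle_trans with (1 := C).
rewrite unit_val; lra.
Qed.

(** ** Columns of the derivative *)

Definition zball0 : zball := ([], 0%Z).
Definition bnth (k : nat) (r : list zball) : zball := nth k r zball0.
(** The point at which $\lambda$ evaluates [f] depends on [f] through $f(0)$ alone. Hence only the
    direction $z^0$ carries a chain-rule term; the others give minus a power. *)
Definition dlam (v : vals) (k : nat) : zball :=
  match k with O => v_dl0 v | S _ => bneg (bnth k (v_alp v)) end.
(** About $10^{-9}$, small against the radius of the ball; trimming at this level keeps the
    polynomials short. *)
Definition thr : Z := 4194304%Z.

Definition col_f (v : vals) (k : nat) : zball * zball :=
  (badd (bmul thr (v_A1 v) (bnth k (v_pp v))) (bmul thr (v_V1 v) (dlam v k)),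
   btail (badd (badd (bmul thr (v_B1 v) (bnth k (v_hp v))) (bmul thr (v_B2 v) (bnth k (v_qp v))))
     (bmul thr (v_V2 v) (dlam v k)))).

Definition col_g (v : vals) (k : nat) : zball * zball :=
  (bmul thr (v_A2 v) (bnth k (v_up v)), btail (bmul thr (v_B3 v) (bnth k (v_mp v)))).

(* [0.0039] in units of [2^-52]. *)
Definition eps_z : Z := 17564038546744%Z.

(* The factor [2^32] turns units of [2^-20] into units of [2^-52]. *)
Definition near_col (c : vecz) (b : zball * zball) : bool :=
  (nb (bsub (psc 4294967296 (fst c), 0%Z) (fst b))
   + nb (bsub (psc 4294967296 (snd c), 0%Z) (snd b)) <=? eps_z)%Z.

(** For $k\ge13$ the column of $\Gamma$ is zero, and the terms with exponent 13 bound the column of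
    the derivative. The length tests exclude the default value of [nth], and the last test provides
    the uniform bound on $1/\lambda$ that [qd_inv] asks for. *)
Definition check_columns (v : vals) : bool :=
  forallb (fun k => near_col (nth k gam_f ([], [])) (col_f v k)
    && near_col (nth k gam_g ([], [])) (col_g v k)) (seq 0 13)
  && (nb (bmul thr (v_A1 v) (bnth 13 (v_pp v))) + nb (bmul thr (v_V1 v) (bnth 13 (v_alp v)))
      + (nb (bmul thr (v_B1 v) (bnth 13 (v_hp v))) + nb (bmul thr (v_B2 v) (bnth 13 (v_qp v)))
      + nb (bmul thr (v_V2 v) (bnth 13 (v_alp v)))) <=? eps_z)%Z
  && (nb (bmul thr (v_A2 v) (bnth 13 (v_up v))) + nb (bmul thr (v_B3 v) (bnth 13 (v_mp v)))
      <=? eps_z)%Z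
  && forallb (fun r => (length r =? 14)%nat)
      [v_alp v; v_pp v; v_up v; v_qp v; v_hp v; v_mp v]
  && (nb (v_il v) <=? 5 * unit_z)%Z.

(** Here 14 powers are listed: exponents 0 to 12 for the columns compared with $\Gamma$, and 13 for
    all later ones. *)
Lemma check_ball :
  match run thr 13 (f0z, radius) (g0z, radius) with Some v => check_columns v | None => false end = true.
Proof. vm_cast_no_check (eq_refl true). Qed.

Lemma xcomp_x0 (a : X) : nrm a <= 1 -> xcomp x0 a = x0.
Proof. intros H; exact (lc_x0 _ 1 (xpow_bounded a H)). Qed.

Lemma xcomp_xpow (k : nat) (a : X) : nrm a <= 1 -> xcomp (xw ^ k)%X a = (a ^ k)%X.
Proof.
intros H; apply evalC_inj; intros w Hw; apply Rlt_le in Hw.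
assert (B : Cmod (evalC a w) <= 1) by (apply Rle_trans with (2 := H), evalC_bound, Hw).
rewrite evalC_xcomp, !evalC_xpow, evalC_xw by assumption; reflexivity.
Qed.

Lemma gapp_basis (cols : list vecz) (k : nat) : (k < length cols)%nat ->
  gapp cols (xw ^ k)%X = vec (nth k cols ([], [])).
Proof.
revert k; induction cols as [|c t IH]; intros k L; cbn [length] in L; [lia|].
destruct k as [|k]; cbn [gapp nth].
- replace (xtail (xw ^ 0)%X) with x0 by (apply l1_eq; reflexivity).
  rewrite gapp_x0; change ((xw ^ 0)%X 0%nat) with 1; yring; change (cst 1) with x1; ring.
- rewrite xpow_head, xpow_tail, IH by lia; yring.
Qed.

Lemma xpow_add (a : X) (m n : nat) : (a ^ (m + n))%X = (a ^ m * a ^ n)%X.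
Proof. induction m as [|m IH]; simpl; [ring | rewrite IH; ring]. Qed.

Lemma tail_power (a b : X) (k : nat) : nrm a <= 1 -> (13 <= k)%nat ->
  nrm (b * a ^ k)%X <= nrm (b * a ^ 13)%X.
Proof.
intros Ha L; replace k with (13 + (k - 13))%nat by lia; rewrite xpow_add.
replace (b * _)%X with (b * a ^ 13 * a ^ (k - 13))%X by ring.
apply Rle_trans with (1 := nrm_mul _ _); rewrite <- (Rmult_1_r (nrm (b * a ^ 13)%X)) at 2.
apply Rmult_le_compat_l; [apply nrm_ge0 | apply nrm_pow_le1, Ha].
Qed.

Section NearBall.

Variable F : Y.
Hypothesis HF : nrmY (minus F F0) <= 11 / 10 ^ 8.

Let sound : exists v, check_columns v = true /\ good F /\ enclosed F v.
Proof.
assert (C := check_ball).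
destruct (run thr 13 (f0z, radius) (g0z, radius)) as [v|] eqn:E; [|discriminate C].
exists v; split; [exact C|].
apply (run_sound _ _ _ _ _ F) with (3 := E); apply inb_near.
- apply Rle_trans with (2 := HF); exact (nrm_pf (minus F F0)).
- apply Rle_trans with (2 := HF); exact (nrm_pg (minus F F0)).
Qed.

Lemma good_near : good F.
Proof. destruct sound as [v [_ [G _]]]; exact G. Qed.

Let N_al : nrm (tal F) <= 1. Proof. destruct good_near as [_ [H _]]; lra. Qed.
Let N_p : nrm (tp F) <= 1. Proof. destruct good_near as [_ [_ [H _]]]; lra. Qed.
Let N_ut : nrm (tut F) <= 1. Proof. destruct good_near as [_ [_ [_ [H _]]]]; lra. Qed.
Let N_m : nrm (tm F) <= 1. Proof. destruct good_near as [_ [_ [_ [_ [H _]]]]]; lra. Qed.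
Let N_q : nrm (tq F) <= 1. Proof. destruct good_near as [_ [_ [_ [_ [_ [H _]]]]]]; lra. Qed.
Let N_h : nrm (th F) <= 1. Proof. destruct good_near as [_ [_ [_ [_ [_ [_ H]]]]]]; lra. Qed.

Lemma d_lam_e2 (k : nat) : d_lam F (e2 k) = x0.
Proof.
unfold d_lam, d_al, e2; cbn [pf pg]; rewrite xcomp_x0 by exact N_al.
change (x0 0%nat) with 0; rewrite cst_0; ring.
Qed.

Lemma d_lam_e1_0 : d_lam F (e1 0) = (- (x1 + xdcomp (pf F) (tal F) * (cis * (x2 * tc F))))%X.
Proof.
unfold d_lam, d_al, e1; cbn [pf pg]; rewrite xcomp_xpow by exact N_al.
change (cst ((xw ^ 0)%X 0%nat)) with x1; simpl xpow; ring.
Qed.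

Lemma d_lam_e1_S (k : nat) : d_lam F (e1 (S k)) = (- (tal F ^ S k))%X.
Proof.
unfold d_lam, d_al, e1; cbn [pf pg]; rewrite xcomp_xpow, xpow_head, cst_0 by exact N_al; ring.
Qed.

Lemma d_T1_e1 (k : nat) : d_T1 F (e1 k) = (dA1 F * tp F ^ k + dV1 F * d_lam F (e1 k))%X.
Proof.
rewrite d_T1_factor; unfold e1 at 1 2; cbn [pf pg].
rewrite xcomp_xpow, xcomp_x0 by assumption; ring.
Qed.

Lemma d_T2_e1 (k : nat) : d_T2 F (e1 k) =
  xtail (dB1 F * th F ^ k + dB2 F * tq F ^ k + dV2 F * d_lam F (e1 k))%X.
Proof.
rewrite d_T2_factor; unfold e1 at 1 2 3; cbn [pf pg].
rewrite !xcomp_xpow, xcomp_x0 by assumption; f_equal; ring.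
Qed.

Lemma d_T1_e2 (k : nat) : d_T1 F (e2 k) = (dA2 F * tut F ^ k)%X.
Proof.
rewrite d_T1_factor, d_lam_e2; unfold e2; cbn [pf pg].
rewrite xcomp_xpow, xcomp_x0 by assumption; ring.
Qed.

Lemma d_T2_e2 (k : nat) : d_T2 F (e2 k) = xtail (dB3 F * tm F ^ k)%X.
Proof.
rewrite d_T2_factor, d_lam_e2; unfold e2; cbn [pf pg].
rewrite xcomp_xpow, !xcomp_x0 by assumption; f_equal; ring.
Qed.

Lemma inb_column (l : list Z) :
  inb (psc 4294967296 l, 0%Z) (cst (/ IZR scale20) * pz l)%X.
Proof.
unfold inb; cbn [fst snd]; rewrite pz_sc.
replace (_ - _)%X with x0; [rewrite nrm_x0; apply Rle_refl|].
transitivity ((cst (IZR unit_z) * cst (/ IZR scale20) - cst (IZR 4294967296)) * pz l)%X; [|ring].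
rewrite <- cst_mul, <- cst_sub; replace (_ - _) with 0; [rewrite cst_0; ring|].
rewrite unit_val; unfold scale20; lra.
Qed.

Lemma near_col_bound (c : vecz) (b : zball * zball) (x y : X) :
  near_col c b = true -> inb (fst b) x -> inb (snd b) y ->
  nrmY (minus (scal (/ IZR scale20) (vec c)) (Pair x y)) <= 39 / 10000.
Proof.
intros C Hx Hy; apply Z.leb_le, IZR_le in C; rewrite plus_IZR in C.
assert (I1 := inb_norm _ _ (inb_sub _ _ _ _ (inb_column (fst c)) Hx)).
assert (I2 := inb_norm _ _ (inb_sub _ _ _ _ (inb_column (snd c)) Hy)).
assert (S := Rplus_le_compat _ _ _ _ I1 I2); rewrite <- Rmult_plus_distr_l in S.
assert (U := unit_pos); apply Rmult_le_reg_l with (1 := U).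
change (IZR unit_z * (nrm (pf (scal (/ IZR scale20) (vec c)) - x)%X
  + nrm (pg (scal (/ IZR scale20) (vec c)) - y)%X) <= IZR unit_z * (39 / 10000)).
rewrite pf_scal, pg_scal; unfold vec; cbn [pf pg].
apply Rle_trans with (1 := S), Rle_trans with (1 := C).
rewrite unit_val; unfold eps_z; lra.
Qed.

Lemma gam_e1 (k : nat) : (k < 13)%nat -> gam (e1 k) = scal (/ IZR scale20) (vec (nth k gam_f ([], []))).
Proof.
intros L; unfold gam, e1; cbn [pf pg]; rewrite gapp_basis, gapp_x0 by exact L; f_equal.
apply plus_zero_r.
Qed.

Lemma gam_e2 (k : nat) : (k < 13)%nat -> gam (e2 k) = scal (/ IZR scale20) (vec (nth k gam_g ([], []))).
Proof.
intros L; unfold gam, e2; cbn [pf pg]; rewrite gapp_basis, gapp_x0 by exact L; f_equal.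
apply plus_zero_l.
Qed.

Lemma nrmY_zero_minus (x y : X) : nrmY (minus zero (Pair x y)) = nrm x + nrm y.
Proof.
change (nrm (x0 - x)%X + nrm (x0 - y)%X = nrm x + nrm y).
replace (x0 - x)%X with (- x)%X by ring; replace (x0 - y)%X with (- y)%X by ring.
now rewrite !nrm_opp.
Qed.

Lemma sum_le_eps (b : Z) (t : R) : (b <= eps_z)%Z -> IZR unit_z * t <= IZR b -> t <= 39 / 10000.
Proof.
intros L H; apply IZR_le in L; assert (U := unit_pos); apply Rmult_le_reg_l with (1 := U).
apply Rle_trans with (1 := H), Rle_trans with (1 := L); rewrite unit_val; unfold eps_z; lra.
Qed.

Lemma columns_near : cols_le (fun h => minus (gam h) (DT F h)) (39 / 10000).
Proof.
destruct sound as [v [C [_ I]]]; unfold check_columns in C.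
rewrite !andb_true_iff in C; destruct C as [[[[C1 C2] C3] C4] _].
cbn [forallb] in C4; rewrite !andb_true_iff in C4.
destruct C4 as [L1 [L2 [L3 [L4 [L5 [L6 _]]]]]]; apply Nat.eqb_eq in L1, L2, L3, L4, L5, L6.
assert (P : forall r x k, powers r x -> length r = 14%nat -> (k < 14)%nat -> inb (bnth k r) (x ^ k)%X).
{ intros r x k H E L; apply H; lia. }
intros k; destruct (le_lt_dec 13 k) as [L|L].
- destruct (high0_gam k L) as [E1 E2]; rewrite E1, E2; unfold DT.
  rewrite d_T1_e1, d_T2_e1, d_T1_e2, d_T2_e2, !nrmY_zero_minus.
  (* Away from column 0 the derivative of $\lambda$ is minus a power, so that all terms have the
     form $ba^k$. *)
  destruct k as [|k']; [lia|]; rewrite !d_lam_e1_S; set (k := S k') in *.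
  assert (U := unit_pos).
  assert (T : forall r x bb b, powers r x -> length r = 14%nat -> nrm x <= 1 -> inb bb b ->
    IZR unit_z * nrm (b * x ^ k)%X <= IZR (nb (bmul thr bb (bnth 13 r)))).
  { intros r x bb b H E Hx Hb; apply Rle_trans with (2 := inb_norm _ _ (inb_mul thr _ _ _ _ Hb (P r x 13%nat H E ltac:(lia)))).
    apply Rmult_le_compat_l; [lra | apply tail_power; assumption]. }
  assert (T1 := T _ _ _ _ (e_pp _ _ I) L2 N_p (e_A1 _ _ I)).
  assert (T2 := T _ _ _ _ (e_alp _ _ I) L1 N_al (e_V1 _ _ I)).
  assert (T3 := T _ _ _ _ (e_hp _ _ I) L5 N_h (e_B1 _ _ I)).
  assert (T4 := T _ _ _ _ (e_qp _ _ I) L4 N_q (e_B2 _ _ I)).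
  assert (T5 := T _ _ _ _ (e_alp _ _ I) L1 N_al (e_V2 _ _ I)).
  assert (T6 := T _ _ _ _ (e_up _ _ I) L3 N_ut (e_A2 _ _ I)).
  assert (T7 := T _ _ _ _ (e_mp _ _ I) L6 N_m (e_B3 _ _ I)).
  apply Z.leb_le in C2, C3; split.
  + apply (sum_le_eps _ _ C2); rewrite !plus_IZR.
    assert (A1 := nrm_add (dA1 F * tp F ^ k)%X (dV1 F * - tal F ^ k)%X).
    replace (dV1 F * - tal F ^ k)%X with (- (dV1 F * tal F ^ k))%X in * by ring.
    rewrite nrm_opp in A1.
    set (t := (dB1 F * th F ^ k + dB2 F * tq F ^ k + dV2 F * - tal F ^ k)%X).
    assert (A2 : nrm (xtail t) <= nrm (dB1 F * th F ^ k)%X + nrm (dB2 F * tq F ^ k)%X + nrm (dV2 F * tal F ^ k)%X).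
    { apply Rle_trans with (1 := nrm_xtail t); unfold t.
      replace (dV2 F * - tal F ^ k)%X with (- (dV2 F * tal F ^ k))%X by ring.
      apply Rle_trans with (1 := nrm_add _ _); rewrite nrm_opp; apply Rplus_le_compat_r, nrm_add. }
    assert (A := Rplus_le_compat _ _ _ _ A1 A2); apply (Rmult_le_compat_l (IZR unit_z)) in A; [|lra].
    apply Rle_trans with (1 := A); rewrite !Rmult_plus_distr_l; lra.
  + apply (sum_le_eps _ _ C3); rewrite !plus_IZR.
    assert (A2 := nrm_xtail (dB3 F * tm F ^ k)%X); apply (Rmult_le_compat_l (IZR unit_z)) in A2; [|lra].
    rewrite Rmult_plus_distr_l; lra.
- rewrite forallb_forall in C1.
  assert (J : In k (seq 0 13)) by (apply in_seq; lia).
  specialize (C1 k J); apply andb_true_iff in C1; destruct C1 as [D1 D2].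
  assert (Hl : inb (dlam v k) (d_lam F (e1 k))).
  { destruct k as [|k]; [rewrite d_lam_e1_0; apply (e_dl0 _ _ I)|].
    rewrite d_lam_e1_S; apply inb_neg; apply P; [apply (e_alp _ _ I) | exact L1 | lia]. }
  split; [rewrite gam_e1 by exact L | rewrite gam_e2 by exact L]; unfold DT.
  + apply (near_col_bound _ _ _ _ D1); unfold col_f; cbn [fst snd].
    * rewrite d_T1_e1; apply inb_add; apply inb_mul; try exact Hl;
      [apply (e_A1 _ _ I) | apply P; [apply (e_pp _ _ I) | exact L2 | lia] | apply (e_V1 _ _ I)].
    * rewrite d_T2_e1; apply inb_tail; apply inb_add; [apply inb_add|]; apply inb_mul; try exact Hl;
      [apply (e_B1 _ _ I) | apply P; [apply (e_hp _ _ I) | exact L5 | lia] |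
       apply (e_B2 _ _ I) | apply P; [apply (e_qp _ _ I) | exact L4 | lia] | apply (e_V2 _ _ I)].
  + apply (near_col_bound _ _ _ _ D2); unfold col_g; cbn [fst snd].
    * rewrite d_T1_e2; apply inb_mul; [apply (e_A2 _ _ I) | apply P; [apply (e_up _ _ I) | exact L3 | lia]].
    * rewrite d_T2_e2; apply inb_tail, inb_mul; [apply (e_B3 _ _ I) | apply P; [apply (e_mp _ _ I) | exact L6 | lia]].
Qed.

Lemma til_near : nrm (til F) <= 5.
Proof.
destruct sound as [v [C [_ I]]]; unfold check_columns in C.
rewrite !andb_true_iff in C; destruct C as [_ C]; apply Z.leb_le, IZR_le in C.
assert (N := inb_norm _ _ (e_il _ _ I)); rewrite mult_IZR in C.
assert (U := unit_pos); nra.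
Qed.

End NearBall.

(** * The Lorenz map *)

Fixpoint pev (l : list Z) (t : R) : R :=
  match l with [] => 0 | c :: l' => IZR c + t * pev l' t end.

Lemma PSeries_pz (l : list Z) (t : R) : Rabs t <= 1 ->
  PSeries (cst (/ IZR unit_z) * pz l)%X t = pev l t / IZR unit_z.
Proof.
intros Ht; assert (Hw : Cmod (RtoC t) <= 1) by (rewrite Cmod_R; exact Ht).
assert (E : evalC (pz l) (RtoC t) = RtoC (pev l t)).
{ induction l as [|c l IH]; cbn [pz pev]; [apply evalC_x0, Hw|].
  rewrite evalC_xadd, evalC_xmul, evalC_cst, evalC_xw, IH by exact Hw.
  rewrite RtoC_plus, RtoC_mult; reflexivity. }
apply RtoC_inj; rewrite <- evalC_PSeries, evalC_xmul, evalC_cst, E by exact Hw.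
rewrite <- RtoC_mult; f_equal; unfold Rdiv; ring.
Qed.

Lemma pev_continuous (l : list Z) (t : R) : continuous (pev l) t.
Proof.
induction l as [|c l IH]; cbn [pev]; [apply continuous_const|].
apply (continuous_plus (fun _ => IZR c) (fun t => t * pev l t)); [apply continuous_const|].
apply (continuous_mult (fun t => t) (pev l)); [apply continuous_id | exact IH].
Qed.

(** Integer bounds of [sum |c_k| 2^-k] and [sum k |c_k| 2^-(k-1)]. *)
Fixpoint half_norm (l : list Z) : Z :=
  match l with [] => 0%Z | c :: l' => (Z.abs c + (half_norm l' / 2 + 1))%Z end.

Fixpoint half_slope (l : list Z) : Z :=
  match l with [] => 0%Z | _ :: l' => (half_norm l' + (half_slope l' / 2 + 1))%Z end.

Lemma half_up (a : Z) : / 2 * IZR a <= IZR (a / 2 + 1).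
Proof.
assert (H := Z.mul_succ_div_gt a 2 ltac:(lia)).
assert (H' : (a <= 2 * (a / 2 + 1))%Z) by lia.
apply IZR_le in H'; rewrite mult_IZR in H'; lra.
Qed.

Lemma half_norm_bound (l : list Z) (t : R) : Rabs t <= / 2 -> Rabs (pev l t) <= IZR (half_norm l).
Proof.
intros Ht; induction l as [|c l IH]; cbn [pev half_norm]; [rewrite Rabs_R0; apply Rle_refl|].
rewrite plus_IZR, abs_IZR; apply Rle_trans with (1 := Rabs_triang _ _), Rplus_le_compat_l.
apply Rle_trans with (2 := half_up _); rewrite Rabs_mult.
apply Rmult_le_compat; try apply Rabs_pos; assumption.
Qed.

(** The Horner step $yq(y)-xq(x)=(y-x)q(x)+y(q(y)-q(x))$, where $|y|\le1/2$ halves the slope already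
    found for $q$. *)
Lemma half_slope_bound (l : list Z) (x y : R) : Rabs x <= / 2 -> Rabs y <= / 2 ->
  Rabs (pev l y - pev l x) <= IZR (half_slope l) * Rabs (y - x).
Proof.
intros Hx Hy; induction l as [|c l IH]; cbn [pev half_slope].
- replace (0 - 0) with 0 by ring; rewrite Rabs_R0; lra.
- replace (IZR c + y * pev l y - (IZR c + x * pev l x)) with
    ((y - x) * pev l x + y * (pev l y - pev l x)) by ring.
  rewrite plus_IZR, Rmult_plus_distr_r.
  apply Rle_trans with (1 := Rabs_triang _ _), Rplus_le_compat; rewrite Rabs_mult.
  + rewrite Rmult_comm; apply Rmult_le_compat_r; [apply Rabs_pos | apply half_norm_bound, Hx].
  + apply Rle_trans with (/ 2 * (IZR (half_slope l) * Rabs (y - x))).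
    * apply Rmult_le_compat; try apply Rabs_pos; assumption.
    * rewrite <- Rmult_assoc; apply Rmult_le_compat_r; [apply Rabs_pos | apply half_up].
Qed.

(* Monotonicity is decided by comparing the linear coefficient with the slope of the rest. *)
Lemma pev_increasing (a b : Z) (l : list Z) (x y : R) :
  (half_slope (a :: 0%Z :: l) < b)%Z -> Rabs x <= / 2 -> Rabs y <= / 2 -> x < y ->
  pev (a :: b :: l) x < pev (a :: b :: l) y.
Proof.
intros Hb Hx Hy L.
assert (S := half_slope_bound (a :: 0%Z :: l) x y Hx Hy).
rewrite (Rabs_pos_eq (y - x)) in S by lra; apply IZR_lt in Hb.
apply Rabs_le_between in S; cbn [pev] in *; nra.
Qed.

Lemma pev_decreasing (a b : Z) (l : list Z) (x y : R) :
  (half_slope (a :: 0%Z :: l) < - b)%Z -> Rabs x <= / 2 -> Rabs y <= / 2 -> x < y ->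
  pev (a :: b :: l) y < pev (a :: b :: l) x.
Proof.
intros Hb Hx Hy L.
assert (S := half_slope_bound (a :: 0%Z :: l) x y Hx Hy).
rewrite (Rabs_pos_eq (y - x)) in S by lra; apply IZR_lt in Hb; rewrite opp_IZR in Hb.
apply Rabs_le_between in S; cbn [pev] in *; nra.
Qed.

Definition fv (t : R) : R := pev f0z t / IZR unit_z.
(** [hv] is $tg(t)$. With $t=z/\tau=2z$ the right branch $-1+zg(z/\tau)$ becomes $-1+tg(t)/2$, so
    its monotonicity concerns a single polynomial. *)
Definition hv (t : R) : R := pev (0%Z :: g0z) t / IZR unit_z.
(** The right end is forced: it is the left limit $\varphi(0)=f(-1/s)$ at the origin. *)
Definition r0 : R := fv (- (5 / 11)).

Lemma fv_decreasing (x y : R) : Rabs x <= / 2 -> Rabs y <= / 2 -> x < y -> fv y < fv x.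
Proof.
intros Hx Hy L; unfold fv; apply Rmult_lt_compat_r; [apply Rinv_0_lt_compat, unit_pos|].
unfold f0z; apply pev_decreasing; try assumption; reflexivity.
Qed.

Lemma hv_increasing (x y : R) : Rabs x <= / 2 -> Rabs y <= / 2 -> x < y -> hv x < hv y.
Proof.
intros Hx Hy L; unfold hv; apply Rmult_lt_compat_r; [apply Rinv_0_lt_compat, unit_pos|].
unfold g0z; apply pev_increasing; try assumption; reflexivity.
Qed.

Lemma r0_bounds : 45 / 100 < r0 < 46 / 100.
Proof. unfold r0, fv; rewrite unit_val; cbn [pev f0z]; split; lra. Qed.

(** The least value of the left branch, attained at $x=-1$, is $\varphi(1)=f(0)$. *)
Lemma fv_0 : -1 < fv 0.
Proof. unfold fv; rewrite unit_val; cbn [pev f0z]; lra. Qed.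

Lemma hv_0 : hv 0 = 0.
Proof. unfold hv; cbn [pev]; unfold Rdiv; ring. Qed.

(** From $r<0.46$ follows $2r^2<0.43$, and the stated value keeps the right branch below
    $0.45<r$. *)
Lemma hv_top : / 2 * hv (43 / 100) < 1 + 45 / 100.
Proof. unfold hv; rewrite unit_val; cbn [pev g0z]; lra. Qed.

Definition lorenz0 (x : R) : R :=
  if Rlt_dec x 0 then fv ((x ^ 2 - 1) / s) else -1 + / 2 * hv (2 * x ^ 2).

(** This and [arg_g] confine the arguments of both branches to $|t|\le1/2$, where the slope bounds
    hold. *)
Lemma arg_f (x : R) : -1 <= x <= 0 -> - (5 / 11) <= (x ^ 2 - 1) / s <= 0.
Proof. intros H; unfold s; nra. Qed.

Lemma arg_g (x : R) : 0 <= x <= r0 -> 0 <= 2 * x ^ 2 <= 43 / 100.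
Proof. intros H; assert (B := r0_bounds); nra. Qed.

Lemma half_abs (t : R) : - / 2 <= t <= / 2 -> Rabs t <= / 2.
Proof. apply Rabs_le. Qed.

Lemma lorenz0_neg (x : R) : x < 0 -> lorenz0 x = fv ((x ^ 2 - 1) / s).
Proof. intros H; unfold lorenz0; destruct (Rlt_dec x 0); [reflexivity | contradiction]. Qed.

Lemma lorenz0_pos (x : R) : 0 < x -> lorenz0 x = -1 + / 2 * hv (2 * x ^ 2).
Proof. intros H; unfold lorenz0; destruct (Rlt_dec x 0); [lra | reflexivity]. Qed.

Lemma left_continuous (x : R) : continuous (fun x => fv ((x ^ 2 - 1) / s)) x.
Proof.
apply (continuous_comp (fun x => (x ^ 2 - 1) / s) fv).
- apply (@ex_derive_continuous R_AbsRing R_NormedModule); unfold s; auto_derive; exact I.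
- apply (continuous_mult (pev f0z) (fun _ => / IZR unit_z)); [apply pev_continuous | apply continuous_const].
Qed.

Lemma right_continuous (x : R) : continuous (fun x => -1 + / 2 * hv (2 * x ^ 2)) x.
Proof.
apply (continuous_plus (fun _ => -1) (fun x => / 2 * hv (2 * x ^ 2))); [apply continuous_const|].
apply (continuous_mult (fun _ => / 2) (fun x => hv (2 * x ^ 2))); [apply continuous_const|].
apply (continuous_comp (fun x => 2 * x ^ 2) hv).
- apply (@ex_derive_continuous R_AbsRing R_NormedModule); auto_derive; exact I.
- apply (continuous_mult (pev (0%Z :: g0z)) (fun _ => / IZR unit_z)); [apply pev_continuous | apply continuous_const].
Qed.

Lemma fv_le (x y : R) : Rabs x <= / 2 -> Rabs y <= / 2 -> x <= y -> fv y <= fv x.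
Proof. intros Hx Hy [L|E]; [left; apply fv_decreasing; assumption | subst; right; reflexivity]. Qed.

Lemma hv_le (x y : R) : Rabs x <= / 2 -> Rabs y <= / 2 -> x <= y -> hv x <= hv y.
Proof. intros Hx Hy [L|E]; [left; apply hv_increasing; assumption | subst; right; reflexivity]. Qed.

Lemma lorenz0_is_Lorenz : is_Lorenz_map r0 lorenz0.
Proof.
assert (B := r0_bounds).
split; [lra|]; split; [|split; [|split; [|split; [|split]]]].
- intros x [[H1 H2] H0]; destruct (Rlt_dec x 0) as [N|N].
  + rewrite lorenz0_neg by exact N; assert (A := arg_f x ltac:(lra)); split.
    * apply Rle_trans with (fv 0); [left; apply fv_0 | apply fv_le; [apply half_abs; lra | apply half_abs; lra | apply A]].
    * apply fv_le; [apply half_abs; lra | apply half_abs; lra | apply A].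
  + rewrite lorenz0_pos by lra; assert (A := arg_g x ltac:(lra)).
    assert (L1 : hv 0 <= hv (2 * x ^ 2)) by (apply hv_le; [apply half_abs; lra | apply half_abs; lra | apply A]).
    assert (L2 : hv (2 * x ^ 2) <= hv (43 / 100)) by (apply hv_le; [apply half_abs; lra | apply half_abs; lra | apply A]).
    rewrite hv_0 in L1; assert (T := hv_top); lra.
(* The origin is excluded, so near each point one of the two formulas is valid. *)
- intros x [_ H0]; eapply filterlim_filter_le_1; [apply filter_le_within|].
  destruct (Rlt_dec x 0) as [N|N].
  + apply (continuous_ext_loc _ (fun x => fv ((x ^ 2 - 1) / s))); [|apply left_continuous].
    apply (locally_interval _ x m_infty 0); [exact Logic.I | exact N|].
    intros y _ Hy; symmetry; apply lorenz0_neg, Hy.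
  + apply (continuous_ext_loc _ (fun x => -1 + / 2 * hv (2 * x ^ 2))); [|apply right_continuous].
    apply (locally_interval _ x 0 p_infty); [simpl; lra | exact Logic.I|].
    intros y Hy _; symmetry; apply lorenz0_pos, Hy.
- intros x y H1 H2 H3; rewrite !lorenz0_neg by lra.
  assert (A := arg_f x ltac:(lra)); assert (A' := arg_f y ltac:(lra)).
  apply fv_decreasing; [apply half_abs; lra | apply half_abs; lra|].
  unfold s; nra.
- intros x y H1 H2 H3; rewrite !lorenz0_pos by lra.
  assert (A := arg_g x ltac:(lra)); assert (A' := arg_g y ltac:(lra)).
  assert (L : hv (2 * x ^ 2) < hv (2 * y ^ 2)); [|lra].
  apply hv_increasing; [apply half_abs; lra | apply half_abs; lra | nra].
(* Each formula is continuous across 0, so that the one-sided limits are its values there. *)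
- apply filterlim_ext_loc with (fun x => fv ((x ^ 2 - 1) / s)).
  + exists (mkposreal 1 Rlt_0_1); intros y _ Hy; symmetry; apply lorenz0_neg, Hy.
  + eapply filterlim_filter_le_1; [apply filter_le_within|].
    replace r0 with (fv ((0 ^ 2 - 1) / s)); [apply left_continuous|].
    unfold r0; f_equal; unfold s; field.
- apply filterlim_ext_loc with (fun x => -1 + / 2 * hv (2 * x ^ 2)).
  + exists (mkposreal 1 Rlt_0_1); intros y _ Hy; symmetry; apply lorenz0_pos, Hy.
  + eapply filterlim_filter_le_1; [apply filter_le_within|].
    assert (E : -1 + / 2 * hv (2 * 0 ^ 2) = -1) by (replace (2 * 0 ^ 2) with 0 by ring; rewrite hv_0; ring).
    assert (Q := right_continuous 0); unfold continuous in Q; rewrite E in Q; exact Q.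
Qed.

Lemma F0_represents : represents_Lorenz_map F0.
Proof.
exists r0, lorenz0; split; [exact lorenz0_is_Lorenz|]; assert (B := r0_bounds); split; intros x Hx.
- assert (A := arg_f x ltac:(lra)); split.
  + unfold s in *; apply Rabs_lt_between; nra.
  + rewrite lorenz0_neg by lra; unfold phi; cbn [pf F0]; unfold f0.
    rewrite PSeries_pz by (apply Rabs_le; lra); reflexivity.
- assert (A := arg_g x ltac:(lra)); split.
  + unfold tau; rewrite Rabs_pos_eq; lra.
  + rewrite lorenz0_pos by lra; unfold psi; cbn [pg F0]; unfold g0.
    replace (x ^ 2 / tau) with (2 * x ^ 2) by (unfold tau; field).
    rewrite PSeries_pz by (apply Rabs_le; lra); unfold hv; cbn [pev]; field.
    assert (U := unit_pos); lra.
Qed.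

(** * The theorem *)

(** The resolvent at $z=1$. The operator $\Gamma-I$ preserves real pairs and commutes with taking
    real parts, so the real part of the complex inverse, restricted to real pairs, inverts it with
    the same bound. *)
Lemma real_inverse : exists J : Y -> Y,
  is_inverse (fun H : Y => minus (gam H) H) J /\ forall F, nrmY (J F) <= 36 * nrmY F.
Proof.
destruct (resolvent (RtoC 1) Cmod_1) as [J [[[Jp Js _] [J1 J2]] JB]].
assert (SR : forall F : Y, shifted (RtoC 1) (join F zero) = join (minus (gam F) F) zero).
{ intros F; unfold shifted; rewrite (cplx_real _ _ opY_gam); apply co_ext; intros b n.
  rewrite co_minus, co_scal; destruct b; apply injective_projections; simpl;
  change (@zero _) with 0; unfold plus, opp; simpl; ring. }
assert (RS : forall H : YC, minus (gam (ReY H)) (ReY H) = ReY (shifted (RtoC 1) H)).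
{ intros H; unfold shifted; apply pair_eq; apply l1_eq; intros n; simpl;
  unfold minus, plus, opp, Re; simpl; unfold Re; simpl; ring. }
set (K := fun F : Y => ReY (J (join F zero))).
assert (KB : forall F, nrmY (K F) <= 36 * nrmY F).
{ intros F; unfold K; apply Rle_trans with (1 := nrmY_ReY _), Rle_trans with (1 := JB _).
  rewrite nYC_join_0; apply Rle_refl. }
exists K; split; [|exact KB]; split; [|split].
- split.
  + intros F G; unfold K; rewrite <- ReY_plus, <- Jp; do 2 f_equal.
    apply co_ext; intros b n; rewrite co_plus; destruct b; apply injective_projections; simpl; try reflexivity; symmetry; apply Rplus_0_l.
  + intros c F; unfold K.
    assert (E : join (scal c F) zero = scal (RtoC c) (join F zero)).
    { rewrite join_scal; change (Re (RtoC c)) with c; change (Im (RtoC c)) with 0; f_equal; yring. }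
    rewrite E, Js, ReY_scal; change (Re (RtoC c)) with c; change (Im (RtoC c)) with 0; yring.
  + exists 36; split; [lra | exact KB].
- intros F; unfold K; rewrite <- SR, J1; apply ReY_join.
- intros F; unfold K; rewrite RS, J2; apply ReY_join.
Qed.

Lemma expi_mod (t : R) : Cmod (expi t) = 1.
Proof.
unfold Cmod, expi; cbn [fst snd]; rewrite <- sqrt_1; f_equal.
assert (H := sin2_cos2 t); unfold Rsqr in H; lra.
Qed.

Lemma opnorm_lt {K : AbsRing} {V W : NormedModule K} (A : V -> W) (b c : R) :
  (forall x, norm x <= 1 -> norm (A x) <= b) -> b < c -> Rbar_lt (opnorm A) c.
Proof.
intros H L; apply Rbar_le_lt_trans with b; [|exact L].
apply (proj2 (Lub_Rbar_correct _)); intros m [x [Hx E]]; subst m; exact (H x Hx).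
Qed.

(** * Derivatives and bounds on the ball around [F0] *)

Section NearF0.

Variable F : Y.
Hypothesis HF : norm (minus F F0) <= / 10 ^ 7.

Let near (h : Y) : nrmY h <= / 10 ^ 8 -> nrmY (minus (plus F h) F0) <= 11 / 10 ^ 8.
Proof.
intros Hh; change (nrmY (minus F F0) <= / 10 ^ 7) in HF.
replace (minus (plus F h) F0) with (plus (minus F F0) h) by yring.
apply Rle_trans with (1 := nrmY_plus _ _); lra.
Qed.

Let HF' : nrmY (minus F F0) <= 11 / 10 ^ 8.
Proof. change (nrmY (minus F F0) <= / 10 ^ 7) in HF; lra. Qed.

Let nice (h : Y) : nrmY h <= / 10 ^ 8 -> good (plus F h) /\ nrm (til (plus F h)) <= 5.
Proof. intros Hh; split; [apply good_near | apply til_near]; apply near, Hh. Qed.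

Let delta_pos : 0 < / 10 ^ 8.
Proof. lra. Qed.

Lemma T_differentiable : filterdiff T (locally F) (DT F).
Proof. exact (filterdiff_T F 5 _ delta_pos nice). Qed.

Lemma opY_DT : opY (DT F).
Proof.
destruct (qd_tT1 F 5 _ delta_pos nice) as [[a1 s1 [M [M0 b1]]] _].
destruct (qd_tT2 F 5 _ delta_pos nice) as [[a2 s2 [N [N0 b2]]] _].
split.
- intros h k; apply pair_eq; [apply a1 | apply a2].
- intros c h; apply pair_eq; [rewrite pf_scal; apply s1 | rewrite pg_scal; apply s2].
- exists (M + N); split; [lra|]; intros h; rewrite Rmult_plus_distr_r.
  exact (Rplus_le_compat _ _ _ _ (b1 h) (b2 h)).
Qed.

Lemma opY_residual : opY (fun h => minus (gam h) (DT F h)).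
Proof. apply opY_minus; [apply opY_gam | apply opY_DT]. Qed.

Lemma newton_differentiable : exists DPhi : Y -> Y,
  filterdiff (Newton gam) (locally F) DPhi /\ Rbar_lt (opnorm DPhi) (Finite (2 / 10)).
Proof.
destruct real_inverse as [J [HJ JB]].
exists (fun h => J (minus (gam h) (DT F h))); split.
- apply filterdiff_ext with (fun G => J (minus (gam G) (T G))).
  (* The chosen inverse agrees with the explicit [J], which is bounded and linear and thus its own
     derivative. *)
  { intros G; symmetry; apply (inv_op_unique (fun H : Y => minus (gam H) H) J HJ). }
  apply (filterdiff_comp' (fun G => minus (gam G) (T G)) J F (fun h => minus (gam h) (DT F h)) J).
  + apply (filterdiff_minus_fct gam T gam (DT F)); [|apply T_differentiable].
    apply filterdiff_linear; destruct opY_gam as [a s [M [M0 b]]]; split; [exact a | exact s|].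
    exists (M + 1); split; [lra|]; intros h; apply Rle_trans with (1 := b h).
    apply Rmult_le_compat_r; [apply nrmY_ge0 | lra].
  + apply filterdiff_linear, HJ.
- apply opnorm_lt with (36 * (39 / 10000)); [|lra].
  intros h Hh; apply Rle_trans with (1 := JB _); apply Rmult_le_compat_l; [lra|].
  apply Rle_trans with (1 := real_bound _ _ h opY_residual (columns_near F HF')).
  rewrite <- (Rmult_1_r (39 / 10000)) at 2; apply Rmult_le_compat_l; [lra | exact Hh].
Qed.

Lemma resolvent_near (t : R) :
  invertible (shifted (expi t)) /\
  Rbar_lt (opnorm (fun H : YC =>
    inv_op (shifted (expi t)) (cplx (fun h : Y => minus (gam h) (DT F h)) H))) (Finite (9 / 10)).
Proof.
destruct (resolvent (expi t) (expi_mod t)) as [J [HJ JB]]; split; [exists J; exact HJ|].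
apply opnorm_lt with (36 * (39 / 10000)); [|lra].
intros H HH; rewrite (inv_op_unique _ J HJ).
apply Rle_trans with (1 := JB _); apply Rmult_le_compat_l; [lra|].
apply Rle_trans with (1 := cplx_bound _ _ H opY_residual (columns_near F HF')).
rewrite <- (Rmult_1_r (39 / 10000)) at 2; apply Rmult_le_compat_l; [lra | exact HH].
Qed.

End NearF0.

Lemma newton_step : norm (minus (Newton gam F0) F0) < 5 / 10 ^ 9.
Proof.
destruct real_inverse as [J [HJ JB]].
unfold Newton; rewrite (inv_op_unique _ J HJ).
destruct HJ as [[Jp Js _] [J1 J2]].
(* Writing $F_0=J(\Gamma F_0-F_0)$ cancels $\Gamma F_0$, and only the residual $TF_0-F_0$ is left
   under [J]. *)
assert (E : minus (J (minus (gam F0) (T F0))) F0 = scal (-1) (J (minus (T F0) F0))).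
{ assert (Jm : forall a b, minus (J a) (J b) = J (minus a b)).
  { intros a b.
    assert (Q : J a = plus (J (minus a b)) (J b)).
    { rewrite <- Jp; f_equal; yring. }
    rewrite Q; yring. }
  transitivity (minus (J (minus (gam F0) (T F0))) (J (minus (gam F0) F0))).
  - exact (f_equal (fun x : Y => minus (J (minus (gam F0) (T F0))) x) (eq_sym (J1 F0))).
  - rewrite Jm, <- Js; f_equal; yring;
      change (IZR (-1)) with (- (1)); rewrite cst_opp; change (cst 1) with x1; ring. }
change (nrmY (minus (J (minus (gam F0) (T F0))) F0) < 5 / 10 ^ 9).
rewrite E, nrmY_scal; replace (Rabs (-1)) with 1 by (rewrite Rabs_left; lra); rewrite Rmult_1_l.
assert (Q := residual_F0); assert (Q' := JB (minus (T F0) F0)); lra.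
Qed.

Theorem theorem5p3 :
  exists (F0 : Y) (M : @matrix R (2 * d) (2 * d)),
    let Gam : Y -> Y := mat_op M in
    let B : Y -> Prop := fun F => norm (minus F F0) <= / 10 ^ 7 in
    let GamZ : R -> YC -> YC :=
      fun t H => minus (cplx Gam H) (scal (expi t) H) in
    represents_Lorenz_map F0 /\
    (forall F : Y, B F -> T_defined F) /\
    invertible (fun H : Y => minus (Gam H) H) /\
    (forall F : Y, B F ->
      exists DPhi : Y -> Y,
        filterdiff (Newton Gam) (locally F) DPhi /\
        Rbar_lt (opnorm DPhi) (Finite (2 / 10))) /\
    norm (minus (Newton Gam F0) F0) < 5 / 10 ^ 9 /\
    (forall (t : R) (F : Y), B F ->
      exists DT : Y -> Y,
        filterdiff T (locally F) DT /\
        invertible (GamZ t) /\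
        Rbar_lt
          (opnorm (fun H : YC =>
             inv_op (GamZ t) (cplx (fun h : Y => minus (Gam h) (DT h)) H)))
          (Finite (9 / 10))).
Proof.
exists F0, gam_matrix; rewrite mat_op_gam; cbv zeta.
split; [exact F0_represents|]; split; [|split; [|split; [|split]]].
- intros F HF; apply T_defined_good, good_near.
  change (nrmY (minus F F0) <= / 10 ^ 7) in HF; lra.
- destruct real_inverse as [J [HJ _]]; exists J; exact HJ.
- intros F HF; apply newton_differentiable, HF.
- exact newton_step.
- intros t F HF; exists (DT F); split; [apply T_differentiable, HF | apply resolvent_near, HF].
Qed.
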